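(* Let $p$ be a prime. Given $k$ polynomials $p_1,\ldots,p_k\in\mathbb{F}_p[x_1,\ldots,x_n]$, each of degree at most $d$, the quantity $\sum_{x\in\{0,1\}^n}\prod_{i=1}^kp_i(x)$, where each $p_i(x)$ is identified with an integer in $\{0,1,\ldots,p-1\}$ and the products and sum are taken over the integers, can be computed in $p^{2k}\cdot(1.9^n+2^{n-n/(6dp)})\cdot\mathrm{poly}(n)$ time.
   Formalization: The stated time is proved for multilinear polynomials; for arbitrary ones the bit length of the input is added to 1.9^n-type bound before the poly(n) factor, since with unbounded d the input can be longer than the bound. Also d is at least 1. *)

(* Defs.v *)
From Stdlib Require Import Reals.
From mathcomp Require Import all_boot all_order all_algebra.
From mathcomp Require Import mpoly.

Set Implicit Arguments.
Unset Strict Implicit.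
Unset Printing Implicit Defensive.

Local Open Scope nat_scope.

(** * Random access machine with logarithmic cost

    Structured programs over an unbounded memory of natural numbers, with
    indirect addressing and a one-way input stream.  Every value and every
    address that is handled is charged its bit length, and multiplication and
    division are charged the product of the bit lengths of their operands, so
    that cost is within a polynomial of Turing machine time, with no unit-cost
    operation on long integers. *)

(* [trunc_log 2 0 = 0], so [bitlen 0 = 1]. *)
Definition bitlen (v : nat) : nat := (trunc_log 2 v).+1.

Inductive binop := Add | Sub | Mul | Div | Mod.

(* Truncated subtraction also serves as the comparison test. *)
Definition binop_val (o : binop) (a b : nat) : nat :=
  match o with
  | Add => a + b
  | Sub => a - b
  | Mul => a * b
  | Div => a %/ b
  | Mod => a %% b
  end.

Definition binop_cost (o : binop) (a b : nat) : nat :=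
  match o with
  | Add | Sub => bitlen a + bitlen b
  | Mul | Div | Mod => bitlen a * bitlen b
  end.

(* [Get e] is the content of the cell whose address is the value of [e]. *)
Inductive expr :=
  | Lit of nat
  | Get of expr
  | Bin of binop & expr & expr.

Definition memory := nat -> nat.

Fixpoint expr_val (m : memory) (e : expr) : nat :=
  match e with
  | Lit v => v
  | Get e1 => m (expr_val m e1)
  | Bin o e1 e2 => binop_val o (expr_val m e1) (expr_val m e2)
  end.

Fixpoint expr_cost (m : memory) (e : expr) : nat :=
  match e with
  | Lit v => bitlen v
  | Get e1 =>
      expr_cost m e1 + bitlen (expr_val m e1) + bitlen (m (expr_val m e1))
  | Bin o e1 e2 =>
      expr_cost m e1 + expr_cost m e2
      + binop_cost o (expr_val m e1) (expr_val m e2)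
  end.

(* [Store a e] writes the value of [e] at address [a]; [Read a] consumes the
   next input number and writes it at address [a].  [If] and [While] test
   whether the value of their guard is nonzero. *)
Inductive program :=
  | Skip
  | Store of expr & expr
  | Read of expr
  | Seq of program & program
  | If of expr & program & program
  | While of expr & program.

Definition update (m : memory) (a v : nat) : memory :=
  fun b => if b == a then v else m b.

(* [exec P m s T m' s']: started in memory [m] with remaining input [s], the
   program [P] halts at total cost [T] in memory [m'] with remaining input
   [s'].  Reading past the end of the input gives 0. *)
Inductive exec :
    program -> memory -> seq nat -> nat -> memory -> seq nat -> Prop :=
  | ExecSkip m s : exec Skip m s 1 m s
  | ExecStore a e m s :
      exec (Store a e) m s
        (expr_cost m a + expr_cost m e
         + bitlen (expr_val m a) + bitlen (expr_val m e))
        (update m (expr_val m a) (expr_val m e)) s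
  | ExecRead a m s :
      exec (Read a) m s
        (expr_cost m a + bitlen (expr_val m a) + bitlen (head 0 s))
        (update m (expr_val m a) (head 0 s)) (behead s)
  | ExecSeq P1 P2 m0 s0 T1 m1 s1 T2 m2 s2 :
      exec P1 m0 s0 T1 m1 s1 -> exec P2 m1 s1 T2 m2 s2 ->
      exec (Seq P1 P2) m0 s0 (T1 + T2) m2 s2
  | ExecIfTrue e P1 P2 m s T m' s' :
      expr_val m e != 0 -> exec P1 m s T m' s' ->
      exec (If e P1 P2) m s ((expr_cost m e).+1 + T) m' s'
  | ExecIfFalse e P1 P2 m s T m' s' :
      expr_val m e = 0 -> exec P2 m s T m' s' ->
      exec (If e P1 P2) m s ((expr_cost m e).+1 + T) m' s'
  | ExecWhileTrue e P m0 s0 T1 m1 s1 T2 m2 s2 :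
      expr_val m0 e != 0 ->
      exec P m0 s0 T1 m1 s1 -> exec (While e P) m1 s1 T2 m2 s2 ->
      exec (While e P) m0 s0 ((expr_cost m0 e).+1 + T1 + T2) m2 s2
  | ExecWhileFalse e P m s :
      expr_val m e = 0 ->
      exec (While e P) m s (expr_cost m e).+1 m s.

(* The memory is initially zero and the result is left in cell 0. *)
Definition computes_in (P : program) (inp : seq nat) (out T : nat) : Prop :=
  exists m s, exec P (fun=> 0) inp T m s /\ m 0 = out.

(** * The problem *)

Section Problem.

Variables (p k n : nat) (f : 'I_k -> {mpoly 'F_p[n]}).

(* For [p] prime, the carrier of ['F_p] is {0, ..., p - 1}; the coercion to
   [nat] is the identification with integers. *)
Definition cube_value (i : 'I_k) (x : {ffun 'I_n -> bool}) : nat :=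
  ((f i).@[fun j => ((x j : nat)%:R)%R] : 'F_p).

Definition sum_product : nat :=
  \sum_(x : {ffun 'I_n -> bool}) \prod_(i < k) cube_value i x.

(* A polynomial is given by its nonzero terms; each term is written as the flag
   1, the coefficient and the [n] exponents, and the list of terms is closed by
   the flag 0. *)
Definition encode_term (i : 'I_k) (m : 'X_{1..n}) : seq nat :=
  [:: 1, (((f i)@_m)%R : nat) & [seq m j | j <- enum 'I_n]].

Definition encode_poly (i : 'I_k) : seq nat :=
  rcons (flatten [seq encode_term i m | m <- msupp (f i)]) 0.

Definition encode_input : seq nat :=
  [:: n, k, p & flatten [seq encode_poly i | i <- enum 'I_k]].

(* Bit size of the lists of terms, an element of ['F_p] taking [bitlen p]
   bits. *)
Definition input_bits : nat :=
  \sum_(i < k) \sum_(m <- msupp (f i)) (bitlen p + \sum_(j < n) bitlen (m j)).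

Definition multilinear_input : Prop :=
  forall i m, m \in msupp (f i) -> forall j, m j <= 1.

End Problem.

(** * The time bound *)

Section TimeBound.

Local Open Scope R_scope.

Definition time_bound (p k d n : nat) : R :=
  INR p ^ (2 * k)%N
  * ((19 / 10) ^ n
     + Rpower 2 (INR n - INR n / (6 * INR d * INR p))).

(* Every polynomial in [n] is at most [poly_factor c n] for some [c]. *)
Definition poly_factor (c n : nat) : R := INR (c * n.+1 ^ c)%N.

Definition time_le (T : nat) (b : R) : Prop := INR T <= b.

End TimeBound.

(* Main.v *)
(** The integer [a mod p] is a [p]-periodic function of [a], so by Fleck's
    congruence its [j]-th difference at 0 is divisible by
    [p ^ ((j - 1) / (p - 1))].  Expanding [prod_i (p_i(x) mod p)] monomial by
    monomial with these differences, every contribution of degree more than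
    [d (p - 1) (L + k - 1)] in [x] vanishes modulo [p ^ L].  Hence, for
    [m = n / (6 d p)] and [2 ^ m <= p ^ (L - k)], the partial sums
    [H(x) = sum_y prod_i (p_i(x, y) mod p)] over the last [m] variables are
    smaller than [p ^ L] and agree modulo [p ^ L] with a polynomial of that
    degree [D] in the first [n - m] variables.

    The program computes [H] on the points of weight at most [D] (evaluating
    each [p_i] by a subset-sum transform restricted to these points), recovers
    the coefficients by Moebius inversion modulo [p ^ L], and evaluates the
    polynomial everywhere by a second subset-sum transform, in time about
    [2 ^ (n - m)] plus [2 ^ m] times the number of points of weight at most [D].
    If [3 (D + m) <= n] the latter is at most [1.9 ^ n]; otherwise
    [p ^ (2 k) >= 2 ^ m], and the program takes [m = 0] and [D = n] instead,
    which is brute force. *)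
Require Import Defs.
From Stdlib Require Import Reals Lra.
From mathcomp Require Import all_boot all_order all_algebra.
From mathcomp Require Import mpoly.
From mathcomp Require Import zify ring.

Set Implicit Arguments.
Unset Strict Implicit.
Unset Printing Implicit Defensive.
Import GRing.Theory.

(** * Bits of natural numbers and subset transforms *)

(** The bound allows a polynomial factor in [n] only, while the numbers handled have about [k log p]
    bits, so every factor polynomial in [k log p] has to disappear into [p ^ (2 k)]. This shapes the
    cost analysis. With [k = 0] the program must answer before it even reads [p]. The terms of the
    input are read with additions and subtractions alone, at a cost linear in [log p] and
    independent of [k]. In the brute-force case [2 ^ m] may already use up all of [p ^ (2 k)], so
    the bit lengths are absorbed by a case distinction on whether they exceed [n]. The degree [d] is
    not part of the input either: the program takes the largest number of variables in a term (but
    at least 1), which is at most [d], and a smaller degree only improves the bound. Points of the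
    cube are binary expansions of numbers, so a subset-sum transform is a product of commuting
    one-bit steps, which can be done in place and restricted to any set closed under clearing
    bits. *)

Definition bit (z j : nat) : bool := odd (z %/ 2 ^ j).

Lemma bit_ge z j : bit z j -> 2 ^ j <= z.
Proof. by rewrite /bit; case: leqP => // /divn_small ->. Qed.

Lemma bit_sub z j i : bit z j -> bit (z - 2 ^ j) i = bit z i && (i != j).
Proof.
move=> bz; have zj := bit_ge bz; rewrite /bit.
case: (ltngtP i j) => [ij|ji|->].
- rewrite andbT; have -> : 2 ^ j = 2 ^ (j - i) * 2 ^ i by rewrite -expnD subnK // ltnW.
  rewrite divnBMl oddB; last first.
    by rewrite leq_divRL ?expn_gt0 // -expnD (subnK (ltnW ij)).
  by rewrite oddX subn_eq0 leqNgt ij /= addbF.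
- have -> : 2 ^ i = 2 ^ j * 2 ^ (i - j) by rewrite -expnD subnKC // ltnW.
  rewrite andbT !divnMA.
  rewrite -[X in (z - X) %/ _]mul1n divnBMl -(subnSK ji) expnS !divnMA.
  congr (odd (_ %/ _)); move: bz; rewrite /bit.
  by case: (z %/ 2 ^ j) => // a; rewrite subn1 /= => a_even; lia.
- rewrite andbF -[X in (z - X) %/ _]mul1n divnBMl oddB; first by move: bz; rewrite /bit => ->.
  by rewrite divn_gt0 ?expn_gt0.
Qed.

Lemma bit_small z j : z < 2 ^ j -> bit z j = false.
Proof. by move=> /divn_small zj; rewrite /bit zj. Qed.

Lemma bit_small_le z n j : z < 2 ^ n -> n <= j -> bit z j = false.
Proof. by move=> zn nj; apply: bit_small; apply: leq_trans zn _; rewrite leq_exp2l. Qed.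

Lemma bit_half z j : bit (z %/ 2) j = bit z j.+1.
Proof. by rewrite /bit expnS divnMA. Qed.

Lemma bit_low n x y j : x < 2 ^ n -> bit (x + 2 ^ n * y) j = if j < n then bit x j else bit y (j - n).
Proof.
move=> xn; rewrite /bit mulnC; case: ltnP => jn.
  have -> : 2 ^ n = 2 ^ (n - j) * 2 ^ j by rewrite -expnD subnK // ltnW.
  rewrite mulnA addnC divnMDl ?expn_gt0 //.
  by rewrite oddD oddM oddX subn_eq0 leqNgt jn /= andbF.
have -> : 2 ^ j = 2 ^ n * 2 ^ (j - n) by rewrite -expnD subnKC.
by rewrite divnMA addnC divnMDl ?expn_gt0 // (divn_small xn) addn0.
Qed.

Lemma bits_sum n z : z < 2 ^ n -> z = \sum_(j < n) bit z j * 2 ^ j.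
Proof.
elim: n z => [|n IH] z zn; first by rewrite big_ord0; move: zn; rewrite expn0; case: z.
rewrite big_ord_recl /= expn0 muln1.
have zh : z %/ 2 < 2 ^ n by rewrite ltn_divLR // -expnSr.
rewrite {1}(divn_eq z 2) {1}(IH _ zh) big_distrl /= addnC modn2 /bit expn0 divn1.
congr (_ + _); apply: eq_bigr => j _; rewrite -/(bit _ _) bit_half /bump /= add1n.
by rewrite /bit expnSr mulnA.
Qed.

Definition wt n z := \sum_(j < n) bit z j.

Lemma wt_sub n z j : bit z j -> wt n (z - 2 ^ j) <= wt n z.
Proof. by move=> bz; apply: leq_sum => i _; rewrite bit_sub //; case: (bit z i) => //; case: (_ != _). Qed.

Lemma wt_half n z : z < 2 ^ n -> wt n z = wt n (z %/ 2) + z %% 2.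
Proof.
case: n => [|n] zn.
  by rewrite /wt !big_ord0; move: zn; rewrite expn0; case: z.
rewrite /wt big_ord_recl /= [in RHS]big_ord_recr /= addnC modn2 [bit z 0]/bit expn0 divn1.
have zh : z %/ 2 < 2 ^ n by rewrite ltn_divLR // -expnSr.
rewrite (bit_small zh) addn0; congr (_ + _); apply: eq_bigr => j _.
by rewrite bit_half.
Qed.

Lemma wt_le n z : wt n z <= n.
Proof. by rewrite -[X in _ <= X]card_ord -sum1_card; apply: leq_sum => j _; case: (bit z j). Qed.

Section Transform.
Local Open Scope ring_scope.
Variable R : comNzRingType.

Definition bit_step (c : R) j (f : nat -> R) z : R :=
  f z + (if bit z j then c * f (z - 2 ^ j)%N else 0).

Definition btransform c J (f : nat -> R) : nat -> R := iteri J (bit_step c) f.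

(** A step reads only [z] and [z] with one bit cleared, so values outside a set closed under
    clearing bits never matter. This is what permits tables restricted to points of low weight. *)
Lemma btransform_ext c J (dn : pred nat) f g :
  (forall z j, dn z -> bit z j -> dn (z - 2 ^ j)%N) ->
  {in dn, f =1 g} -> {in dn, btransform c J f =1 btransform c J g}.
Proof.
move=> dnP fg; elim: J => [|J IH] z dz; first exact: fg.
rewrite /btransform /= /bit_step -/(btransform c J f) -/(btransform c J g) IH //.
by case: ifP => // bz; rewrite IH //; apply: dnP.
Qed.

Lemma btransformS c J f z : btransform c J.+1 f z = bit_step c J (btransform c J f) z.
Proof. by []. Qed.

Lemma btransformD c J f g z : btransform c J (fun x => f x + g x) z = btransform c J f z + btransform c J g z.
Proof.
elim: J z => [//|J IH] z; rewrite !btransformS /bit_step !IH.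
by case: ifP => _; rewrite ?mulrDr ?addr0 // addrACA.
Qed.

Lemma btransformZ c J a f z : btransform c J (fun x => a * f x) z = a * btransform c J f z.
Proof.
elim: J z => [//|J IH] z; rewrite !btransformS /bit_step !IH.
by case: ifP => _; rewrite ?mulrDr ?mulr0 // mulrCA.
Qed.

Lemma btransform_sum c J (I : Type) (r : seq I) (f : I -> nat -> R) z :
  btransform c J (fun x => \sum_(i <- r) f i x) z = \sum_(i <- r) btransform c J (f i) z.
Proof.
elim: r => [|i r IH].
  rewrite big_nil -[RHS](mul0r (btransform c J (fun=> 0) z)) -btransformZ.
  by apply: (@btransform_ext _ _ predT) => // x _; rewrite big_nil mul0r.
rewrite big_cons -IH -btransformD.
by apply: (@btransform_ext _ _ predT) => // x _; rewrite big_cons.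
Qed.

Lemma bit_stepC c d i j f z : i != j ->
  bit_step c i (bit_step d j f) z = bit_step d j (bit_step c i f) z.
Proof.
move=> ij; rewrite /bit_step.
case bi: (bit z i); case bj: (bit z j); rewrite ?addr0 // ?bit_sub ?bi ?bj //=.
- rewrite ij eq_sym ij subnAC; ring.
- by rewrite addr0.
- by rewrite addr0.
Qed.

Lemma btransform_bit_step c d J f z : btransform c J (bit_step d J f) z = bit_step d J (btransform c J f) z.
Proof.
suff H j : (j <= J)%N -> forall z, btransform c j (bit_step d J f) z = bit_step d J (btransform c j f) z.
  exact: H.
elim: j => [//|j IH] jJ {}z; rewrite btransformS.
transitivity (bit_step c j (bit_step d J (btransform c j f)) z).
  by rewrite /bit_step !IH ?(ltnW jJ).
by rewrite bit_stepC // neq_ltn jJ.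
Qed.

(** Steps on different bits commute, so the last step of the inner transform can be moved outside
    the outer rounds below it; the two steps on bit [J] then cancel. *)
Lemma btransformK J f z : btransform 1 J (btransform (-1) J f) z = f z.
Proof.
elim: J z => [//|J IH] z; rewrite btransformS.
transitivity (bit_step 1 J (bit_step (-1) J (btransform 1 J (btransform (-1) J f))) z).
  rewrite /bit_step -!/(btransform _ _ _).
  have E x : btransform 1 J (btransform (-1) J.+1 f) x = bit_step (-1) J (btransform 1 J (btransform (-1) J f)) x.
    by rewrite -btransform_bit_step.
  by rewrite !E.
rewrite /bit_step; case bz: (bit z J); last by rewrite !addr0 IH.
by rewrite bit_sub // bz eqxx /= !IH; ring.
Qed.

(** Rounds before [j] preserve independence of bit [j], round [j] subtracts two equal values, and
    later rounds preserve the resulting zeros. *)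
Lemma btransform_indep j J f : (j < J)%N ->
  (forall z, bit z j -> f z = f (z - 2 ^ j)%N) ->
  forall z, bit z j -> btransform (-1) J f z = 0.
Proof.
move=> jJ fj.
have low i : (i <= j)%N -> forall z, bit z j ->
    btransform (-1) i f z = btransform (-1) i f (z - 2 ^ j)%N.
  elim: i => [|i IH] ij z bz; first exact: fj.
  rewrite !btransformS /bit_step -IH ?(ltnW ij) // bit_sub // neq_ltn ij andbT.
  case bi: (bit z i) => //; rewrite subnAC -IH ?(ltnW ij) //.
  by rewrite bit_sub // bz neq_ltn ij orbT.
elim: J jJ => [//|J IH]; rewrite ltnS leq_eqVlt => /predU1P[<-|jJ] z bz.
  by rewrite btransformS /bit_step bz -low //; ring.
rewrite btransformS /bit_step IH // add0r; case: ifP => // bJ; rewrite IH ?mulr0 //.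
by rewrite bit_sub // bz neq_ltn jJ.
Qed.

(** The transformed function is the monomial in the variables of [r]. A point with more than
    [size r] bits has a bit outside [r], on which the monomial does not depend. *)
Lemma btransform_low (r : seq nat) N z : (size r < wt N z)%N ->
  btransform (-1) N (fun x => (all (bit x) r)%:R) z = 0.
Proof.
move=> rw.
have [j /andP[bz jr]] : exists j : 'I_N, bit z j && (val j \notin r).
  apply/existsP; apply: contraLR rw; rewrite negb_exists -leqNgt => /forallP H.
  have -> : wt N z = size [seq val j | j <- enum [pred j : 'I_N | bit z j]].
    by rewrite size_map -cardE -sum1_card [RHS]big_mkcond; apply: eq_bigr => j _; rewrite inE; case: bit.
  apply: uniq_leq_size.
    by rewrite map_inj_uniq ?enum_uniq //; apply: val_inj.
  move=> x /mapP[j]; rewrite mem_enum inE => bz ->.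
  by move: (H j); rewrite bz /= negbK.
apply: (@btransform_indep j) => // x bx; congr (_ %:R); congr nat_of_bool.
apply: eq_in_all => i ir; rewrite bit_sub //; case: eqP => [ij|]; last by rewrite andbT.
by rewrite -[val j]/(nat_of_ord j) -ij ir in jr.
Qed.

Lemma btransform_delta n S z : (S < 2 ^ n)%N -> (z < 2 ^ n)%N ->
  btransform 1 n (fun x => (x == S)%:R) z = [forall j : 'I_n, bit S j ==> bit z j]%:R.
Proof.
move=> Sn.
(* After [J] rounds the bits below [J] may exceed those of [S], while the others still have to
   agree. *)
pose E J x := [forall j : 'I_n, if (j < J)%N then bit S j ==> bit x j else bit S j == bit x j].
suff H J : (J <= n)%N -> forall z, (z < 2 ^ n)%N ->
    btransform 1 J (fun x => (x == S)%:R) z = (E J z)%:R.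
  move=> zn; rewrite H //; congr (_ %:R); congr nat_of_bool.
  by apply: eq_forallb => j; rewrite ltn_ord.
elim: J => [|J IH] Jn {}z zn.
  rewrite /btransform /=; congr (_ %:R); congr nat_of_bool; apply/eqP/forallP => [-> j|H].
    by rewrite /= eqxx.
  rewrite (bits_sum zn) (bits_sum Sn); apply: eq_bigr => j _.
  by have := H j; rewrite /= => /eqP ->.
rewrite btransformS /bit_step !IH ?(ltnW Jn) ?(leq_ltn_trans (leq_subr _ _)) //.
set o := Ordinal Jn.
pose C := [forall j : 'I_n, (j != o) ==> if (j < J)%N then bit S j ==> bit z j else bit S j == bit z j].
have EJ x b : (forall j : 'I_n, j != o -> bit x j = bit z j) -> bit x J = b ->
    E J x = C && (bit S J == b).
  move=> xz xb; apply/forallP/andP => [H|[/forallP H /eqP H'] j].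
    split; last by have := H o; rewrite /= ltnn xb.
    apply/forallP => j; apply/implyP => jo; by have := H j; rewrite xz.
  have [->|jo] := eqVneq j o; first by rewrite /= ltnn xb H'.
  by have := H j; rewrite jo /= xz.
have ES : E J.+1 z = C && (bit S J ==> bit z J).
  apply/forallP/andP => [H|[/forallP H H'] j].
    split; last by have := H o; rewrite /= ltnSn.
    apply/forallP => j; apply/implyP => jo; have := H j.
    by rewrite ltnS leq_eqVlt; case: eqP => // jJ; case/eqP: jo; apply: val_inj.
  have [->|jo] := eqVneq j o; first by rewrite /= ltnSn.
  have jJ : (j != J :> nat) by apply: contraNneq jo => jJ; apply/eqP/val_inj.
  by have := H j; rewrite jo /= ltnS [(j <= J)%N]leq_eqVlt (negbTE jJ).
rewrite ES; case bz: (bit z J); rewrite (EJ z _ _ bz) //.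
  rewrite (EJ (z - 2 ^ J)%N false) //; last by rewrite bit_sub // eqxx andbF.
    by case: (C); case: (bit S J); rewrite /= ?mulr0 ?mulr1 ?addr0 ?add0r.
  move=> j jo; rewrite bit_sub //; suff -> : (j != J :> nat) by rewrite andbT.
  by apply: contraNneq jo => jJ; apply/eqP/val_inj.
by case: (C); case: (bit S J); rewrite /= ?addr0.
Qed.

End Transform.

(** * Fleck's congruence *)

Section Fleck.
Local Open Scope ring_scope.

Definition delta (F : nat -> int) a : int := F a.+1 - F a.

Definition ndelta j (F : nat -> int) : nat -> int := iter j delta F.

Lemma ndeltaS j F a : ndelta j.+1 F a = ndelta j F a.+1 - ndelta j F a.
Proof. by []. Qed.

Lemma eq_ndelta j F G : F =1 G -> ndelta j F =1 ndelta j G.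
Proof. by move=> FG; elim: j => [//|j IH] a; rewrite !ndeltaS !IH. Qed.

Lemma ndelta_shift j F b a : ndelta j (fun x => F (x + b)%N) a = ndelta j F (a + b)%N.
Proof. by elim: j a => [//|j IH] a; rewrite !ndeltaS !IH. Qed.

Lemma ndelta_add i j F a : ndelta (i + j) F a = ndelta i (ndelta j F) a.
Proof. by rewrite /ndelta iterD. Qed.

Lemma ndeltaZ j c F a : ndelta j (fun x => c * F x) a = c * ndelta j F a.
Proof. by elim: j a => [//|j IH] a; rewrite !ndeltaS !IH mulrBr. Qed.

(** Any range longer than [j] is allowed since ['C(j, i)] vanishes beyond [j]; in the recursion the
    two differences can then be expanded over ranges that match after a shift. *)
Lemma ndelta_bin j K F a : (j < K)%N ->
  ndelta j F a = \sum_(i < K) (-1) ^+ (j + i) * 'C(j, i)%:R * F (a + i)%N.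
Proof.
elim: j K a => [|j IH] [//|K] a jK.
  rewrite big_ord_recl /= bin0 !addn0 expr0 !mul1r big1 ?addr0 // => i _.
  by rewrite bin0n mulr0 mul0r.
rewrite ndeltaS (IH K) // (IH K.+1) ?(ltnW jK) // !big_ord_recl /= !bin0 !addn0.
rewrite exprS opprD -!sumrN addrCA mulr1 mulN1r mulNr.
rewrite mulr1 mulNr; congr (_ + _).
rewrite -big_split /=; apply: eq_bigr => i _.
rewrite /bump /= add1n binS natrD !addnS !addSn !exprS; ring.
Qed.

Variables (p : nat) (p_pr : prime p).

(** The inner binomial coefficients are divisible by [p]. By periodicity the two end terms add up to
    [(1 + (-1) ^ p) * F a], which is 0 for odd [p] and even for [p = 2]. *)
Lemma ndelta_prime F a : (forall x, F (x + p)%N = F x) ->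
  (p %| ndelta p F a)%Z.
Proof.
case: p p_pr => // q q_pr Fp.
rewrite (@ndelta_bin q.+1 q.+2) // big_ord_recr big_ord_recl /=.
rewrite bin0 binn !addn0 Fp !mulr1 addrAC -mulrDl.
rewrite rpredD //; last first.
  apply: rpred_sum => i _; rewrite dvdz_mulr // dvdz_mull //.
  rewrite natz dvdzE !absz_nat prime_dvd_bin // /bump /= add1n.
  by rewrite ltnS ltn_ord.
rewrite dvdz_mulr // addnn -signr_odd -[(-1) ^+ (q.+1.*2)]signr_odd odd_double expr0.
have [[->]|odd_p] := even_prime q_pr; first by [].
by rewrite odd_p expr1 addNr dvdz0.
Qed.

(* Modulo p the p-th difference is F(a + p) - F(a) = 0, so it is p times a
   p-periodic function, whose sum over a period telescopes to 0. *)
Lemma ndelta_prime_ex F : (forall x, F (x + p)%N = F x) ->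
  exists2 G : nat -> int, forall x, G (x + p)%N = G x
    & forall a, ndelta p F a = p%:Z * delta G a.
Proof.
move=> Fp; have p0 : p%:Z != 0 by have := prime_gt0 p_pr; lia.
pose K a := (ndelta p F a %/ p)%Z.
have KE a : ndelta p F a = p%:Z * K a.
  by rewrite mulrC divzK // ndelta_prime.
have nFp j x : ndelta j F (x + p)%N = ndelta j F x.
  by rewrite -ndelta_shift; apply: eq_ndelta => y; rewrite Fp.
have K0 a : \sum_(i < p) K (a + i)%N = 0.
  apply: (mulfI p0); rewrite mulr0 mulr_sumr.
  under eq_bigr do rewrite -KE.
  have -> : p = p.-1.+1 :> nat by rewrite prednK ?prime_gt0.
  under eq_bigr => i _ do rewrite ndeltaS -addnS.
  rewrite -(big_mkord xpredT (fun i => ndelta p.-1 F (a + i.+1)%N - ndelta p.-1 F (a + i)%N)).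
  by rewrite telescope_sumr //= addn0 prednK ?prime_gt0 // nFp subrr.
pose G a := \sum_(i < a) K i.
have GS a : delta G a = K a by rewrite /delta /G big_ord_recr /= addrAC subrr add0r.
exists G => a; last by rewrite GS KE.
rewrite /G big_split_ord /= -[RHS]addr0; congr (_ + _); exact: K0.
Qed.

(** The innermost [p] differences turn [F] into [p] times one difference of a function that is again
    [p]-periodic, so each further factor [p] costs [p - 1] differences. *)
Lemma fleck F t a : (forall x, F (x + p)%N = F x) ->
  ((p ^ t)%N %| ndelta (1 + (p - 1) * t)%N F a)%Z.
Proof.
elim: t F a => [|t IH] F a Fp; first by rewrite expn0 dvd1z.
have [G Gp GE] := ndelta_prime_ex Fp.
have -> : (1 + (p - 1) * t.+1 = (p - 1) * t + p)%N.
  by have := prime_gt0 p_pr; rewrite mulnS; lia.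
rewrite ndelta_add (eq_ndelta _ GE) ndeltaZ.
have -> : ndelta ((p - 1) * t) (delta G) a = ndelta (1 + (p - 1) * t)%N G a.
  by rewrite addnC ndelta_add.
rewrite expnS PoszM; apply: dvdz_mul; first exact: dvdzz.
exact: IH.
Qed.

(** The differences left over after division by [p - 1] are applied first; they keep [F]
    periodic. *)
Lemma fleck_le F j a : (forall x, F (x + p)%N = F x) ->
  ((p ^ ((j - 1) %/ (p - 1)))%N %| ndelta j F a)%Z.
Proof.
move=> Fp; case: j => [|j]; first by rewrite sub0n div0n expn0 dvd1z.
have -> : (j.+1 - 1 = j)%N by rewrite subn1.
set t := (j %/ _)%N.
have -> : j.+1 = ((1 + (p - 1) * t) + j %% (p - 1))%N.
  by rewrite {1}(divn_eq j (p - 1)) mulnC; lia.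
rewrite ndelta_add; apply: fleck => x.
by rewrite -ndelta_shift; apply: eq_ndelta => y; rewrite Fp.
Qed.

End Fleck.

(** * Low degree of products of periodic functions *)

Section Degree.
Local Open Scope ring_scope.
Variables (p : nat) (p_pr : prime p) (R : comNzRingType) (L N d : nat).
Hypothesis pL0 : (p ^ L)%:R = 0 :> R.
Variables (F : nat -> int).
Hypothesis Fp : forall x, F (x + p)%N = F x.

(* Expanding F([s <= x] + c) as F(c) + [s <= x] (delta F)(c), monomial by
   monomial, trades degree d for one more difference of F. *)
Lemma btransform_prod_aux (ls : seq (seq (seq nat))) (c : int) t J k r z :
  ((p ^ t)%N %| c)%Z -> (size r <= d * J)%N -> (J <= (p - 1) * (t + k))%N ->
  {in ls, forall l : seq (seq nat), {in l, forall s : seq nat, size s <= d}%N} ->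
  (d * ((p - 1) * (L + (k + size ls) - 1)) < wt N z)%N ->
  btransform (-1) N (fun x => c%:~R * (all (bit x) r)%:R
    * \prod_(l <- ls) (F (count (all (bit x)) l))%:~R) z = 0 :> R.
Proof.
elim: ls c t J k r => [|l ls IH] c t J k r tc rJ Jt lsd wz.
  (* All factors are expanded. Either the coefficient is divisible by [p ^ L], hence zero in [R], or
     [t <= L - 1] and what remains is a monomial of degree at most [d * ((p - 1) * (L - 1 + k))],
     too low for the weight of [z]. *)
  have [tL|Lt] := ltnP t L; last first.
    have -> : c%:~R = 0 :> R.
      have /dvdzP[q ->] := tc; rewrite rmorphM /= -(subnKC Lt) expnD PoszM rmorphM /=.
      by rewrite -[in X in _ * X]pmulrn pL0 mul0r mulr0.
    rewrite -[RHS](mul0r (btransform (-1) N (fun=> 0) z)) -btransformZ.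
    by apply: (@btransform_ext _ _ _ predT) => // x _; rewrite !mul0r.
  transitivity (c%:~R * btransform (-1) N (fun x => (all (bit x) r)%:R) z : R).
    by rewrite -btransformZ; apply: (@btransform_ext _ _ _ predT) => // x _; rewrite big_nil mulr1.
  rewrite btransform_low ?mulr0 //; apply: leq_ltn_trans wz; apply: leq_trans rJ _.
  rewrite leq_mul2l; apply/orP; right; apply: leq_trans Jt _.
  by rewrite leq_mul2l /= addn0; apply/orP; right; lia.
have lsd' : {in ls, forall l : seq (seq nat), {in l, forall s : seq nat, size s <= d}%N}.
  by move=> l' l'ls; apply: lsd; rewrite inE l'ls orbT.
suff H j r' l' : (size r' <= d * (J + j))%N ->
    {in l', forall s : seq nat, size s <= d}%N ->
    btransform (-1) N (fun x => c%:~R * (all (bit x) r')%:R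
      * ((ndelta j F (count (all (bit x)) l'))%:~R
      * \prod_(l <- ls) (F (count (all (bit x)) l))%:~R)) z = 0 :> R.
  transitivity (btransform (-1) N (fun x => c%:~R * (all (bit x) r)%:R
      * ((ndelta 0 F (count (all (bit x)) l))%:~R
      * \prod_(l <- ls) (F (count (all (bit x)) l))%:~R)) z : R).
    by apply: (@btransform_ext _ _ _ predT) => // x _; rewrite big_cons.
  by apply: H; [rewrite addn0|apply: lsd; rewrite inE eqxx].
elim: l' j r' => [|s l' IHl] j r' r'J l'd.
  transitivity (btransform (-1) N (fun x => (c * ndelta j F 0)%:~R * (all (bit x) r')%:R
      * \prod_(l <- ls) (F (count (all (bit x)) l))%:~R) z : R).
    apply: (@btransform_ext _ _ _ predT) => // x _.
    by rewrite /= rmorphM /= -!mulrA; congr (_ * _); rewrite mulrCA.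
  (* Expanding this factor took [j] differences and gives [(j - 1) %/ (p - 1)] new factors [p]. The
     rounding loses at most one block of [p - 1] differences per factor; raising [k] by one accounts
     for it. *)
  apply: (IH _ (t + (j - 1) %/ (p - 1))%N (J + j)%N k.+1) => //.
  - by rewrite expnD PoszM dvdz_mul // fleck_le.
  - have p1 : (0 < p - 1)%N by have := prime_gt1 p_pr; lia.
    have : (j <= (p - 1) * ((j - 1) %/ (p - 1) + 1))%N.
      have := divn_eq (j - 1) (p - 1); have := ltn_pmod (j - 1) p1.
      by rewrite [X in _ -> _ = X + _ -> _]mulnC mulnDr; lia.
    by move: Jt; rewrite !mulnDr mulnS; lia.
  - by move: wz; rewrite /= addSnnS.
transitivity (btransform (-1) N (fun x =>
    (c%:~R * (all (bit x) r')%:R * ((ndelta j F (count (all (bit x)) l'))%:~R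
      * \prod_(l <- ls) (F (count (all (bit x)) l))%:~R))
  + (c%:~R * (all (bit x) (s ++ r'))%:R * ((ndelta j.+1 F (count (all (bit x)) l'))%:~R
      * \prod_(l <- ls) (F (count (all (bit x)) l))%:~R))) z : R).
  apply: (@btransform_ext _ _ _ predT) => // x _; rewrite all_cat ndeltaS rmorphB [count _ (s :: l')]/=.
  case: (all _ s); rewrite /= ?add1n ?add0n; ring.
rewrite btransformD !IHl ?addr0 //.
- by rewrite size_cat addnS mulnS leq_add //; apply: l'd; rewrite inE eqxx.
- by move=> s' s'l; apply: l'd; rewrite inE s'l orbT.
- by move=> s' s'l; apply: l'd; rewrite inE s'l orbT.
Qed.

Lemma btransform_prod (ls : seq (seq (seq nat))) z :
  {in ls, forall l : seq (seq nat), {in l, forall s : seq nat, size s <= d}%N} ->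
  (d * ((p - 1) * (L + size ls - 1)) < wt N z)%N ->
  btransform (-1) N (fun x => \prod_(l <- ls) (F (count (all (bit x)) l))%:~R) z = 0 :> R.
Proof.
move=> lsd wz.
have := @btransform_prod_aux ls 1 0 0 0 [::] z; rewrite add0n /= => <- //.
  by apply: (@btransform_ext _ _ _ predT) => // x _; rewrite !mul1r.
Qed.

End Degree.

(** * Tables *)

Definition table_step (dom : pred nat) c M j (A : nat -> nat) z :=
  if dom z && bit z j then (A z + c * A (z - 2 ^ j)) %% M else A z.

Definition table_transform dom c M J A := iteri J (table_step dom c M) A.

(** The [N] low bits of a point are the variables of the interpolated polynomial, subject to the
    weight bound; the high bits are the variables summed over. *)
Definition dom N Y D z := (z %/ 2 ^ N < Y) && (wt N (z %% 2 ^ N) <= D).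

Lemma dom_sub N Y D z j : dom N Y D z -> bit z j -> dom N Y D (z - 2 ^ j).
Proof.
have P0 : 0 < 2 ^ N by rewrite expn_gt0.
have zE : z = z %% 2 ^ N + 2 ^ N * (z %/ 2 ^ N) by rewrite addnC mulnC -divn_eq.
rewrite /dom; move: (ltn_pmod z P0) zE.
set x := z %% _; set y := z %/ _ => xP zE /andP[yY xD].
rewrite zE bit_low //; case: ltnP => jN bj.
  have xj := bit_ge bj.
  rewrite addnC -addnBA // mulnC divnMDl // modnMDl.
  rewrite divn_small ?modn_small ?addn0 ?(leq_ltn_trans (leq_subr _ _)) //.
  by rewrite yY /=; apply: leq_trans xD; apply: wt_sub.
have -> : 2 ^ j = 2 ^ N * 2 ^ (j - N) by rewrite -expnD subnKC.
rewrite -addnBA; last by rewrite leq_mul2l bit_ge // orbT.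
rewrite -mulnBr addnC mulnC divnMDl // modnMDl divn_small // modn_small // addn0 xD andbT.
by apply: leq_ltn_trans yY; rewrite leq_subr.
Qed.

Section Xform.
Variables (dm : pred nat) (c M : nat).

Lemma table_transformS J A z : table_transform dm c M J.+1 A z = table_step dm c M J (table_transform dm c M J A) z.
Proof. by []. Qed.

Lemma table_transform_out J A z : ~~ dm z -> table_transform dm c M J A z = A z.
Proof.
by move=> dz; elim: J => [//|J IH]; rewrite table_transformS /table_step (negbTE dz) IH.
Qed.

Lemma table_transform_lt J A V : 0 < M -> M <= V -> (forall z, A z < V) ->
  forall z, table_transform dm c M J A z < V.
Proof.
move=> M0 MV AV; elim: J => [//|J IH] z; rewrite table_transformS /table_step.
by case: ifP => // _; apply: leq_trans MV; rewrite ltn_pmod.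
Qed.

Lemma table_transformE (R : comNzRingType) J A z : (M%:R = 0 :> R)%R ->
  (forall z j, dm z -> bit z j -> dm (z - 2 ^ j)) -> dm z ->
  ((table_transform dm c M J A z)%:R = btransform c%:R J (fun x => (A x)%:R) z :> R)%R.
Proof.
move=> M0 dmP; have modM a : ((a %% M)%:R = a%:R :> R)%R.
  by rewrite {2}(divn_eq a M) natrD natrM M0 mulr0 add0r.
elim: J z => [//|J IH] z dz; rewrite table_transformS btransformS /table_step /bit_step dz /=.
case: ifP => bz; last by rewrite IH // addr0.
by rewrite modM natrD natrM !IH // dmP.
Qed.

End Xform.

Definition supp (es : seq nat) := [seq j <- iota 0 (size es) | nth 0 es j != 0].
(** On 0/1 points only the set of variables of a term matters. [mask] is this set as a point of the
    cube, so that terms with equal masks merge into one multilinear coefficient. *)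
Definition mask (es : seq nat) := \sum_(j < size es) (nth 0 es j != 0) * 2 ^ j.

Lemma sum_bits_lt n (b : nat -> bool) : \sum_(j < n) b j * 2 ^ j < 2 ^ n.
Proof.
elim: n => [|n IH]; first by rewrite big_ord0.
by rewrite big_ord_recr /= expnS mul2n -addnn -addSn leq_add //; case: (b n); rewrite ?mul1n.
Qed.

Lemma bit_sum n (b : nat -> bool) j : bit (\sum_(i < n) b i * 2 ^ i) j = (j < n) && b j.
Proof.
elim: n => [|n IH]; first by rewrite big_ord0 /bit div0n.
rewrite big_ord_recr /= [_ * 2 ^ n]mulnC bit_low ?sum_bits_lt // IH.
have [jn|nj|->] := ltngtP j n.
- by rewrite ltnS (ltnW jn).
- rewrite ltnS leqNgt nj /=; apply: (@bit_small_le _ 1); last by rewrite subn_gt0.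
  by case: (b n).
by rewrite subnn ltnSn /bit divn1; case: (b n).
Qed.

Lemma mask_lt es : mask es < 2 ^ size es.
Proof. exact: (sum_bits_lt _ (fun j => nth 0 es j != 0)). Qed.

Lemma bit_mask es j : bit (mask es) j = (nth 0 es j != 0).
Proof.
rewrite /mask (bit_sum _ (fun j => nth 0 es j != 0)); case: ltnP => // js.
by rewrite nth_default.
Qed.

Lemma all_supp (a : pred nat) es :
  all a (supp es) = [forall j : 'I_(size es), (nth 0 es j != 0) ==> a j].
Proof.
apply/allP/forallP => [H j|H j]; last first.
  rewrite mem_filter mem_iota add0n => /andP[ej /= js].
  by have := H (Ordinal js); rewrite /= ej.
by apply/implyP => ej; apply: H; rewrite mem_filter ej mem_iota add0n ltn_ord.
Qed.

Definition term := (nat * seq nat)%type.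

Definition polyval p (f : seq term) z := (\sum_(t <- f) t.1 * all (bit z) (supp t.2)) %% p.

Definition coef (f : seq term) z := \sum_(t <- f | mask t.2 == z) t.1.

(** A term is a point mass at its mask, and the transform spreads it to all points above the mask,
    which are those where the monomial is 1. *)
Lemma btransform_coef (R : comNzRingType) n (f : seq term) z : (z < 2 ^ n)%N ->
  {in f, forall t : term, size t.2 = n} ->
  (btransform 1 n (fun x => (coef f x)%:R) z
  = (\sum_(t <- f) t.1 * all (bit z) (supp t.2))%N%:R :> R)%R.
Proof.
move=> zn fn.
rewrite natr_sum; transitivity
  (btransform 1 n (fun x => \sum_(t <- f) t.1%:R * (x == mask t.2)%:R) z : R)%R.
  apply: (@btransform_ext _ _ _ predT) => // x _; rewrite /coef natr_sum big_mkcond /=.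
  by apply: eq_bigr => t _; rewrite eq_sym; case: eqP; rewrite ?mulr1 ?mulr0.
rewrite btransform_sum; apply: eq_big_seq => t tf.
rewrite btransformZ btransform_delta //; last by rewrite -(fn _ tf) mask_lt.
rewrite natrM; congr (_ * (nat_of_bool _)%:R)%R.
rewrite all_supp (fn _ tf); apply: eq_forallb => j; by rewrite bit_mask.
Qed.

(** Coefficients are given only up to congruence (a stored one may be [p] itself), and an entry with
    no bit to process is never reduced, hence the [%% p] in the conclusion. Both disappear in
    ['F_p]. *)
Lemma table_transform_eval p n N Y D (f : seq term) A z : prime p ->
  (forall z, dom N Y D z -> z < 2 ^ n) ->
  {in f, forall t : term, size t.2 = n} ->
  (forall z, z < 2 ^ n -> A z = coef f z %[mod p]) -> dom N Y D z ->
  table_transform (dom N Y D) 1 p n A z %% p = polyval p f z.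
Proof.
move=> p_pr dn fn AE dz; rewrite /polyval -!(val_Fp_nat p_pr); congr (val _).
rewrite (@table_transformE _ _ _ 'F_p) //; last 2 first.
- by rewrite pchar_Fp_0.
- by move=> x j; apply: dom_sub.
rewrite -(btransform_coef 'F_p (dn _ dz) fn).
apply: (@btransform_ext _ _ _ (dom N Y D)) => // x; first by move=> j; apply: dom_sub.
move=> dx; apply: val_inj; rewrite /= !val_Fp_nat //; exact/AE/dn.
Qed.

(** * Partial sums over the high variables and their interpolation modulo a prime power *)

Section Interpolation.
Variables (p N Y d : nat) (fs : seq (seq term)).
Hypothesis p_pr : prime p.
Hypothesis fsd : {in fs, forall f : seq term, {in f, forall t : term, size (supp t.2) <= d}}.

Definition hsum x := \sum_(y < Y) \prod_(f <- fs) polyval p f (x + 2 ^ N * y).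

(** A coefficient [c] becomes [c] copies of its monomial, so the value of the polynomial is the
    number of monomials that hold at the point, and reduction modulo [p] is a periodic function of
    this count. *)
Definition expand (f : seq term) := flatten [seq nseq t.1 (supp t.2) | t <- f].

(** The effect of fixing the high variables to [y]: monomials containing a high variable that is 0
    in [y] disappear, the others lose their high part. *)
Definition low y (l : seq (seq nat)) :=
  [seq [seq j <- s | j < N] | s <- l & all (fun j => bit y (j - N)) [seq j <- s | N <= j]].

Lemma count_expand (a : pred (seq nat)) f : count a (expand f) = \sum_(t <- f) t.1 * a (supp t.2).
Proof.
rewrite /expand count_flatten -map_comp sumnE big_map.
by apply: eq_bigr => t _; rewrite /= count_nseq mulnC.
Qed.

Lemma count_low x y l : x < 2 ^ N ->
  count (all (bit (x + 2 ^ N * y))) l = count (all (bit x)) (low y l).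
Proof.
move=> xN; rewrite /low count_map count_filter; apply: eq_count => s /=.
elim: s => [//|j s IH] /=; rewrite IH bit_low // ltnNge.
by case: (leqP N j) => _ /=; case: (bit _ _); case: (all _ _); rewrite ?andbF /=.
Qed.

Lemma btransform_hsum (R : comNzRingType) L z : (p ^ L)%:R%R = 0%R :> R ->
  d * ((p - 1) * (L + size fs - 1)) < wt N z -> z < 2 ^ N ->
  (btransform (-1) N (fun x => (hsum x)%:R) z = 0 :> R)%R.
Proof.
move=> pL dz zN; pose F a : int := (a %% p)%N.
transitivity (btransform (-1) N (fun x => \sum_(y < Y) \prod_(l <- [seq low y (expand f) | f <- fs])
    (F (count (all (bit x)) l))%:~R) z : R)%R.
  apply: (@btransform_ext _ _ _ (fun x => x < 2 ^ N)) => //.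
    by move=> x j xN _; apply: leq_ltn_trans xN; rewrite leq_subr.
  move=> x xN; rewrite /hsum natr_sum; apply: eq_bigr => y _.
  rewrite natr_prod big_map; apply: eq_bigr => f _.
  by rewrite -count_low // count_expand /F /polyval.
rewrite btransform_sum big1 // => y _; apply: (@btransform_prod _ p_pr _ L N d pL F).
- by move=> x; rewrite /F modnDr.
- move=> _ /mapP[f ffs ->] _ /mapP[s /[!mem_filter] /andP[_ sl] ->].
  rewrite size_filter; apply: leq_trans (count_size _ _) _.
  move: sl; rewrite /expand => /flattenP[_ /mapP[t tf ->]] /nseqP[-> _].
  exact: fsd tf.
- by rewrite size_map.
Qed.

(** Makes the partial sums recoverable from residues. Strictness comes from the residues being at
    most [p - 1], with at least one factor in each product. *)
Lemma hsum_lt q x : 0 < size fs -> 0 < q -> Y <= q -> hsum x < p ^ size fs * q.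
Proof.
move=> fs0 q0 Yq; have p0 := prime_gt0 p_pr.
have Hle z : \prod_(f <- fs) polyval p f z <= p.-1 ^ size fs.
  elim: (fs) => [|f fs' IH]; first by rewrite big_nil.
  by rewrite big_cons expnS leq_mul // /polyval -ltnS prednK // ltn_pmod.
apply: (@leq_ltn_trans (Y * p.-1 ^ size fs)).
  by rewrite -[X in _ <= X * _]card_ord -sum_nat_const; apply: leq_sum.
rewrite mulnC; apply: (@leq_ltn_trans (p.-1 ^ size fs * q)); first by rewrite leq_mul2l Yq orbT.
by rewrite ltn_pmul2r // ltn_exp2r // prednK.
Qed.

(** The subset-sum transform inverts the Moebius transform, so it suffices that the restricted table
    agrees modulo [p ^ L] with the full Moebius transform: up to weight [D] because these points are
    closed under clearing bits, beyond because both vanish. With [N <= D] there is no point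
    beyond. *)
Lemma interpolation L D (H : nat -> nat) : 1 < p ^ L ->
  (forall x, hsum x < p ^ L) ->
  (N <= D) || (d * ((p - 1) * (L + size fs - 1)) <= D) ->
  (forall x, H x = if dom N 1 D x then hsum x else 0) ->
  forall D' x, N <= D' -> x < 2 ^ N ->
    table_transform (dom N 1 D') 1 (p ^ L) N (table_transform (dom N 1 D) (p ^ L - 1) (p ^ L) N H) x = hsum x.
Proof.
move=> M1 hM dD HE D' x ND' xN; set M := p ^ L in M1 hM *.
have domE E z : dom N 1 E z = (z < 2 ^ N) && (wt N z <= E).
  rewrite /dom ltnS leqn0 -leqn0 -ltnS ltn_divLR ?expn_gt0 // mul1n.
  by case: ltnP => // zN; rewrite modn_small.
(* ['Z_M] is the ring of integers modulo [M] only for [1 < M], hence the assumption on [p ^ L]. *)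
have M0 : (M%:R = 0 :> 'Z_M)%R by apply: val_inj; rewrite /= val_Zp_nat // modnn.
have Mm1 : ((M - 1)%:R = -1 :> 'Z_M)%R by rewrite natrB ?M0 ?sub0r // ltnW.
have Hlt z : H z < M by rewrite HE; case: ifP => // _; apply: ltnW.
suff: ((table_transform (dom N 1 D') 1 M N (table_transform (dom N 1 D) (M - 1) M N H) x)%:R = (hsum x)%:R :> 'Z_M)%R.
  move/(congr1 val); rewrite /= !val_Zp_nat // !modn_small //.
  have M_gt0 := ltnW M1; apply: table_transform_lt => // z; exact: table_transform_lt.
have xD' : dom N 1 D' x by rewrite domE xN (leq_trans (wt_le _ _)).
rewrite (table_transformE _ _ _ M0) //; last by move=> z j; apply: dom_sub.
rewrite -(btransformK N (fun x => (hsum x)%:R : 'Z_M)%R x).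
apply: (@btransform_ext _ _ _ (dom N 1 D')) => // z; first by move=> j; apply: dom_sub.
rewrite -[z \in _]/(dom N 1 D' z) => zD'; have [zD|zD] := boolP (dom N 1 D z).
  rewrite (table_transformE _ _ _ M0) //; last by move=> y j; apply: dom_sub.
  rewrite Mm1; apply: (@btransform_ext _ _ _ (dom N 1 D)) => // y; first by move=> j; apply: dom_sub.
  by rewrite HE -[y \in _]/(dom N 1 D y) => ->.
move: zD' zD; rewrite !domE => /andP[zN _]; rewrite zN -ltnNge /= => Dz.
rewrite table_transform_out ?domE ?zN -?ltnNge // HE domE zN leqNgt Dz /= (@btransform_hsum _ L) //.
case/orP: dD => dD; last exact: leq_ltn_trans Dz.
by move: (leq_trans Dz (wt_le _ _)); rewrite ltnNge dD.
Qed.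

End Interpolation.

Lemma sum_blocks P Y (g : nat -> nat) :
  \sum_(0 <= z < P * Y) g z = \sum_(0 <= x < P) \sum_(0 <= y < Y) g (x + P * y).
Proof.
elim: Y => [|Y IH].
  by rewrite muln0 big_geq // big1 // => x _; rewrite big_geq.
rewrite mulnS addnC (big_cat_nat _ (leq_addr _ _)) //= IH.
under [RHS]eq_bigr do rewrite big_nat_recr //=.
rewrite big_split /=; congr addn.
by rewrite -{1}[P * Y]add0n big_addn addKn.
Qed.

(** * Cost of programs *)

Lemma bitlen_gt0 v : 0 < bitlen v. Proof. by []. Qed.

Lemma bitlenP v : v < 2 ^ bitlen v.
Proof. exact: trunc_log_ltn. Qed.

Lemma bitlen_le v n : 0 < n -> v < 2 ^ n -> bitlen v <= n.
Proof.
case: v => [|v] n0 vn; first by rewrite /bitlen trunc_log0.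
by rewrite /bitlen -(ltn_exp2l _ _ (isT : 1 < 2)); apply: leq_ltn_trans vn; apply: trunc_logP.
Qed.

Lemma leq_bitlen a b : a <= b -> bitlen a <= bitlen b.
Proof. by move=> ab; rewrite ltnS; apply: leq_trunc_log. Qed.

Lemma bitlenD a b : bitlen (a + b) <= bitlen a + bitlen b.
Proof.
apply: bitlen_le; first by rewrite addn_gt0.
have := bitlenP a; have := bitlenP b; rewrite expnD.
have : 0 < 2 ^ trunc_log 2 a by rewrite expn_gt0.
have : 0 < 2 ^ trunc_log 2 b by rewrite expn_gt0.
rewrite /bitlen !expnS; nia.
Qed.

Lemma bitlenM a b : bitlen (a * b) <= bitlen a + bitlen b.
Proof.
apply: bitlen_le; first by rewrite addn_gt0.
have := bitlenP a; have := bitlenP b; rewrite expnD; nia.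
Qed.

Lemma binop_bitlen o a b : bitlen (binop_val o a b) <= bitlen a + bitlen b.
Proof.
case: o => /=; [exact: bitlenD| |exact: bitlenM| |];
  apply: leq_trans (leq_addr _ _); apply: leq_bitlen.
- exact: leq_subr.
- exact: leq_div.
- exact: leq_mod.
Qed.

(** Measures how far an expression can lengthen numbers: an operation at most adds the lengths of
    its operands, a read resets to one memory word, and a literal counts with its own length. *)
Fixpoint esize (e : expr) : nat :=
  match e with
  | Lit v => bitlen v
  | Get e1 => (esize e1).+1
  | Bin _ e1 e2 => (esize e1 + esize e2).+1
  end.

Fixpoint additive (e : expr) : bool :=
  match e with
  | Lit _ => true
  | Get e1 => additive e1
  | Bin o e1 e2 => (if o is (Defs.Add | Defs.Sub) then true else false) && additive e1 && additive e2
  end.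

Fixpoint avoids (X : pred nat) (m : memory) (e : expr) : bool :=
  match e with
  | Lit _ => true
  | Get e1 => avoids X m e1 && ~~ X (expr_val m e1)
  | Bin _ e1 e2 => avoids X m e1 && avoids X m e2
  end.

(** Exceeds the size of every expression in the program, where [adr] copies its index four times. *)
Definition max_size := 600.
(** Expression costs are at most quadratic in [esize] and a store evaluates two expressions, hence
    the form. It is locked to stay an opaque constant in arithmetic goals. *)
Definition kappa : nat := locked ((2 * max_size).+1 ^ 2).

Section Frame.

(* The cells in [X] are exempt from the bound [V] and must not be read.  When
   [lin] holds, multiplications and divisions are excluded, so that a step costs
   O(bitlen V) instead of O(bitlen V ^ 2). *)
Variables (lin : bool) (X : pred nat) (V : nat).

Definition unit_sq := if lin then bitlen V else bitlen V * bitlen V.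
Definition step_cost := kappa * unit_sq.
Definition bounded (m : memory) := forall a, ~~ X a -> m a <= V.

Let B := bitlen V.

Lemma leq_unit_sq : B <= unit_sq.
Proof. by rewrite /unit_sq; case: lin; rewrite // leq_pmulr. Qed.

Lemma expr_bitlen m e : bounded m -> avoids X m e -> bitlen (expr_val m e) <= esize e * B.
Proof.
move=> mV; elim: e => [v|e IH|o e1 IH1 e2 IH2] /=.
- by rewrite leq_pmulr.
- move=> /andP[_ eX]; rewrite mulSn; apply: leq_trans (leq_addr _ _).
  exact/leq_bitlen/mV.
- move=> /andP[/IH1 H1 /IH2 H2]; apply: leq_trans (binop_bitlen _ _ _) _.
  by rewrite mulSn mulnDl; lia.
Qed.

Lemma expr_costP m e : bounded m -> avoids X m e -> lin ==> additive e ->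
  expr_cost m e <= esize e ^ 2 * unit_sq.
Proof.
have BU := leq_unit_sq; have B0 : 0 < B by [].
move=> mV; elim: e => [v|e IH|o e1 IH1 e2 IH2] /=.
- have : 0 < bitlen v by []; nia.
- move=> /andP[eX eX'] ea; have := IH eX ea; have := expr_bitlen mV eX.
  by have := leq_bitlen (mV _ eX'); rewrite -/B; nia.
- move=> /andP[e1X e2X] ea.
  have [oa ea1 ea2] : [/\ lin -> if o is (Defs.Add | Defs.Sub) then true else false,
      lin ==> additive e1 & lin ==> additive e2].
    by move: ea; case: (lin) => //= /andP[/andP[-> -> ->]].
  have := IH1 e1X ea1; have := IH2 e2X ea2.
  have := expr_bitlen mV e1X; have := expr_bitlen mV e2X.
  set b1 := bitlen _; set b2 := bitlen _ => H2 H1 C2 C1.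
  have : binop_cost o (expr_val m e1) (expr_val m e2)
         <= 2 * (esize e1 + esize e2) * unit_sq + esize e1 * esize e2 * unit_sq.
    move: oa; rewrite /unit_sq -/B; case: o {ea} => /=; rewrite -/b1 -/b2; case: (lin) => // oa;
      try (have := oa isT => //); nia.
  nia.
Qed.

Definition good_expr e := (esize e <= max_size) && (lin ==> additive e).

Lemma leq_kappa n : n <= 2 * max_size -> n.+1 ^ 2 <= kappa.
Proof. by move=> H; rewrite /kappa -lock leq_exp2r. Qed.

Lemma guard_cost m e : bounded m -> avoids X m e -> good_expr e ->
  (expr_cost m e).+1 <= step_cost.
Proof.
move=> mV eX /andP[es ea]; have U0 : 0 < unit_sq by apply: leq_trans leq_unit_sq.
have := expr_costP mV eX ea; have := @leq_kappa (esize e); rewrite /step_cost.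
by move=> /(_ ltac:(lia)); nia.
Qed.

Lemma store_cost m a e : bounded m -> avoids X m a -> avoids X m e ->
  good_expr a -> good_expr e ->
  expr_cost m a + expr_cost m e + bitlen (expr_val m a) + bitlen (expr_val m e) <= step_cost.
Proof.
move=> mV aX eX /andP[sa aa] /andP[se ae].
have BU := leq_unit_sq.
have := expr_costP mV aX aa; have := expr_costP mV eX ae.
have := expr_bitlen mV eX; have := expr_bitlen mV aX.
have := @leq_kappa (esize a + esize e); rewrite /step_cost.
by move=> /(_ ltac:(lia)); nia.
Qed.

Lemma read_cost m a v : bounded m -> avoids X m a -> good_expr a -> v <= V ->
  expr_cost m a + bitlen (expr_val m a) + bitlen v <= step_cost.
Proof.
move=> mV aX /andP[sa aa] /leq_bitlen; rewrite -/B => vB.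
have BU := leq_unit_sq.
have := expr_costP mV aX aa; have := expr_bitlen mV aX.
have := @leq_kappa (esize a); rewrite /step_cost.
by move=> /(_ ltac:(lia)); nia.
Qed.

(** A total-correctness triple with a cost bound. It also promises a bounded final memory, so
    postconditions need not carry the bounds. *)
Definition costs P m s C (Q : memory -> seq nat -> Prop) :=
  exists T m' s', [/\ exec P m s T m' s', T <= C, bounded m' & Q m' s'].

Definition runs P m s n Q := costs P m s (n * step_cost) Q.

Lemma costs_weaken P m s C C' (Q Q' : memory -> seq nat -> Prop) :
  costs P m s C Q -> C <= C' -> (forall m' s', bounded m' -> Q m' s' -> Q' m' s') ->
  costs P m s C' Q'.
Proof.
move=> [T [m' [s' [ex TC mV q]]]] CC QQ; exists T, m', s'; split => //.
  exact: leq_trans TC CC.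
exact: QQ.
Qed.

Lemma costs_leq P m s C C' Q : C <= C' -> costs P m s C Q -> costs P m s C' Q.
Proof. by move=> CC H; apply: costs_weaken H CC _. Qed.

Lemma runs_weaken P m s n n' (Q Q' : memory -> seq nat -> Prop) :
  runs P m s n Q -> n <= n' -> (forall m' s', bounded m' -> Q m' s' -> Q' m' s') ->
  runs P m s n' Q'.
Proof. by move=> H nn; apply: costs_weaken H _; rewrite leq_mul2r nn orbT. Qed.

Lemma costs_seq P1 P2 m s C1 C2 (Q R : memory -> seq nat -> Prop) :
  costs P1 m s C1 R ->
  (forall m' s', bounded m' -> R m' s' -> costs P2 m' s' C2 Q) ->
  costs (Seq P1 P2) m s (C1 + C2) Q.
Proof.
move=> [T1 [m1 [s1 [ex1 Tn1 mV1 r]]]] /(_ _ _ mV1 r) [T2 [m2 [s2 [ex2 Tn2 mV2 q]]]].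
exists (T1 + T2), m2, s2; split => //; first exact: ExecSeq ex1 ex2.
by rewrite leq_add.
Qed.

(** Lets the cost of the second program depend on the state reached by the first, as needed once the
    parameters of the run are computed by the program itself. *)
Lemma costs_seq_le P1 P2 m s C1 C (Q R : memory -> seq nat -> Prop) :
  costs P1 m s C1 R ->
  (forall m' s', bounded m' -> R m' s' -> exists2 C2, C1 + C2 <= C & costs P2 m' s' C2 Q) ->
  costs (Seq P1 P2) m s C Q.
Proof.
move=> [T1 [m1 [s1 [ex1 Tn1 mV1 r]]]] /(_ _ _ mV1 r) [C2 CC].
move=> [T2 [m2 [s2 [ex2 Tn2 mV2 q]]]].
exists (T1 + T2), m2, s2; split => //; first exact: ExecSeq ex1 ex2.
by apply: leq_trans CC; rewrite leq_add.
Qed.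

Lemma runs_seq P1 P2 m s n1 n2 (Q R : memory -> seq nat -> Prop) :
  runs P1 m s n1 R ->
  (forall m' s', bounded m' -> R m' s' -> runs P2 m' s' n2 Q) ->
  runs (Seq P1 P2) m s (n1 + n2) Q.
Proof. by rewrite /runs mulnDl; apply: costs_seq. Qed.

Lemma costs_if e P1 P2 m s C Q : bounded m -> avoids X m e -> good_expr e ->
  (expr_val m e != 0 -> costs P1 m s C Q) -> (expr_val m e = 0 -> costs P2 m s C Q) ->
  costs (If e P1 P2) m s (step_cost + C) Q.
Proof.
move=> mV eX ge H1 H2; have gc := guard_cost mV eX ge.
have [e0|e0] := eqVneq (expr_val m e) 0.
  have [T [m' [s' [ex Tn mV' q]]]] := H2 e0.
  by exists ((expr_cost m e).+1 + T), m', s'; split => //; [exact: ExecIfFalse|rewrite leq_add].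
have [T [m' [s' [ex Tn mV' q]]]] := H1 e0.
by exists ((expr_cost m e).+1 + T), m', s'; split => //; [exact: ExecIfTrue|rewrite leq_add].
Qed.

Lemma runs_if e P1 P2 m s n Q : bounded m -> avoids X m e -> good_expr e ->
  (expr_val m e != 0 -> runs P1 m s n Q) -> (expr_val m e = 0 -> runs P2 m s n Q) ->
  runs (If e P1 P2) m s n.+1 Q.
Proof. by rewrite /runs mulSn; apply: costs_if. Qed.

Fixpoint good_prog (P : program) : bool :=
  match P with
  | Skip => true
  | Store a e => good_expr a && good_expr e
  | Read a => good_expr a
  | Seq P1 P2 => good_prog P1 && good_prog P2
  | If e P1 P2 => [&& good_expr e, good_prog P1 & good_prog P2]
  | While _ _ => false
  end.

Fixpoint ticks (P : program) : nat :=
  match P with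
  | Skip | Store _ _ | Read _ => 1
  | Seq P1 P2 => ticks P1 + ticks P2
  | If _ P1 P2 => (ticks P1 + ticks P2).+1
  | While _ _ => 0
  end.

(** A weakest precondition for loop-free programs; simplifying it executes the program symbolically.
    Its side conditions keep exempt cells unread and all other cells at most [V]. *)
Fixpoint wp (P : program) (Q : memory -> seq nat -> Prop) (m : memory) (s : seq nat) : Prop :=
  match P with
  | Skip => Q m s
  | Store a e => [/\ avoids X m a && avoids X m e, X (expr_val m a) || (expr_val m e <= V)
                   & Q (update m (expr_val m a) (expr_val m e)) s]
  | Read a => [/\ avoids X m a, head 0 s <= V
                & Q (update m (expr_val m a) (head 0 s)) (behead s)]
  | Seq P1 P2 => wp P1 (wp P2 Q) m s
  | If e P1 P2 => [/\ avoids X m e, expr_val m e != 0 -> wp P1 Q m s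
                    & expr_val m e = 0 -> wp P2 Q m s]
  | While _ _ => False
  end.

Lemma bounded_update m a v : bounded m -> X a || (v <= V) -> bounded (update m a v).
Proof.
move=> mV av b bX; rewrite /update; case: eqP => [ba|_]; last exact: mV.
by move: av bX; rewrite ba => /orP[->|].
Qed.

Lemma wp_runs P Q m s : good_prog P -> bounded m -> wp P Q m s -> runs P m s (ticks P) Q.
Proof.
elim: P Q m s => [|a e|a|P1 IH1 P2 IH2|e P1 IH1 P2 IH2|//] Q m s /=.
- move=> _ mV q; exists 1, m, s; split => //; first exact: ExecSkip.
  by rewrite mul1n /step_cost -(muln1 1) leq_mul // ?(leq_trans _ leq_unit_sq) // (@leq_kappa 0).
- move=> /andP[ga ge] mV [/andP[aX eX] ev q].
  eexists _, _, _; split; [exact: ExecStore| |exact: bounded_update|exact: q].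
  by rewrite mul1n store_cost.
- move=> ga mV [aX hV q].
  eexists _, _, _; split; [exact: ExecRead| |apply: bounded_update => //|exact: q].
    by rewrite mul1n read_cost.
  by rewrite hV orbT.
- move=> /andP[g1 g2] mV w; apply: runs_seq (IH1 _ _ _ g1 mV w) _ => m' s' mV' w'.
  exact: IH2.
- move=> /and3P[ge g1 g2] mV [eX w1 w2]; apply: runs_if => // e0.
    by apply: runs_weaken (IH1 _ _ _ g1 mV (w1 e0)) _ _ => //; rewrite leq_addr.
  by apply: runs_weaken (IH2 _ _ _ g2 mV (w2 e0)) _ _ => //; rewrite leq_addl.
Qed.

Lemma runs_straight P m s n Q : good_prog P -> bounded m -> ticks P <= n -> wp P Q m s ->
  runs P m s n Q.
Proof. by move=> gP mV Pn w; apply: runs_weaken (wp_runs gP mV w) Pn _. Qed.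

End Frame.

Definition For (r : nat) (e : expr) (P : program) : program :=
  Seq (Store (Lit r) (Lit 0))
    (While (Bin Defs.Sub e (Get (Lit r)))
       (Seq P (Store (Lit r) (Bin Add (Get (Lit r)) (Lit 1))))).

Section Loop.
Variables (lin : bool) (X : pred nat) (V : nat).

Notation u := (step_cost lin V).

(** The guard and the increment cost at most [2 * u] per round beyond the body, and the
    initialisation and the failing guard another [2 * u]. The invariant is required after the
    counter is advanced, so it may refer to the whole memory. *)
Lemma costs_for r e P (Inv : nat -> memory -> seq nat -> Prop) h (c : nat -> nat) m s n
    (Q : memory -> seq nat -> Prop) :
  bounded X V m -> esize e + esize (Get (Lit r)) + 5 <= max_size -> lin ==> additive e ->
  h <= V -> ~~ X r ->
  Inv 0 (update m r 0) s ->
  (forall i m s, Inv i m s -> m r = i -> expr_val m e = h /\ avoids X m e) ->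
  (forall i m s, i < h -> bounded X V m -> Inv i m s -> m r = i ->
     costs X V P m s (c i) (fun m' s' => m' r = i /\ Inv i.+1 (update m' r i.+1) s')) ->
  \sum_(i < h) (c i + 2 * u) + 2 * u <= n ->
  (forall m s, bounded X V m -> Inv h m s -> Q m s) ->
  costs X V (For r e P) m s n Q.
Proof.
move=> mV er ea hV rX I0 Ie Ibody cn IQ.
have gs : good_expr lin (Bin Defs.Sub e (Get (Lit r))) by rewrite /good_expr /= andbT ea andbT; move: er => /=; lia.
have ga : good_expr lin (Bin Add (Get (Lit r)) (Lit 1)).
  rewrite /good_expr implybT andbT; apply: leq_trans er.
  by have b1 : bitlen 1 = 1 by []; rewrite /= b1; lia.
have gr : good_expr lin (Lit r).
  by rewrite /good_expr implybT andbT; apply: leq_trans er; rewrite /=; lia.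
have g0 : good_expr lin (Lit 0) by rewrite /good_expr implybT.
apply: (costs_weaken _ cn IQ); rewrite addnC /For.
set W := While _ _.
suff H j m1 s1 : j <= h -> bounded X V m1 -> Inv j m1 s1 -> m1 r = j ->
    costs X V W m1 s1 (\sum_(j <= i < h) (c i + 2 * u) + u) (Inv h).
  rewrite -(big_mkord xpredT (fun i => c i + 2 * u)).
  rewrite (_ : 2 * u + _ = u + (\sum_(0 <= i < h) (c i + 2 * u) + u)); last by lia.
  rewrite -{1}[u]mul1n.
  apply: (@costs_seq _ _ _ _ _ _ (1 * u) _ _ (fun m' s' => m' = update m r 0 /\ s' = s)).
    apply: (@wp_runs lin X V (Store (Lit r) (Lit 0))); rewrite /= ?gr //.
    by split => //; rewrite orbT.
  move=> m' s' mV' [m'E ->]; rewrite m'E in mV' *; apply: H => //; by rewrite /update eqxx.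
have [d] := ubnP (h - j); elim: d => // d IH in j m1 s1 *.
rewrite ltnS => hjd jh mV1 I1 m1r; have [ee eX] := Ie _ _ _ I1 m1r.
have gX : avoids X m1 (Bin Defs.Sub e (Get (Lit r))) by rewrite /= eX rX.
move: jh; rewrite leq_eqVlt => /predU1P[jh|jh].
  exists (expr_cost m1 (Bin Defs.Sub e (Get (Lit r)))).+1, m1, s1; split => //.
  - by apply: ExecWhileFalse; rewrite /= ee m1r jh subnn.
  - by apply: leq_trans (guard_cost mV1 gX gs) _; rewrite leq_addl.
  - by rewrite -jh.
have [T1 [m2 [s2 [ex1 Tn1 mV2 [m2r I2]]]]] := Ibody _ _ _ jh mV1 I1 m1r.
have := @wp_runs lin X V (Store (Lit r) (Bin Add (Get (Lit r)) (Lit 1)))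
  (fun m' s' => m' = update m2 r j.+1 /\ s' = s2) m2 s2.
rewrite [good_prog _ _]/= gr ga => /(_ isT mV2) [|Ts [m3 [s3 [exs Tns mV3 [m3E s3E]]]]].
  rewrite /= m2r (negbTE rX) addn1; split => //.
  exact: leq_trans jh hV.
rewrite m3E s3E in exs mV3.
have [|||T2 [m4 [s4 [ex2 Tn2 mV4 I4]]]] := IH j.+1 _ _ _ _ mV3 I2 => //.
- by rewrite subnS; lia.
- by rewrite /update eqxx.
eexists _, m4, s4; split; [|  |exact: mV4|exact: I4].
  apply: ExecWhileTrue ex2; last exact: ExecSeq ex1 exs.
  by rewrite /= ee m1r subn_eq0 -ltnNge.
have := guard_cost mV1 gX gs.
rewrite (big_ltn jh); move: Tn1 Tn2 Tns; rewrite [ticks _]/= mul1n mul2n; lia.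
Qed.

Lemma runs_for r e P (Inv : nat -> memory -> seq nat -> Prop) h (c : nat -> nat) m s n
    (Q : memory -> seq nat -> Prop) :
  bounded X V m -> esize e + esize (Get (Lit r)) + 5 <= max_size -> lin ==> additive e ->
  h <= V -> ~~ X r ->
  Inv 0 (update m r 0) s ->
  (forall i m s, Inv i m s -> m r = i -> expr_val m e = h /\ avoids X m e) ->
  (forall i m s, i < h -> bounded X V m -> Inv i m s -> m r = i ->
     runs lin X V P m s (c i) (fun m' s' => m' r = i /\ Inv i.+1 (update m' r i.+1) s')) ->
  \sum_(i < h) (c i + 2) + 2 <= n ->
  (forall m s, bounded X V m -> Inv h m s -> Q m s) ->
  runs lin X V (For r e P) m s n Q.
Proof.
move=> mV er ea hV rX I0 Ie Ibody cn IQ.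
apply: (costs_for (Inv := Inv) (h := h) (c := fun i => c i * u)) => //.
under eq_bigr do rewrite -mulnDl.
by rewrite -big_distrl -mulnDl leq_mul2r cn orbT.
Qed.

End Loop.

(** * The in-place transform *)

Notation "# r" := (Get (Lit r)) (at level 2, format "# r").
Notation "r ::= e" := (Store (Lit r) e) (at level 70).
Notation "P ;; Q" := (Seq P Q) (at level 75, right associativity).

(* Cells below 64 are registers:
   0 result, 1 n, 2 k, 3 p, 4 index of a polynomial, 5 flag, 6 coefficient,
   7 loop counter, 8 power of 2, 9 mask or point, 10 degree, 11 exponent,
   12 maximal degree, 13 number of masks, 14 loop counter, 15 2 ^ n, 16 m,
   17 N = n - m, 18 2 ^ N, 19 2 ^ m, 20 l, 22 M = p ^ (k + l), 23 D, 24 k + 1,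
   25 loop counter, 26 sum, 27 product, 32 p ^ l; parameters of [transform]:
   21 number of bits, 28 range of y, 29 factor, 30 modulus, 31 weight bound.
   Above them are four interleaved arrays, named by the address of their first
   cell: 64 buffered coefficients, 65 list of masks, 66 weights, 67 tables. *)
Definition ad (a z : nat) : nat := z + z + (z + z) + a.
(** The index is quadrupled by additions, so that array accesses stay [additive] and remain
    available where multiplication is excluded. *)
Definition adr (a : nat) (e : expr) : expr := Bin Add (Bin Add (Bin Add e e) (Bin Add e e)) (Lit a).
Definition arr (a : nat) (e : expr) : expr := Get (adr a e).

(** An array is named by its residue modulo 4: 0 for the buffer, 1 for the masks, 2 for the weights,
    3 for the tables. *)
Definition in_arrays (S : seq nat) (a : nat) : bool := (64 <= a) && (a %% 4 \in S).

Lemma in_arrays_ad S a z : 64 <= a -> in_arrays S (ad a z) = (a %% 4 \in S).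
Proof.
move=> a64; rewrite /in_arrays /ad (leq_trans a64 (leq_addl _ _)) /=.
by rewrite (_ : z + z + (z + z) + a = z * 4 + a) ?modnMDl //; lia.
Qed.

Lemma ad_lit a z r : r < 64 -> 64 <= a -> (ad a z == r) = false.
Proof. by move=> r64 a64; apply/eqP; rewrite /ad; lia. Qed.

Lemma lit_ad a z r : r < 64 -> 64 <= a -> (r == ad a z) = false.
Proof. by move=> r64 a64; rewrite eq_sym ad_lit. Qed.

Lemma ad_eq a a' z z' : 64 <= a < 68 -> 64 <= a' < 68 ->
  (ad a z == ad a' z') = (a == a') && (z == z').
Proof. by move=> Ha Ha'; rewrite /ad; apply/eqP/andP => [|[/eqP-> /eqP->]] //; split; apply/eqP; lia. Qed.

Lemma idx_eq k z z' i i' : i <= k -> i' <= k ->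
  (z * k.+1 + i == z' * k.+1 + i') = (z == z') && (i == i').
Proof.
move=> ik ik'; apply/eqP/andP => [H|[/eqP-> /eqP->]] //.
have zz : z = z'.
  by rewrite -[z]addn0 -(@divn_small i k.+1) // -divnMDl // H divnMDl // divn_small // addn0.
by move: H; rewrite zz => /addnI ->.
Qed.

Definition same (W S : seq nat) (m m' : memory) :=
  forall a, a \notin W -> ~~ in_arrays S a -> m' a = m a.

Lemma same_ad W S m m' a z : same W S m m' -> 64 <= a -> a %% 4 \notin S ->
  all (fun r => r < 64) W -> m' (ad a z) = m (ad a z).
Proof.
move=> H a64 aS Wr; apply: H; last by rewrite in_arrays_ad.
by apply/negP => /(allP Wr); rewrite /ad; lia.
Qed.

Lemma same_update W S m m' a v : same W S m m' -> (a \in W) || in_arrays S a ->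
  same W S m (update m' a v).
Proof.
move=> H aWS b bW bS; rewrite /update; case: eqP => [ba|_]; last exact: H.
by move: aWS bW bS; rewrite ba => /orP[->|->].
Qed.

Lemma same_update_ad W S m m' a z v : same W S m m' -> 64 <= a -> a %% 4 \in S ->
  same W S m (update m' (ad a z) v).
Proof. by move=> H a64 aS; apply: same_update => //; rewrite in_arrays_ad // aS orbT. Qed.

Ltac same_updates :=
  repeat first [apply: same_update; [|by []] | apply: same_update_ad; [|by []|by []]]; try assumption.

Lemma same_trans W S m1 m2 m3 : same W S m1 m2 -> same W S m2 m3 -> same W S m1 m3.
Proof. by move=> H1 H2 a aW aS; rewrite H2 // H1. Qed.

Lemma same_sub W' S' W S m m' : same W' S' m m' -> {subset W' <= W} -> {subset S' <= S} ->
  same W S m m'.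
Proof.
move=> H WW SS a aW aS; apply: H; first by apply: contra aW; apply: WW.
by apply: contra aS => /andP[a64 /SS aS]; apply/andP.
Qed.

(* Table [i <= k] at point [z]; table [k] holds the partial sums [H]. *)
Definition tidx z i := Bin Add (Bin Mul z #24) i.

Definition tb k (m : memory) z i := m (ad 67 (z * k.+1 + i)).

Lemma updE m a v b : update m a v b = if b == a then v else m b.
Proof. by []. Qed.

Lemma tb_reg k m r v z i : r < 64 -> tb k (update m r v) z i = tb k m z i.
Proof. by move=> r64; rewrite /tb /update ad_lit. Qed.

(* Adds [c] times the entry at [z - 2 ^ j] to the entry at [z], for every bit [j]
   of every point [z = x + 2 ^ N * y] with [y < Y] and [x] of weight at most [D].
   Entries without bit [j] are left alone in round [j], so the order of the
   points does not matter. *)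
Definition transform : program :=
  8 ::= Lit 1 ;;
  For 7 #21
    (For 14 #18
       (If (Bin Defs.Sub (Bin Add #31 (Lit 1)) (arr 66 #14))
          (For 25 #28
             (9 ::= Bin Add #14 (Bin Mul #18 #25) ;;
              If (Bin Mod (Bin Div #9 #8) (Lit 2))
                (Store (adr 67 (tidx #9 #4))
                   (Bin Mod (Bin Add (arr 67 (tidx #9 #4))
                               (Bin Mul #29 (arr 67 (tidx (Bin Defs.Sub #9 #8) #4)))) #30))
                Skip))
          Skip) ;;
     8 ::= Bin Add #8 #8).

Definition runs0 V := runs false xpred0 V.

Section TransformSpec.
Variables (V k N Y D c Md J i : nat) (m : memory).
Hypotheses (m18 : m 18 = 2 ^ N) (m28 : m 28 = Y) (m31 : m 31 = D) (m29 : m 29 = c)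
  (m30 : m 30 = Md) (m21 : m 21 = J) (m4 : m 4 = i) (m24 : m 24 = k.+1) (ik : i <= k)
  (mwt : forall x, x < 2 ^ N -> m (ad 66 x) = wt N x).
Hypotheses (Md0 : 0 < Md) (MdV : Md <= V) (JV : J <= V) (YV : Y <= V) (PV : 2 ^ N <= V)
  (PYV : 2 ^ N * Y <= V) (PJV : 2 ^ J <= V) (V0 : 0 < V).

Let A j := table_transform (dom N Y D) c Md j (fun z => tb k m z i).
Let W := [:: 7; 8; 9; 14; 25].

Definition low_count := \sum_(x < 2 ^ N) (wt N x <= D).

Let tabled (m' : memory) (f : nat -> nat) :=
  forall z i', i' <= k -> tb k m' z i' = if i' == i then f z else tb k m z i'.

Let invy j x y (m' : memory) (s' : seq nat) :=
  [/\ same W [:: 3] m m', m' 8 = 2 ^ j, m' 7 = j, m' 14 = x &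
      tabled m' (fun z => if (z %% 2 ^ N < x) || ((z %% 2 ^ N == x) && (z %/ 2 ^ N < y))
                          then A j.+1 z else A j z)].

Lemma transform_y j x y s m1 : j < J -> x < 2 ^ N -> wt N x <= D -> y < Y ->
  bounded xpred0 V m1 -> invy j x y m1 s -> m1 25 = y ->
  runs0 V
   (9 ::= Bin Add #14 (Bin Mul #18 #25) ;;
              If (Bin Mod (Bin Div #9 #8) (Lit 2))
                (Store (adr 67 (tidx #9 #4))
                   (Bin Mod (Bin Add (arr 67 (tidx #9 #4))
                               (Bin Mul #29 (arr 67 (tidx (Bin Defs.Sub #9 #8) #4)))) #30))
                Skip) m1 s 4 (fun m' s' => m' 25 = y /\ invy j x y.+1 (update m' 25 y.+1) s').
Proof.
move=> jJ xP xD yY mV [Hs m8 m7 m14 Ht] m25.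
apply: (wp_runs (P := Seq _ _)) => //.
rewrite /= m14 m25 (Hs 18 isT isT) m18; set z := x + _.
have P0 : 0 < 2 ^ N by rewrite expn_gt0.
have zx : z %% 2 ^ N = x by rewrite /z addnC mulnC modnMDl modn_small.
have zy : z %/ 2 ^ N = y by rewrite /z addnC mulnC divnMDl // divn_small // addn0.
have dz : dom N Y D z by rewrite /dom zx zy yY.
have Aj w : A j.+1 w = table_step (dom N Y D) c Md j (A j) w by [].
split => //.
  apply: leq_trans PYV; apply: (@leq_trans (2 ^ N * y.+1)).
    by rewrite mulnS leq_add2r ltnW.
  by rewrite leq_mul2l yY orbT.
set m2 := update m1 9 z.
have e9 : m2 9 = z by [].
have e8 : m2 8 = 2 ^ j by rewrite -m8.
have e24 : m2 24 = k.+1 by rewrite /m2 /update /= (Hs 24 isT isT).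
have e4 : m2 4 = i by rewrite /m2 /update /= (Hs 4 isT isT).
have e29 : m2 29 = c by rewrite /m2 /update /= (Hs 29 isT isT).
have e30 : m2 30 = Md by rewrite /m2 /update /= (Hs 30 isT isT).
have e25 : m2 25 = y by rewrite -m25.
have e7 : m2 7 = j by rewrite -m7.
have e14 : m2 14 = x by rewrite -m14.
have Hs2 : same W [:: 3] m m2 by apply: same_update.
have Et w i' : tb k m2 w i' = tb k m1 w i' by exact: tb_reg.
have Agt w : w != z -> (w %% 2 ^ N == x) && (w %/ 2 ^ N < y.+1) = (w %% 2 ^ N == x) && (w %/ 2 ^ N < y).
  move=> wz; case: eqP => //= wx; rewrite ltnS leq_eqVlt; case: eqP => // wy.
  by move: wz; rewrite /z -wx -wy addnC mulnC -divn_eq eqxx.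
rewrite e9 e8 e24 e4 e29 e30 -!/(ad _ _) modn2 -/(bit z j) eqb0 negbK.
split => // [bz|/eqP].
  rewrite -!/(tb _ _ _ _) !Et !Ht // !eqxx zx zy ltnn eqxx ltnn /=.
  have -> : (if ((z - 2 ^ j) %% 2 ^ N < x) || ((z - 2 ^ j) %% 2 ^ N == x) && ((z - 2 ^ j) %/ 2 ^ N < y)
      then A j.+1 (z - 2 ^ j) else A j (z - 2 ^ j)) = A j (z - 2 ^ j).
    by case: ifP => // _; rewrite Aj /table_step bit_sub // eqxx andbF andbF.
  split => //; first by apply: leq_trans MdV; apply/ltnW/ltn_pmod.
  have -> : (A j z + c * A j (z - 2 ^ j)) %% Md = A j.+1 z by rewrite Aj /table_step dz bz.
  split; first by rewrite /update lit_ad.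
  split; rewrite /update ?lit_ad //=.
    by do 2!apply: same_update => //; rewrite in_arrays_ad // orbT.
  move=> w i' i'k; rewrite /tb ad_lit // ad_eq // eqxx idx_eq //= -/(tb k m2 w i') Et Ht //.
  case: (eqVneq i' i) => [_|ii']; rewrite ?andbF ?andbT //.
  case: (eqVneq w z) => [->|wz]; first by rewrite zx zy eqxx ltnSn orbT.
  by rewrite Agt.
rewrite eqb0 => bz; split; first by [].
split => //; first exact: same_update.
move=> w i' i'k; rewrite -/m2 tb_reg // Et Ht //.
case: (eqVneq i' i) => [_|ii'] //.
case: (eqVneq w z) => [->|wz]; last by rewrite Agt.
by rewrite zx zy ltnn eqxx ltnn ltnSn Aj /table_step (negbTE bz) !andbF.
Qed.

Lemma transform_x j x s m1 : j < J -> x < 2 ^ N ->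
  bounded xpred0 V m1 -> invy j x 0 m1 s ->
  runs0 V
       (If (Bin Defs.Sub (Bin Add #31 (Lit 1)) (arr 66 #14))
          (For 25 #28
             (9 ::= Bin Add #14 (Bin Mul #18 #25) ;;
              If (Bin Mod (Bin Div #9 #8) (Lit 2))
                (Store (adr 67 (tidx #9 #4))
                   (Bin Mod (Bin Add (arr 67 (tidx #9 #4))
                               (Bin Mul #29 (arr 67 (tidx (Bin Defs.Sub #9 #8) #4)))) #30))
                Skip))
          Skip) m1 s ((wt N x <= D) * (6 * Y) + 3)
    (fun m' s' => m' 14 = x /\ invy j x.+1 0 (update m' 14 x.+1) s').
Proof.
move=> jJ xP mV [Hs m8 m7 m14 Ht].
have wtE : m1 (ad 66 x) = wt N x by rewrite (same_ad _ Hs) // mwt.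
have dP w : w %% 2 ^ N = x -> dom N Y D w = (w %/ 2 ^ N < Y) && (wt N x <= D) by rewrite /dom => ->.
rewrite addnS; apply: runs_if => //.
  rewrite /= m14 (Hs 31 isT isT) m31 addn1 -/(ad _ _) wtE subn_eq0 -ltnNge ltnS => xD.
  rewrite xD mul1n; apply: (runs_for (Inv := invy j x) (h := Y) (c := fun=> 4)) => //.
  - split => //; first exact: same_update.
    by move=> w i' i'k; rewrite tb_reg // Ht.
  - by move=> y m2 s2 [Hs2 _ _ _ _] _; rewrite /= (Hs2 28 isT isT).
  - by move=> y m2 s2 yY mV2 inv2 y2; apply: transform_y.
  - by rewrite sum_nat_const card_ord mulnC.
  move=> m2 s2 _ [Hs2 m82 m72 m142 Ht2]; split => //; split => //; first exact: same_update.
  move=> w i' i'k; rewrite tb_reg // Ht2 //.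
  (* Once all [y < Y] are done, the other points with low part [x] lie outside the domain, where the
     round changes nothing. *)
  case: eqP => // _; rewrite ltn0 andbF orbF ltnS [_ %% _ <= x]leq_eqVlt.
  case: ltngtP => // wx; case: ltnP => // Yw.
  by rewrite -[RHS]/(table_step (dom N Y D) c Md j (A j) w) /table_step dP // ltnNge Yw.
rewrite /= m14 (Hs 31 isT isT) m31 addn1 -/(ad _ _) wtE => /eqP; rewrite subn_eq0 => Dx.
have -> : (wt N x <= D) = false by rewrite leqNgt Dx.
apply: (runs_straight (P := Skip)) => //; split => //; split => //; first exact: same_update.
move=> w i' i'k; rewrite tb_reg // Ht //.
case: eqP => // _; rewrite ltn0 andbF orbF andbF orbF ltnS [_ %% _ <= x]leq_eqVlt.
case: ltngtP => // wx.
by rewrite -[RHS]/(table_step (dom N Y D) c Md j (A j) w) /table_step dP // (leqNgt _ D) Dx andbF.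
Qed.

Definition transform_ticks := J * (6 * Y * low_count + 5 * 2 ^ N + 5) + 3.

Lemma transformP s : bounded xpred0 V m ->
  runs0 V transform m s transform_ticks
    (fun m' s' => same W [:: 3] m m' /\ tabled m' (A J)).
Proof.
move=> mV; rewrite /transform_ticks addnC (_ : 3 + _ = 1 + (J * (6 * Y * low_count + 5 * 2 ^ N + 5) + 2)); last by lia.
pose R j := fun m' (s' : seq nat) => [/\ same W [:: 3] m m', m' 8 = 2 ^ j & tabled m' (A j)].
apply: (runs_seq (R := R 0)).
  apply: (runs_straight (P := Store _ _)) => //; split => //; split => //; first exact: same_update.
  by move=> w i' i'k; rewrite tb_reg // /A /=; case: eqP => // ->.
move=> m1 s1 mV1 R1; apply: (runs_for (Inv := R) (h := J)
    (c := fun=> (6 * Y * low_count + 5 * 2 ^ N + 3))) => //.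
- case: R1 => Hs m8 Ht; split => //; first exact: same_update.
  by move=> z i' i'k; rewrite tb_reg ?Ht.
- by move=> j m2 s2 [Hs2 _ _] _; rewrite /= (Hs2 21 isT isT).
- move=> j m2 s2 jJ mV2 [Hs2 m28' Ht2] m27.
  rewrite (_ : 6 * Y * low_count + 5 * 2 ^ N + 3 = 6 * Y * low_count + 5 * 2 ^ N + 2 + 1); last by lia.
  apply: (@runs_seq _ _ _ _ _ _ _ _ _ _ (fun m' s' =>
      [/\ same W [:: 3] m m', m' 8 = 2 ^ j, m' 7 = j & tabled m' (A j.+1)])).
    apply: (runs_for (Inv := fun x => invy j x 0) (h := 2 ^ N)
      (c := fun x => (wt N x <= D) * (6 * Y) + 3)) => //.
    + split => //; first exact: same_update.
      by move=> w i' i'k; rewrite tb_reg // Ht2 // andbF.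
    + by move=> x m3 s3 [Hs3 _ _ _ _] _; rewrite /= (Hs3 18 isT isT).
    + by move=> x m3 s3 xP mV3 inv3 _; apply: transform_x.
    + under eq_bigr do rewrite -addnA; rewrite big_split /= -big_distrl /= sum_nat_const card_ord.
      by rewrite -/low_count; nia.
    move=> m3 s3 _ [Hs3 m83 m73 _ Ht3]; split => // w i' i'k; rewrite Ht3 //.
    by rewrite ltn_pmod ?expn_gt0.
  move=> m3 s3 mV3 [Hs3 m83 m73 Ht3].
  apply: (runs_straight (P := Store _ _)) => //; rewrite /= m83 addnn -mul2n -expnS; split => //.
    by apply: leq_trans PJV; rewrite leq_exp2l.
  split => //; split => //; first by do 2!apply: same_update => //.
  by move=> w i' i'k; rewrite !tb_reg // Ht3.
- by rewrite sum_nat_const card_ord; apply: eq_leq; congr (_ * _ + _); lia.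
by move=> m2 s2 _ [Hs2 m82 Ht2]; split.
Qed.
End TransformSpec.

(** * Powers of two and weights of points *)

Definition powers_of_two (r : nat) (e : expr) : program :=
  r ::= Lit 1 ;; For 7 e (r ::= Bin Add #r #r).

Lemma powers_of_twoP V r r' h m s : r < 64 -> r' < 64 -> r != 7 -> r' != 7 -> r != r' ->
  bounded xpred0 V m -> m r' = h -> h <= V -> 2 ^ h <= V ->
  runs0 V (powers_of_two r #r') m s (3 * h + 3)
    (fun m' s' => [/\ same [:: r; 7] [::] m m', m' r = 2 ^ h & s' = s]).
Proof.
move=> r64 r'64 r7 r'7 rr' mV mr' hV PV; have V0 : 0 < V by apply: leq_trans PV; rewrite expn_gt0.
have br x : x < 64 -> bitlen x <= 6 by move=> x64; apply: bitlen_le.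
have ge x y : x < 64 -> y < 64 -> good_expr false (Bin Add #x #y).
  move=> /br bx /br yb; rewrite /good_expr andbT /max_size /=.
  by apply: (@leq_trans (6 + 6 + 3)) => //; lia.
have gl x : x < 64 -> good_expr false (Lit x).
  by move=> /br bx; rewrite /good_expr andbT /=; apply: leq_trans bx _.
rewrite (_ : 3 * h + 3 = 1 + (3 * h + 2)); last by lia.
pose R j := fun m' (s' : seq nat) => [/\ same [:: r; 7] [::] m m', m' r = 2 ^ j & s' = s].
apply: (runs_seq (R := R 0)).
  apply: (runs_straight (P := Store _ _)) => //; first by rewrite /= gl.
  rewrite /=; split => //; split => //; last by rewrite /update eqxx.
  by apply: same_update => //; rewrite ?inE ?eqxx.
move=> m1 s1 mV1 [Hs mr ->]; apply: (runs_for (Inv := R) (h := h) (c := fun=> 1)) => //.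
- by rewrite /max_size /=; have := br _ r'64; have b7 : bitlen 7 = 3 by []; lia.
- split => //; first by apply: same_update => //; rewrite ?inE ?eqxx ?orbT.
  by rewrite /update (negbTE r7).
- move=> j m2 s2 [Hs2 _ _] _; split => //=; rewrite Hs2 // ?inE ?negb_or ?r'7 ?andbT 1?eq_sym //.
  by rewrite /in_arrays leqNgt r'64.
- move=> j m2 s2 jh mV2 [Hs2 m2r ->] m27; apply: (runs_straight (P := Store _ _)) => //.
    by rewrite /= gl ?ge.
  rewrite /= m2r addnn -mul2n -expnS; split => //; first by apply: leq_trans PV; rewrite leq_exp2l.
  split; first by rewrite /update eq_sym (negbTE r7).
  split => //; last by rewrite /update eqxx (negbTE r7).
  by do 2!(apply: same_update; last by rewrite ?inE ?eqxx ?orbT).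
- by rewrite sum_nat_const card_ord; lia.
Qed.

Definition weights : program :=
  For 14 #18 (Store (adr 66 #14) (Bin Add (arr 66 (Bin Div #14 (Lit 2))) (Bin Mod #14 (Lit 2)))).

Lemma weightsP V N m s : bounded xpred0 V m -> m 18 = 2 ^ N -> m (ad 66 0) = 0 ->
  2 ^ N <= V -> N <= V ->
  runs0 V weights m s (3 * 2 ^ N + 2)
    (fun m' s' => [/\ same [:: 14] [:: 2] m m', s' = s &
                     forall x, x < 2 ^ N -> m' (ad 66 x) = wt N x]).
Proof.
move=> mV m18 w0 PV NV; have V0 : 0 < V by apply: leq_trans PV; rewrite expn_gt0.
pose R j := fun m' (s' : seq nat) => [/\ same [:: 14] [:: 2] m m', s' = s, m' (ad 66 0) = 0 &
                     forall x, x < j -> m' (ad 66 x) = wt N x].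
apply: (runs_for (Inv := R) (h := 2 ^ N) (c := fun=> 1)) => //.
- by split => //; apply: same_update.
- by move=> j m2 s2 [Hs2 _ _ _] _; rewrite /= (Hs2 18 isT isT).
- move=> x m1 s1 xN mV1 [Hs -> m0 mx] m14; apply: (runs_straight (P := Store _ _)) => //.
  rewrite /= m14 -!/(ad _ _).
  have -> : m1 (ad 66 (x %/ 2)) + x %% 2 = wt N x.
    (* At [x = 0] the entry refers to itself and relies on its initial content 0. *)
    have [->|x0] := posnP x.
      by rewrite m0 /wt big1 // => i _; rewrite /bit div0n.
    by rewrite mx ?ltn_Pdiv // -wt_half.
  split => //; first by apply: leq_trans (wt_le _ _) NV.
  split; first by rewrite /update lit_ad.
  split => //.
  + by do 2!apply: same_update => //; rewrite ?in_arrays_ad // orbT.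
  + rewrite /update ad_lit // ad_eq //=; case: eqP => // <-.
    by rewrite /wt big1 // => i _; rewrite /bit div0n.
  + move=> w; rewrite ltnS /update ad_lit // ad_eq //= => wx.
    by case: eqP => [->//|/eqP wx']; apply: mx; rewrite ltn_neqAle wx' wx.
- by rewrite sum_nat_const card_ord; lia.
- by move=> m2 s2 _ [Hs2 -> _ H].
Qed.

Lemma eq_xform dm c M J f g : f =1 g -> table_transform dm c M J f =1 table_transform dm c M J g.
Proof. by move=> fg; elim: J => [//|J IH] z; rewrite !table_transformS /table_step !IH. Qed.

(** * Evaluation, products and interpolation on the machine *)

Definition evals : program :=
  (28 ::= #19 ;; 31 ::= #23 ;; 29 ::= Lit 1 ;; 30 ::= #3 ;; 21 ::= #1) ;; For 4 #2 transform.

(** Cell 31 is part of the conclusion because the first transform of [interpolate] takes its weight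
    bound from there. *)
Lemma evalsP V p k n N mm D m s :
  bounded xpred0 V m -> m 1 = n -> m 2 = k -> m 3 = p -> m 18 = 2 ^ N -> m 19 = 2 ^ mm ->
  m 23 = D -> m 24 = k.+1 -> (forall x, x < 2 ^ N -> m (ad 66 x) = wt N x) ->
  N + mm = n -> 0 < p -> p <= V -> k <= V -> D <= V -> 2 ^ n <= V ->
  runs0 V evals m s (k * (transform_ticks N (2 ^ mm) D n + 2) + 7)
    (fun m' s' => [/\ same [:: 4; 7; 8; 9; 14; 21; 25; 28; 29; 30; 31] [:: 3] m m', m' 31 = D &
      forall z i, i <= k -> tb k m' z i =
        if i < k then table_transform (dom N (2 ^ mm) D) 1 p n (fun z => tb k m z i) z else tb k m z i]).
Proof.
move=> mV m1 m2 m3 m18 m19 m23 m24 mwt Nm p0 pV kV DV nV.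
have n2 : n < 2 ^ n by exact: ltn_expl.
have NV : 2 ^ N <= V by apply: leq_trans nV; rewrite leq_exp2l // -Nm leq_addr.
have mmV : 2 ^ mm <= V by apply: leq_trans nV; rewrite leq_exp2l // -Nm leq_addl.
have nV' : n <= V by apply: leq_trans (ltnW n2) nV.
have V0 : 0 < V by apply: leq_trans nV; rewrite expn_gt0.
pose W := [:: 4; 7; 8; 9; 14; 21; 25; 28; 29; 30; 31].
pose R i0 := fun m' (s' : seq nat) => [/\ same W [:: 3] m m',
   [/\ m' 21 = n, m' 28 = 2 ^ mm, m' 29 = 1, m' 30 = p & m' 31 = D] &
      forall z i, i <= k -> tb k m' z i =
        if i < i0 then table_transform (dom N (2 ^ mm) D) 1 p n (fun z => tb k m z i) z else tb k m z i].
rewrite addnC (_ : 7 + _ = 5 + (k * (transform_ticks N (2 ^ mm) D n + 2) + 2)); last by lia.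
apply: (runs_seq (R := R 0)).
  apply: (runs_straight (P := Seq _ _)) => //; rewrite /= !updE /= m19 m23 m3 m1.
  do 5!split => //; split; first by do 5!apply: same_update => //.
    by rewrite !updE /= .
  by move=> z i ik; rewrite ltn0 !tb_reg.
move=> m0 s0 mV0 R0; apply: (runs_for (Inv := R) (h := k)
    (c := fun=> transform_ticks N (2 ^ mm) D n)) => //.
- case: R0 => [Hs ? Ht]; split => //; first exact: same_update.
  by move=> z i ik; rewrite tb_reg // Ht.
- by move=> i m' s' [Hs _ _] _; rewrite /= (Hs 2 isT isT).
- move=> i m' s' ik mV' [Hs [m21 m28 m29 m30 m31] Ht] m4.
  have := @transformP V k N (2 ^ mm) D 1 p n i m'.
  move=> /(_ (etrans (Hs 18 isT isT) m18) m28 m31 m29 m30 m21 m4 (etrans (Hs 24 isT isT) m24) (ltnW ik)).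
  have mwt' x : x < 2 ^ N -> m' (ad 66 x) = wt N x by move=> xN; rewrite (same_ad _ Hs) ?mwt.
  rewrite -expnD Nm => /(_ mwt' p0 pV nV' mmV NV nV nV V0 s' mV') HT.
  apply: (runs_weaken HT) => // m1' s1 _ [Hs1 Ht1]; split; first by rewrite (Hs1 4).
  split.
  + apply: same_update => //; apply: same_trans Hs (same_sub Hs1 _ _) => //.
    by apply/allP.
  + by rewrite !updE /= (Hs1 21 isT isT) (Hs1 28 isT isT) (Hs1 29 isT isT) (Hs1 30 isT isT) (Hs1 31 isT isT).
  + move=> z i' i'k; rewrite tb_reg // Ht1 // ltnS leq_eqVlt Ht //.
    case: eqP => [->|//]; by apply: eq_xform => w; rewrite (Ht _ _ (ltnW ik)) ltnn.
- by rewrite sum_nat_const card_ord.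
by move=> m' s' _ [Hs [_ _ _ _ ->] Ht].
Qed.

(** Table [k] is written at low-weight points only and keeps its initial zeros elsewhere, as
    interpolation requires. *)
Definition products : program :=
  For 14 #18
    (If (Bin Defs.Sub (Bin Add #23 (Lit 1)) (arr 66 #14))
       (26 ::= Lit 0 ;;
        For 25 #19
          ((9 ::= Bin Add #14 (Bin Mul #18 #25) ;; 27 ::= Lit 1) ;;
           For 4 #2 (27 ::= Bin Mul #27 (Bin Mod (arr 67 (tidx #9 #4)) #3)) ;;
           26 ::= Bin Add #26 #27) ;;
        Store (adr 67 (tidx #14 #2)) #26)
       Skip).

Section Products.
Variables (V k N Y D p : nat) (m : memory).
Hypotheses (m2 : m 2 = k) (m3 : m 3 = p) (m18 : m 18 = 2 ^ N) (m19 : m 19 = Y)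
  (m23 : m 23 = D) (m24 : m 24 = k.+1) (mwt : forall x, x < 2 ^ N -> m (ad 66 x) = wt N x).
Hypotheses (p0 : 0 < p) (kV : k <= V) (YV : Y <= V) (PV : 2 ^ N <= V)
  (PYV : 2 ^ N * Y <= V) (pkV : p ^ k <= V) (YpV : Y * p ^ k <= V) (V0 : 0 < V).

Let val z := \prod_(i < k) (tb k m z i %% p).
Definition table_sum x := \sum_(y < Y) val (x + 2 ^ N * y).

Let W := [:: 4; 9; 14; 25; 26; 27].

Let prod_le (K : nat) z : K <= k -> \prod_(i < K) (tb k m z i %% p) <= p ^ k.
Proof.
move=> Kk; apply: (@leq_trans (p ^ K)); last by rewrite leq_pexp2l.
elim: K {Kk} => [|K IH]; first by rewrite big_ord0.
by rewrite big_ord_recr expnSr; apply: leq_mul => //; apply/ltnW/ltn_pmod.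
Qed.

Let sum_le (y : nat) x : y <= Y -> \sum_(y' < y) val (x + 2 ^ N * y') <= Y * p ^ k.
Proof.
move=> yY; apply: (@leq_trans (y * p ^ k)); last by rewrite leq_mul2r yY orbT.
elim: y {yY} => [|y IH]; first by rewrite big_ord0.
by rewrite big_ord_recr mulSnr; apply: leq_add => //; apply: prod_le.
Qed.

Let prodS i z : \prod_(i' < i.+1) (tb k m z i' %% p)
  = (\prod_(i' < i) (tb k m z i' %% p)) * (tb k m z i %% p).
Proof. by rewrite big_ord_recr. Qed.

Let sumS x y : \sum_(y' < y.+1) val (x + 2 ^ N * y')
  = \sum_(y' < y) val (x + 2 ^ N * y') + val (x + 2 ^ N * y).
Proof. by rewrite big_ord_recr. Qed.

Let inv x (m' : memory) (s' : seq nat) := same W [:: 3] m m' /\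
  (forall z i, i <= k -> tb k m' z i =
     if [&& i == k, z < x & wt N z <= D] then table_sum z else tb k m z i).

Lemma productsP s : bounded xpred0 V m ->
  runs0 V products m s (low_count N D * ((3 * k + 7) * Y) + 7 * 2 ^ N + 2)
    (fun m' s' => same W [:: 3] m m' /\
      (forall z i, i <= k -> tb k m' z i =
        if [&& i == k, z < 2 ^ N & wt N z <= D] then table_sum z else tb k m z i)).
Proof.
move=> mV; apply: (runs_for (Inv := inv) (h := 2 ^ N)
  (c := fun x => (wt N x <= D) * ((3 * k + 7) * Y) + 5)) => //.
- split => //; first exact: same_update.
  by move=> z i ik; rewrite tb_reg // andbF.
- by move=> x m1 s1 [Hs _] _; rewrite /= (Hs 18 isT isT).
- move=> x m1 s1 xP mV1 [Hs Ht] m14.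
  have wtE : m1 (ad 66 x) = wt N x by rewrite (same_ad _ Hs) // mwt.
  rewrite addnS; apply: runs_if => //.
    rewrite /= m14 (Hs 23 isT isT) m23 addn1 -/(ad _ _) wtE subn_eq0 -ltnNge ltnS => xD.
    rewrite xD mul1n.
    pose R y := fun m' (s' : seq nat) => [/\ same W [:: 3] m m', m' 14 = x,
       m' 26 = \sum_(y' < y) val (x + 2 ^ N * y')
       & forall z i, i <= k -> tb k m' z i = tb k m1 z i].
    rewrite (_ : _ + 4 = 1 + ((3 * k + 7) * Y + 2 + 1)); last by lia.
    apply: (runs_seq (R := R 0)).
      apply: (runs_straight (P := Store _ _)) => //; split => //; split => //.
      + exact: same_update.
      + by rewrite big_ord0.
      + by move=> z i ik; rewrite tb_reg.
    move=> m3' s3 mV3 R3; apply: (runs_seq (R := R Y)).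
      apply: (runs_for (Inv := R) (h := Y) (c := fun=> 3 * k + 5)) => //.
      + case: R3 => Hs3 m3x m3s Ht3; split => //; first exact: same_update.
        by move=> z i ik; rewrite tb_reg // Ht3.
      + by move=> y m4 s4 [Hs4 _ _ _] _; rewrite /= (Hs4 19 isT isT).
      + move=> y m4 s4 yY mV4 [Hs4 m4x m4s Ht4] m4y.
        pose z := x + 2 ^ N * y.
        pose S i := fun m' (s' : seq nat) => [/\ same W [:: 3] m m', m' 14 = x /\ m' 25 = y,
          m' 26 = \sum_(y' < y) val (x + 2 ^ N * y'),
          m' 9 = z /\ m' 27 = \prod_(i' < i) (tb k m z i' %% p)
          & forall z i, i <= k -> tb k m' z i = tb k m1 z i].
        rewrite (_ : 3 * k + 5 = 2 + ((3 * k + 2) + 1)); last by lia.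
        apply: (runs_seq (R := S 0)).
          apply: (runs_straight (P := Seq _ _)) => //; rewrite /= m4x (Hs4 18 isT isT) m18 m4y -/z.
          split => //.
            apply: leq_trans PYV; apply: (@leq_trans (2 ^ N * y.+1)).
              by rewrite mulnS leq_add2r ltnW.
            by rewrite leq_mul2l yY orbT.
          split => //; split => //.
          * by do 2!apply: same_update => //.
          * by rewrite !updE /= big_ord0.
          * by move=> w i ik; rewrite !tb_reg // Ht4.
        move=> m5 s5 mV5 S5; apply: (runs_seq (R := S k)).
          apply: (runs_for (Inv := S) (h := k) (c := fun=> 1)) => //.
          * case: S5 => Hs5 m5x m5s m5z Ht5; split => //; first exact: same_update.
            by move=> w i ik; rewrite tb_reg // Ht5.
          * by move=> i m6 s6 [Hs6 _ _ _ _] _; rewrite /= (Hs6 2 isT isT).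
          * move=> i m6 s6 ik mV6 [Hs6 m6x m6s [m6z m6p] Ht6] m6i.
            apply: (runs_straight (P := Store _ _)) => //.
            rewrite /= m6z m6p m6i (Hs6 24 isT isT) m24 (Hs6 3 isT isT) m3 -/(ad _ _) -/(tb _ _ _ _).
            rewrite Ht6 ?(ltnW ik) // Ht ?(ltnW ik) // (ltn_eqF ik) /=.
            rewrite -prodS.
            split => //; first by apply: leq_trans pkV; apply: prod_le.
            split => //; split => //.
            - by do 2!apply: same_update => //.
            - by move=> w i' i'k; rewrite !tb_reg // Ht6.
          * by rewrite sum_nat_const card_ord; lia.
        move=> m6 s6 mV6 [Hs6 [m6x m6y] m6s [m6z m6p] Ht6].
        apply: (runs_straight (P := Store _ _)) => //; rewrite /= m6s m6p.
        rewrite -/(val z) -sumS.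
        split => //; first by apply: leq_trans YpV; apply: sum_le.
        split => //; split => //; first by do 2!apply: same_update => //.
        by move=> w i' i'k; rewrite !tb_reg // Ht6.
      + by rewrite sum_nat_const card_ord; lia.
    move=> m4 s4 mV4 [Hs4 m4x m4s Ht4].
    apply: (runs_straight (P := Store _ _)) => //.
    rewrite /= m4x m4s (Hs4 24 isT isT) m24 (Hs4 2 isT isT) m2 -/(ad _ _).
    split => //; first by apply: leq_trans YpV; apply: sum_le.
    split; first by rewrite updE lit_ad.
    split; first by do 2!apply: same_update => //; rewrite in_arrays_ad // orbT.
    move=> w i ik; rewrite tb_reg // /tb updE ad_eq // idx_eq //= -!/(tb _ _ _ _) Ht4 // Ht //.
    case: (eqVneq i k) => [->|ik']; rewrite ?andbF ?andbT //=.
    case: (eqVneq w x) => [->|wx]; first by rewrite ltnSn xD.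
    by rewrite ltnS [w <= x]leq_eqVlt (negbTE wx).
  rewrite /= m14 (Hs 23 isT isT) m23 addn1 -/(ad _ _) wtE => /eqP; rewrite subn_eq0 => Dx.
  apply: (runs_straight (P := Skip)) => //; first by rewrite addnS.
  split => //; split; first exact: same_update.
  move=> z i ik; rewrite tb_reg // Ht // ltnS [z <= x]leq_eqVlt.
  by case: (eqVneq z x) => [->|]; rewrite // (leqNgt _ D) Dx !andbF.
- under eq_bigr do rewrite -addnA; rewrite big_split /= -big_distrl /= sum_nat_const card_ord.
  by rewrite -/(low_count N D); nia.
Qed.

End Products.

(** Modulo [M] the factor [M - 1] is -1, which makes the first transform the Moebius inversion. For
    the second one the weight bound [n] excludes no point. *)
Definition interpolate : program :=
  (4 ::= #2 ;; 28 ::= Lit 1 ;; 21 ::= #17 ;; 30 ::= #22 ;; 29 ::= Bin Defs.Sub #22 (Lit 1)) ;;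
  transform ;; (29 ::= Lit 1 ;; 31 ::= #1) ;; transform ;; 0 ::= Lit 0 ;;
  For 14 #18 (0 ::= Bin Add #0 (arr 67 (tidx #14 #2))).

Lemma interpolateP V k n N D M m s : bounded xpred0 V m ->
  m 1 = n -> m 2 = k -> m 17 = N -> m 18 = 2 ^ N -> m 22 = M -> m 24 = k.+1 -> m 31 = D ->
  (forall x, x < 2 ^ N -> m (ad 66 x) = wt N x) ->
  (forall z, tb k m z k < M) ->
  k <= V -> N <= n -> 2 ^ n * M <= V ->
  runs0 V interpolate m s
    (transform_ticks N 1 D N + transform_ticks N 1 n N + 3 * 2 ^ N + 10)
    (fun m' s' => m' 0 = \sum_(x < 2 ^ N)
       table_transform (dom N 1 n) 1 M N (table_transform (dom N 1 D) (M - 1) M N (fun z => tb k m z k)) x).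
Proof.
move=> mV m1 m2 m17 m18 m22 m24 m31 mwt HM kV Nn nMV.
have M0 : 0 < M by apply: leq_ltn_trans (HM 0).
have nV : 2 ^ n <= V by apply: leq_trans nMV; rewrite leq_pmulr.
have MV : M <= V by apply: leq_trans nMV; rewrite leq_pmull // expn_gt0.
have n2 : n < 2 ^ n by exact: ltn_expl.
have NV : 2 ^ N <= V by apply: leq_trans nV; rewrite leq_exp2l.
have nV' : n <= V by apply: leq_trans (ltnW n2) nV.
have NV' : N <= V by apply: leq_trans nV'.
have V0 : 0 < V by apply: leq_trans nV; rewrite expn_gt0.
pose W := [:: 4; 7; 8; 9; 14; 21; 25; 28; 29; 30; 31].
rewrite (_ : _ + 10 = 5 + (transform_ticks N 1 D N + (2 + (transform_ticks N 1 n N + (1 + (3 * 2 ^ N + 2)))))); last by lia.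
pose R c D H := fun m' (s' : seq nat) => [/\ same W [:: 3] m m',
   [/\ m' 4 = k, m' 21 = N, m' 28 = 1, m' 29 = c & m' 30 = M], m' 31 = D &
   forall z, tb k m' z k = H z].
apply: (runs_seq (R := R (M - 1) D (fun z => tb k m z k))).
  apply: (runs_straight (P := Seq _ _)) => //.
  rewrite /= !updE /= m2 m17 m22.
  do 5!split => //; first by apply: leq_trans MV; rewrite leq_subr.
  split; first by do 5!apply: same_update => //.
  + by rewrite !updE.
  + by rewrite !updE.
  + by move=> z; rewrite !tb_reg.
have trans c D' H m1' s1' : bounded xpred0 V m1' -> R c D' H m1' s1' ->
    runs0 V transform m1' s1' (transform_ticks N 1 D' N) (R c D' (table_transform (dom N 1 D') c M N H)).
  move=> mV1 [Hs [m1'4 m1'21 m1'28 m1'29 m1'30] m1'31 Ht].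
  have := @transformP V k N 1 D' c M N k m1'.
  move=> /(_ (etrans (Hs 18 isT isT) m18) m1'28 m1'31 m1'29 m1'30 m1'21 m1'4 (etrans (Hs 24 isT isT) m24) (leqnn k)).
  have mwt' x : x < 2 ^ N -> m1' (ad 66 x) = wt N x by move=> xN; rewrite (same_ad _ Hs) ?mwt.
  rewrite muln1 => /(_ mwt' M0 MV NV' V0 NV NV NV V0 s1' mV1) HT.
  apply: (runs_weaken HT) => // m2' s2 _ [Hs1 Ht1]; split.
  + by apply: same_trans Hs (same_sub Hs1 _ _) => //; apply/allP.
  + by rewrite (Hs1 4 isT isT) (Hs1 21 isT isT) (Hs1 28 isT isT) (Hs1 29 isT isT) (Hs1 30 isT isT).
  + by rewrite (Hs1 31 isT isT).
  + by move=> z; rewrite Ht1 // eqxx; apply: eq_xform.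
move=> m3 s3 mV3 R3; apply: runs_seq (trans _ _ _ _ _ mV3 R3) _.
set H1 := table_transform _ _ _ _ _ => m4 s4 mV4 [Hs4 [m44 m421 m428 m429 m430] m431 Ht4].
apply: (runs_seq (R := R 1 n H1)).
  apply: (runs_straight (P := Seq _ _)) => //.
  rewrite /= !updE /= (Hs4 1 isT isT) m1.
  do 2!split => //; split.
  + by do 2!apply: same_update => //.
  + by rewrite !updE.
  + by rewrite !updE.
  + by move=> z; rewrite !tb_reg.
move=> m5 s5 mV5 R5; apply: runs_seq (trans _ _ _ _ _ mV5 R5) _.
set H2 := table_transform _ _ _ _ H1 => m6 s6 mV6 [Hs6 _ _ Ht6].
have H2M z : H2 z < M by do 2!apply: table_transform_lt => // *.
pose S x := fun m' (s' : seq nat) => [/\ same [:: 0, 14 & W] [:: 3] m m',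
  m' 0 = \sum_(x' < x) H2 x' & forall z, tb k m' z k = H2 z].
apply: (runs_seq (R := S 0)).
  apply: (runs_straight (P := Store _ _)) => //; split => //; split.
  + by apply: same_update => //; apply: same_sub Hs6 _ _ => //; apply/allP.
  + by rewrite updE big_ord0.
  + by move=> z; rewrite tb_reg.
move=> m7 s7 mV7 S7; apply: (runs_for (Inv := S) (h := 2 ^ N) (c := fun=> 1)) => //.
- case: S7 => Hs7 m70 Ht7; split => //; first exact: same_update.
  by move=> z; rewrite tb_reg.
- by move=> i m8 s8 [Hs8 _ _] _; rewrite /= (Hs8 18 isT isT).
- move=> x m8 s8 xN mV8 [Hs8 m80 Ht8] m8x.
  apply: (runs_straight (P := Store _ _)) => //.
  rewrite /= m80 m8x (Hs8 24 isT isT) m24 (Hs8 2 isT isT) m2 -/(ad _ _) -/(tb _ _ _ _) Ht8.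
  have E : \sum_(x' < x.+1) H2 x' = \sum_(x' < x) H2 x' + H2 x by rewrite big_ord_recr.
  rewrite -E; split => //.
    apply: leq_trans nMV; apply: (@leq_trans (x.+1 * M)); last first.
      by rewrite leq_mul2r (leq_trans xN) ?orbT // leq_exp2l.
    by rewrite -[X in _ <= X * _]card_ord -sum_nat_const; apply: leq_sum => i _; apply: ltnW.
  split => //; split => //; first by do 2!apply: same_update => //.
  by move=> z; rewrite !tb_reg.
- by rewrite sum_nat_const card_ord mulnC.
- by move=> m8 s8 _ [_ -> _].
Qed.

(** * Choice of the block length, the modulus and the degree bound *)

Definition parameters : program :=
  16 ::= Bin Div #1 (Bin Mul (Lit 6) (Bin Mul #12 #3)) ;;
  powers_of_two 19 #16 ;;
  22 ::= Lit 1 ;;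
  For 7 #2 (22 ::= Bin Mul #22 #3) ;;
  (20 ::= Lit 0 ;; 32 ::= Lit 1) ;;
  For 7 #16
    (If (Bin Defs.Sub #19 #32) (32 ::= Bin Mul #32 #3 ;; 20 ::= Bin Add #20 (Lit 1)) Skip) ;;
  22 ::= Bin Mul #22 #32 ;;
  23 ::= Bin Mul #12 (Bin Mul (Bin Defs.Sub #3 (Lit 1))
                        (Bin Defs.Sub (Bin Add (Bin Add #2 #2) #20) (Lit 1))) ;;
  If (Bin Defs.Sub (Bin Mul (Lit 3) (Bin Add #23 #16)) #1)
     (16 ::= Lit 0 ;; 19 ::= Lit 1 ;; 23 ::= #1) Skip ;;
  17 ::= Bin Defs.Sub #1 #16 ;;
  18 ::= Bin Div #15 #19.

Definition block (n p d : nat) := n %/ (6 * (d * p)).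

(** This is [d (p - 1) (L + k - 1)] for [L = k + l]. *)
Definition degree_bound (p k d l : nat) := d * ((p - 1) * (k + k + l - 1)).

(** [l] is the least exponent with [2 ^ block <= p ^ l]. Minimality makes the outcome unique, bounds
    the modulus by [p ^ k * (p * 2 ^ n)], and enters the choice between the two modes. *)
Record params_spec (n p k d mm l D : nat) : Prop := ParamsSpec {
  params_pow : 2 ^ block n p d <= p ^ l;
  params_min : 0 < l -> p ^ l.-1 < 2 ^ block n p d;
  params_le : l <= block n p d;
  params_mode : (mm, D) = if n < 3 * (degree_bound p k d l + block n p d) then (0, n)
                          else (block n p d, degree_bound p k d l) }.

Lemma parametersP V n p k d m s : bounded xpred0 V m ->
  m 1 = n -> m 2 = k -> m 3 = p -> m 12 = d -> m 15 = 2 ^ n -> 1 < p ->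
  k <= V -> p ^ k * (p * 2 ^ n) <= V -> (forall l, l <= n -> degree_bound p k d l <= V) ->
  runs0 V parameters m s (9 * n + 3 * k + 30)
    (fun m' s' => s' = s /\ same [:: 7; 16; 17; 18; 19; 20; 22; 23; 32] [::] m m' /\
      exists mm l D, [/\ params_spec n p k d mm l D, m' 23 = D, m' 22 = p ^ k * p ^ l &
        [/\ m' 16 = mm, m' 19 = 2 ^ mm, m' 17 = n - mm & m' 18 = 2 ^ (n - mm)]]).
Proof.
move=> mV m1 m2 m3 m12 m15 p1 kV pV DV; have p0 := ltnW p1.
have n2 : n < 2 ^ n by exact: ltn_expl.
have pk0 : 0 < p ^ k by rewrite expn_gt0 p0.
have ppV : p * 2 ^ n <= V by apply: leq_trans pV; rewrite leq_pmull.
have nV : 2 ^ n <= V by apply: leq_trans ppV; rewrite leq_pmull.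
have nV' : n <= V by apply: leq_trans (ltnW n2) nV.
have V0 : 0 < V by apply: leq_trans nV; rewrite expn_gt0.
pose W := [:: 7; 16; 17; 18; 19; 20; 22; 23; 32].
pose b := block n p d.
have bn : b <= n by exact: leq_div.
have bV : 2 ^ b <= V by apply: leq_trans nV; rewrite leq_exp2l.
set Post := (X in runs0 _ _ _ _ _ X).
apply: (@runs_weaken _ _ _ _ _ _ (1 + (3 * b + 3 + (1 + (3 * k + 2 + (2 + (6 * b + 2 + 9)))))) _ Post); [|lia|done].
pose Q m' (s' : seq nat) := s' = s /\ same W [::] m m'.
apply: (runs_seq (R := fun m' s' => Q m' s' /\ m' 16 = b)).
  apply: (runs_straight (P := Store _ _)) => //; rewrite /= m1 m3 m12.
  split => //; first exact: leq_trans nV'.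
  by split => //; split => //; apply: same_update.
move=> ma sa mVa [[-> Hsa] ma16].
apply: (runs_seq (R := fun m' s' => [/\ Q m' s', m' 16 = b & m' 19 = 2 ^ b])).
  apply: (runs_weaken (powers_of_twoP _ _ _ _ _ _ mVa ma16 _ bV)) => //; first exact: leq_trans nV'.
  move=> mb sb _ [Hsb mb19 ->]; rewrite mb19 (Hsb 16 isT isT) ma16.
  by split => //; split => //; apply: same_trans Hsa (same_sub Hsb _ _) => //; apply/allP.
move=> mb sb mVb [[-> Hsb] mb16 mb19].
pose R j := fun m' s' => [/\ Q m' s', m' 16 = b, m' 19 = 2 ^ b & m' 22 = p ^ j].
apply: (runs_seq (R := R 0)).
  apply: (runs_straight (P := Store _ _)) => //; split => //; split => //.
  by split => //; apply: same_update.
move=> mc sc mVc Rc.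
apply: (runs_seq (R := R k)).
  apply: (runs_for (Inv := R) (h := k) (c := fun=> 1)) => //.
  - by case: Rc => [[-> Hsc] ? ? ?]; split => //; split => //; apply: same_update.
  - by move=> i m' s' [[_ Hs] _ _ _] _; rewrite /= (Hs 2 isT isT).
  - move=> i m' s' ik mV' [[-> Hs] m'16 m'19 m'22] m'7.
    apply: (runs_straight (P := Store _ _)) => //.
    rewrite /= m'22 (Hs 3 isT isT) m3 -expnSr; split => //.
      apply: leq_trans pV; rewrite -[X in X <= _]muln1 leq_mul ?muln_gt0 ?p0 ?expn_gt0 //.
      by rewrite leq_exp2l.
    split => //; split => //; split => //; by do 2!apply: same_update => //.
  - by rewrite sum_nat_const card_ord mulnC.
move=> md sd mVd [[-> Hsd] md16 md19 md22].
(* [l] equals the number of rounds until [p ^ l] reaches [2 ^ b] and then stays; [b] rounds suffice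
   as [p >= 2]. *)
pose S j := fun m' s' => [/\ Q m' s', m' 16 = b /\ m' 19 = 2 ^ b, m' 22 = p ^ k &
   exists l, [/\ m' 20 = l /\ m' 32 = p ^ l, l <= j, 0 < l -> p ^ l.-1 < 2 ^ b &
                (2 ^ b <= p ^ l) || (l == j)]].
apply: (runs_seq (R := S 0)).
  apply: (runs_straight (P := Seq _ _)) => //; split => //; split => //; split => //.
    by split => //; do 2!apply: same_update => //.
  by exists 0; split => //; rewrite orbT.
move=> me se mVe Se.
apply: (runs_seq (R := S b)).
  apply: (runs_for (Inv := S) (h := b) (c := fun=> 4)) => //.
  - exact: leq_trans nV'.
  - case: Se => [[-> Hse] [? ?] ? [l [[? ?] ? ? ?]]]; split => //; first by split => //; apply: same_update.
    by exists l; split.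
  - by move=> j m' s' [_ [m'16 _] _ _] _; rewrite /= m'16.
  - move=> j m' s' jb mV' [[-> Hs] [m'16 m'19] m'22 [l [[m'20 m'32] lj lmin lor]]] m'7.
    apply: (runs_straight (P := If _ _ _)) => //.
    rewrite /= m'19 m'32; split => //.
      rewrite subn_eq0 -ltnNge => lb; have lj' : l = j by move: lor; rewrite leqNgt lb => /eqP.
      rewrite (Hs 3 isT isT) m3 -expnSr; split => //.
        apply: leq_trans ppV; rewrite expnS leq_mul2l; apply/orP; right.
        apply: leq_trans (ltnW lb) _; by rewrite leq_exp2l.
      rewrite !updE /= m'20 addn1; split => //.
        by apply: leq_trans nV'; apply: leq_trans bn; rewrite lj'.
      split => //; split => //; first by split => //; do 3!apply: same_update => //.
      by exists l.+1; rewrite lj'; split => //; [rewrite -lj'|rewrite eqxx orbT].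
    move=> /eqP; rewrite subn_eq0 => bl; split => //; split => //.
      by split => //; apply: same_update.
    by exists l; split => //; [exact: leqW|rewrite bl].
  - by rewrite sum_nat_const card_ord mulnC.
move=> mf sf mVf [[-> Hsf] [mf16 mf19] mf22 [l [[mf20 mf32] lb lmin lor]]].
have powl : 2 ^ b <= p ^ l.
  by case/orP: lor => // /eqP ->; case: (b) => [|b'] //; rewrite leq_exp2r.
have lV : p ^ k * p ^ l <= V.
  apply: leq_trans pV; rewrite leq_mul2l; apply/orP; right.
  case: (l) lmin lb => [|l'] lmin lb; first by rewrite muln_gt0 p0 expn_gt0.
  rewrite expnS leq_mul2l; apply/orP; right.
  by apply: leq_trans (ltnW (lmin isT)) _; rewrite leq_exp2l.
pose D0 := degree_bound p k d l.
apply: (runs_straight (P := Seq _ _)) => //.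
rewrite /= mf22 mf32 !updE /= (Hsf 12 isT isT) m12 (Hsf 3 isT isT) m3 (Hsf 2 isT isT) m2 mf20.
rewrite -[d * _]/D0 (Hsf 1 isT isT) m1 mf16 mf19 (Hsf 15 isT isT) m15 subn_eq0 -ltnNge.
do 2!(split => //); first by apply: DV; apply: leq_trans lb bn.
have fin mm D m' a c : a = n - mm -> c = 2 ^ (n - mm) -> params_spec n p k d mm l D ->
    m' 23 = D -> m' 22 = p ^ k * p ^ l ->
    m' 16 = mm -> m' 19 = 2 ^ mm -> same W [::] m m' ->
    Post (update (update m' 17 a) 18 c) s.
  move=> aE cE H m'23 m'22 m'16 m'19 Hm; split => //; split; first by do 2!apply: same_update => //.
  by exists mm, l, D; split => //; split => //; rewrite !updE.
split => //.
  move=> nD; rewrite subn0 divn1; do 5!split => //.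
  apply: (fin 0 n); rewrite ?updE ?subn0 //=.
  - by split => //; rewrite nD.
  - by do 5!apply: same_update => //.
move/eqP; rewrite subn_eq0 leqNgt => nD.
have H1 : n - b <= V by apply: leq_trans nV'; apply: leq_subr.
have H2 : 2 ^ n %/ 2 ^ b <= V by apply: leq_trans nV; apply: leq_div.
do 2!split => //; apply: (fin b D0); rewrite ?updE //=.
- by rewrite expnB.
- by split => //; rewrite (negbTE nD).
- by do 2!apply: same_update => //.
Qed.

(** * Reading the input *)

Definition read_exponents : program :=
  For 7 #1
    (Read (Lit 11) ;; If #11 (9 ::= Bin Add #9 #8 ;; 10 ::= Bin Add #10 (Lit 1)) Skip ;;
     8 ::= Bin Add #8 #8).

(** Terms such as [x] and [x ^ 2] share a mask, and their coefficients add up. Both summands lie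
    between 1 and [p], so subtracting [p] once is enough to return to this range. *)
Definition add_to_buffer : program :=
  If (arr 64 #9)
    (Store (adr 64 #9) (Bin Add (arr 64 #9) #6) ;;
     If (Bin Defs.Sub (arr 64 #9) #3) (Store (adr 64 #9) (Bin Defs.Sub (arr 64 #9) #3)) Skip)
    (Store (adr 65 #13) #9 ;; 13 ::= Bin Add #13 (Lit 1) ;; Store (adr 64 #9) #6).

(** Cell 10 counts variables instead of adding exponents, since only the degree after multilinear
    reduction matters. Cell 11 is cleared because an exponent may exceed any bound kept on the
    memory. *)
Definition read_term : program :=
  Read (Lit 6) ;; (9 ::= Lit 0 ;; 10 ::= Lit 0 ;; 8 ::= Lit 1) ;; read_exponents ;;
  11 ::= Lit 0 ;;
  If (Bin Defs.Sub #10 #12) (12 ::= #10) Skip ;;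
  add_to_buffer ;;
  Read (Lit 5).

(* [k], the index [i], [k + 1] and the last exponent: the cost of reading a term
   must not depend on [log k], and must be linear in [log p], whence also the
   absence of [Mod] in [add_to_buffer]. *)
Definition unread : pred nat := fun a => [|| a == 2, a == 4, a == 11 | a == 24].

Lemma unread_ad a z : 64 <= a -> unread (ad a z) = false.
Proof. by move=> a64; rewrite /unread !ad_lit. Qed.

Lemma kappa_ge n : n <= 1000 -> n <= kappa.
Proof.
move=> n1; apply: leq_trans (@leq_kappa n _); first by rewrite expnS expn1; nia.
exact: leq_trans n1 _.
Qed.

Lemma exec_seqE P1 P2 m s T m' s' : exec (Seq P1 P2) m s T m' s' ->
  exists T1 m1 s1 T2, [/\ exec P1 m s T1 m1 s1, exec P2 m1 s1 T2 m' s' & T = T1 + T2].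
Proof. by move=> ex; inversion ex; eexists _, _, _, _; split; eauto. Qed.

Section RawCosts.
Variables (X : pred nat) (V : nat).

Let step_ge n : n <= 1000 -> n <= step_cost true V.
Proof. by move=> /kappa_ge n1; apply: leq_trans n1 _; rewrite /step_cost leq_pmulr. Qed.

(** For numbers of unbounded size, namely exponents: each is charged its own length, which the input
    size pays for. *)
Lemma costs_read r m s : r < 64 -> bounded X V m -> X r || (head 0 s <= V) ->
  costs X V (Read (Lit r)) m s (step_cost true V + bitlen (head 0 s))
    (fun m' s' => m' = update m r (head 0 s) /\ s' = behead s).
Proof.
move=> r64 mV rX; eexists _, _, _; split; [exact: ExecRead| |exact: bounded_update|by []].
rewrite /= leq_add2r; have : bitlen r <= 6 by exact: bitlen_le.
by move=> r6; apply: leq_trans (step_ge (isT : 12 <= 1000)); rewrite (leq_add r6 r6).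
Qed.

Lemma costs_if_cell r P1 P2 m s C Q : r < 64 ->
  (m r != 0 -> costs X V P1 m s C Q) -> (m r = 0 -> costs X V P2 m s C Q) ->
  costs X V (If #r P1 P2) m s (step_cost true V + bitlen (m r) + C) Q.
Proof.
move=> r64 H1 H2; have r6 : bitlen r <= 6 by exact: bitlen_le.
have gc : (expr_cost m #r).+1 <= step_cost true V + bitlen (m r).
  rewrite /= -addSn leq_add2r; apply: leq_trans (step_ge (isT : 13 <= 1000)).
  by rewrite ltnS (leq_add r6 r6).
have [e0|e0] := eqVneq (m r) 0.
  have [T [m' [s' [ex Tn mV' q]]]] := H2 e0.
  by exists ((expr_cost m #r).+1 + T), m', s'; split => //; [exact: ExecIfFalse|rewrite leq_add].
have [T [m' [s' [ex Tn mV' q]]]] := H1 e0.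
by exists ((expr_cost m #r).+1 + T), m', s'; split => //; [exact: ExecIfTrue|rewrite leq_add].
Qed.

Lemma costs_while_cell r P m s C (Q : memory -> seq nat -> Prop) : r < 64 -> bounded X V m ->
  (m r = 0 -> Q m s) ->
  (m r != 0 -> costs X V (Seq P (While #r P)) m s C Q) ->
  costs X V (While #r P) m s (step_cost true V + bitlen (m r) + C) Q.
Proof.
move=> r64 mV H0 H1; have r6 : bitlen r <= 6 by exact: bitlen_le.
have gc : (expr_cost m #r).+1 <= step_cost true V + bitlen (m r).
  rewrite /= -addSn leq_add2r; apply: leq_trans (step_ge (isT : 13 <= 1000)).
  by rewrite ltnS (leq_add r6 r6).
have [e0|e0] := eqVneq (m r) 0.
  exists (expr_cost m #r).+1, m, s; split => //; [exact: ExecWhileFalse| |exact: H0].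
  exact: leq_trans gc (leq_addr _ _).
have [T [m' [s' [ex Tn mV' q]]]] := H1 e0.
have [T1 [m1 [s1 [T2 [ex1 ex2 TE]]]]] := exec_seqE ex; rewrite TE in Tn.
exists ((expr_cost m #r).+1 + T1 + T2), m', s'; split => //; first exact: ExecWhileTrue ex2.
by rewrite -addnA leq_add.
Qed.

End RawCosts.

Lemma size_supp es : size (supp es) = \sum_(j < size es) (nth 0 es j != 0).
Proof.
rewrite /supp size_filter -sum1_count -(big_mkord xpredT (fun j => nat_of_bool (nth 0 es j != 0))).
by rewrite big_mkcond /= /index_iota subn0; apply: eq_bigr => j _; case: eqP.
Qed.

Section ReadExponents.
Variables (n V : nat).
Hypothesis nV : 2 ^ n <= V.
Notation u := (step_cost true V).

Definition exponent_bits (es : seq nat) := \sum_(e <- es) bitlen e.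

(** Each exponent is charged twice, when it is read and when it is tested; the rest is a constant
    number of steps per variable. *)
Lemma read_exponentsP es s m : bounded unread V m -> size es = n ->
  m 1 = n -> m 8 = 1 -> m 9 = 0 -> m 10 = 0 ->
  costs unread V read_exponents m (es ++ s) ((7 * n + 2) * u + 2 * exponent_bits es)
    (fun m' s' => [/\ s' = s, same [:: 7; 8; 9; 10; 11] [::] m m', m' 9 = mask es &
                     m' 10 = size (supp es)]).
Proof.
move=> mV es_n m1 m8 m9 m10.
have n2 : n < 2 ^ n by exact: ltn_expl.
have nV' : n <= V by apply: leq_trans nV; apply: ltnW.
have V0 : 0 < V by apply: leq_trans nV; rewrite expn_gt0.
pose R j := fun m' s' => [/\ s' = drop j es ++ s, same [:: 7; 8; 9; 10; 11] [::] m m', m' 8 = 2 ^ j,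
  m' 9 = \sum_(i < j) (nth 0 es i != 0) * 2 ^ i & m' 10 = \sum_(i < j) (nth 0 es i != 0)].
apply: (costs_for (lin := true) (Inv := R) (h := n) (c := fun j => 5 * u + 2 * bitlen (nth 0 es j))) => //.
- split; rewrite ?updE ?big_ord0 //=; [by rewrite drop0|exact: same_update].
- by move=> j m' s' [_ Hs _ _ _] _; rewrite /= (Hs 1 isT isT).
- move=> j m' s' jn mV' [-> Hs m'8 m'9 m'10] m'7.
  have dj : drop j es = nth 0 es j :: drop j.+1 es by rewrite (drop_nth 0) // es_n.
  rewrite (_ : 5 * u + _ = (u + bitlen (nth 0 es j)) + ((u + bitlen (nth 0 es j) + 2 * u) + 1 * u)); last by lia.
  apply: (costs_seq (R := fun m1 s1 => m1 = update m' 11 (nth 0 es j) /\ s1 = drop j.+1 es ++ s)).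
    by have := @costs_read unread V 11 m' (drop j es ++ s) isT mV' isT; rewrite dj.
  move=> m2 s2 mV2 [m2E ->]; pose e := nth 0 es j.
  have maskS : \sum_(i < j.+1) (nth 0 es i != 0) * 2 ^ i
      = \sum_(i < j) (nth 0 es i != 0) * 2 ^ i + (nth 0 es j != 0) * 2 ^ j by rewrite big_ord_recr.
  have degS : \sum_(i < j.+1) (nth 0 es i != 0)
      = \sum_(i < j) (nth 0 es i != 0) + (nth 0 es j != 0) by rewrite big_ord_recr.
  have sumV : \sum_(i < j.+1) (nth 0 es i != 0) * 2 ^ i <= V.
    apply: leq_trans nV; apply: ltnW; apply: leq_trans (sum_bits_lt j.+1 (fun i => nth 0 es i != 0)) _.
    by rewrite leq_exp2l.
  have degV : \sum_(i < j.+1) (nth 0 es i != 0) <= V.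
    apply: leq_trans nV'; apply: leq_trans jn; rewrite -[X in _ <= X]card_ord -sum1_card.
    by apply: leq_sum => i _; case: eqP.
  apply: (costs_seq (R := fun m1 s1 => [/\ s1 = drop j.+1 es ++ s, m1 7 = j, same [:: 7; 8; 9; 10; 11] [::] m m1, m1 8 = 2 ^ j &
    m1 9 = \sum_(i < j.+1) (nth 0 es i != 0) * 2 ^ i /\ m1 10 = \sum_(i < j.+1) (nth 0 es i != 0)])).
    have m211 : m2 11 = nth 0 es j by rewrite m2E.
    rewrite -m211; apply: costs_if_cell => // [m2n|m20].
      apply: (runs_straight (lin := true) (P := Seq _ _)) => //.
      rewrite m2E /= !updE /= m'9 m'8 m'10; move: m2n; rewrite m211 => enz.
      rewrite maskS enz mul1n in sumV; rewrite degS enz in degV.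
      do 2!split => //; split => //; first by do 3!apply: same_update => //.
      by rewrite maskS degS enz mul1n.

    apply: (runs_straight (lin := true) (P := Skip)) => //.
    rewrite m2E /= !updE /= m'9 m'8 m'10; move: m20; rewrite m211 => enz.
    by rewrite maskS degS enz mul0n !addn0; split => //; apply: same_update.
  move=> m3 s3 mV3 [-> m37 Hs3 m38 [m39 m310]].
  apply: (runs_straight (lin := true) (P := Store _ _)) => //.
  rewrite /= m38 addnn -mul2n -expnS; split => //; first by apply: leq_trans nV; rewrite leq_exp2l.
  by split => //; split => //; do 2!apply: same_update => //.
- rewrite big_split big_split /= !sum_nat_const !card_ord -big_distrr /=.
  have -> : exponent_bits es = \sum_(j < n) bitlen (nth 0 es j).
    by rewrite /exponent_bits (big_nth 0) big_mkord es_n.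
  by set S := (\sum_(_ < _) _); nia.
- move=> m' s' mV' [-> Hs m'8 m'9 m'10]; split => //.
  + by rewrite -es_n drop_size.
  + by rewrite m'9 /mask es_n.
  + by rewrite m'10 size_supp es_n.
Qed.

End ReadExponents.

Lemma coef_rcons f t z : coef (rcons f t) z = coef f z + (mask t.2 == z) * t.1.
Proof.
rewrite /coef -cats1 big_cat /= big_cons big_nil; congr (_ + _).
by case: eqP => _; rewrite ?mul1n ?addn0.
Qed.

Section ReadTerms.
Variables (n p : nat).
Hypothesis p0 : 0 < p.

(** Masks are below [2 ^ n] and sums in the buffer, before reduction, at most [2 * p]. *)
Definition read_bound := 2 ^ n + 2 * p.
Notation u := (step_cost true read_bound).

Definition valid_term (t : term) := [&& 0 < t.1, t.1 < p & size t.2 == n].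

Definition encode_terms (f : seq term) : seq nat :=
  rcons (flatten [seq 1 :: t.1 :: t.2 | t <- f]) 0.

(* Cell 13 counts the distinct masks read, listed in array 65; array 64 holds
   the coefficients, shifted to 1, ..., p so that 0 means "not yet seen". *)
Definition buffered (f : seq term) (m : memory) := exists Ls : seq nat,
  [/\ uniq Ls, size Ls = m 13, forall t, t < size Ls -> m (ad 65 t) = nth 0 Ls t,
      Ls =i [seq mask t.2 | t <- f] &
      forall z, [/\ m (ad 64 z) <= p, (m (ad 64 z) == 0) = (z \notin Ls) &
                    m (ad 64 z) = coef f z %[mod p]]].

Definition reading (m0 : memory) d (f : seq term) (m : memory) :=
  [/\ bounded unread read_bound m, same [:: 5; 6; 7; 8; 9; 10; 11; 12; 13] [:: 0; 1] m0 m,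
      m 11 = 0, m 12 = maxn d (\max_(t <- f) size (supp t.2)) & buffered f m].

Lemma add_to_bufferP f t m s : all valid_term (rcons f t) ->
  bounded unread read_bound m -> buffered f m -> m 9 = mask t.2 -> m 6 = t.1 -> m 3 = p ->
  runs true unread read_bound add_to_buffer m s 8
    (fun m' s' => [/\ s' = s, same [:: 13] [:: 0; 1] m m' & buffered (rcons f t) m']).
Proof.
rewrite all_rcons => /andP[/and3P[c0 cp /eqP tn] fv] mV [Ls [uLs sLs nLs LsE bufE]] m9 m6 m3.
have pV : 2 * p <= read_bound by exact: leq_addl.
have nV : 2 ^ n <= read_bound by exact: leq_addr.
have msk : mask t.2 < 2 ^ n by rewrite -tn mask_lt.
have [bp b0 bE] := bufE (mask t.2).
have LsV : {subset Ls <= iota 0 (2 ^ n)}.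
  move=> z; rewrite LsE mem_iota /= add0n => /mapP[t' /(allP fv) /and3P[_ _ /eqP t'n] ->].
  by rewrite -t'n mask_lt.
apply: (runs_straight (P := If _ _ _)) => //.
rewrite /= m9 m6 -!/(ad _ _) !unread_ad //=; split => // [|/eqP].
  rewrite b0 negbK => mL; set v := m (ad 64 (mask t.2)) in bp bE *.
  set ma := update m _ _.
  have -> : ma 9 = mask t.2 by rewrite /ma updE lit_ad.
  have -> : ma 3 = p by rewrite /ma updE lit_ad.
  have -> : ma (ad 64 (mask t.2)) = v + t.1 by rewrite /ma updE eqxx.
  have fin w m' : same [:: 13] [:: 0; 1] m m' -> m' 13 = m 13 ->
      (forall i, m' (ad 65 i) = m (ad 65 i)) ->
      (forall z, m' (ad 64 z) = if z == mask t.2 then w else m (ad 64 z)) ->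
      0 < w <= p -> w = v + t.1 %[mod p] -> buffered (rcons f t) m'.
    move=> Hm m'13 m'L m'b /andP[w0 wp] wv; exists Ls; split => //.
    - by rewrite m'13.
    - by move=> i iL; rewrite m'L nLs.
    - move=> z; rewrite map_rcons mem_rcons inE -LsE.
      by case: eqP => [->|].
    - move=> z; rewrite m'b coef_rcons; case: (eqVneq z (mask t.2)) => [->|zt].
        rewrite mul1n mL; split => //; first by rewrite eqn0Ngt w0.
        by rewrite wv -modnDml bE modnDml.
      by rewrite mul0n addn0; apply: bufE.
  have v0 : 0 < v by rewrite lt0n b0 negbK.
  have vcV : v + t.1 <= read_bound by apply: leq_trans pV; rewrite mul2n -addnn leq_add // ltnW.
  split => //; split => // [|/eqP].
    rewrite subn_eq0 -ltnNge => lt; split; [by []|exact: leq_trans (leq_subr _ _) vcV|split => //].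
      by same_updates.
    apply: (fin (v + t.1 - p)).
    - by same_updates.
    - by rewrite /ma !updE !lit_ad.
    - by move=> i; rewrite /ma !updE !ad_eq //=.
    - by move=> z; rewrite /ma !updE !ad_eq //=; case: eqP.
    - by rewrite subn_gt0 lt /= leq_subLR leq_add // ltnW.
    - by rewrite -[in RHS](subnK (ltnW lt)) modnDr.
  rewrite subn_eq0 => le; split => //.
    by same_updates.
  apply: (fin (v + t.1)) => //.
  - by same_updates.
  - by rewrite /ma !updE !lit_ad.
  - by move=> i; rewrite /ma !updE !ad_eq //=.
  - by move=> z; rewrite /ma !updE !ad_eq //=; case: eqP.
  - by rewrite le addn_gt0 v0.
rewrite b0 => mL.
have uL' : uniq (rcons Ls (mask t.2)) by rewrite rcons_uniq mL.
have L2 : size Ls < 2 ^ n.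
  rewrite -(size_rcons Ls (mask t.2)) -[X in _ <= X](size_iota 0); apply: uniq_leq_size => // z.
  by rewrite mem_rcons inE => /predU1P[->|/LsV //]; rewrite mem_iota add0n.
have e13 : update m (ad 65 (m 13)) (mask t.2) 13 = m 13 by rewrite updE lit_ad.
rewrite !e13; set ma := update (update _ _ _) _ _.
have -> : ma 9 = mask t.2 by rewrite /ma !updE lit_ad.
have -> : ma 6 = t.1 by rewrite /ma !updE lit_ad.
split => //; first by apply: leq_trans nV; apply: ltnW.
split => //; first by apply: leq_trans nV; rewrite -sLs addn1.
split => //; first by apply: leq_trans pV; apply: leq_trans (ltnW cp) _; rewrite leq_pmull.
split => //.
  by same_updates.
exists (rcons Ls (mask t.2)); split => //.
- by rewrite size_rcons /ma !updE lit_ad //= addn1 sLs.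
- move=> i; rewrite size_rcons nth_rcons ltnS => iL.
  rewrite /ma !updE !ad_eq //= ad_lit // -sLs; case: ltngtP iL => // iL _; exact: nLs.
- by move=> z; rewrite map_rcons !mem_rcons !inE LsE.
- move=> z; rewrite /ma !updE !ad_eq //= ad_lit // coef_rcons mem_rcons inE.
  case: (eqVneq z (mask t.2)) => [->|zt] /=; last by rewrite mul0n addn0; apply: bufE.
  rewrite mul1n; split => //; first exact: ltnW.
    by rewrite eqn0Ngt c0.
  rewrite -modnDml -bE; move: b0; rewrite mL => /eqP ->; by rewrite mod0n.
Qed.

Lemma read_termP m0 d f t b s m : m0 1 = n -> m0 3 = p ->
  all valid_term (rcons f t) -> b <= 1 -> reading m0 d f m ->
  costs unread read_bound read_term m (t.1 :: t.2 ++ b :: s)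
    ((7 * n + 21) * u + 2 * (bitlen t.1 + exponent_bits t.2))
    (fun m' s' => [/\ s' = s, m' 5 = b & reading m0 d (rcons f t) m']).
Proof.
move=> m01 m03 /[dup] fval; rewrite all_rcons => /andP[/and3P[c0 cp /eqP tn] fv] b1 [mV Hs m11 m12 [Ls [uLs sLs nLs LsE bufE]]].
have pV : 2 * p <= read_bound by exact: leq_addl.
have nV : 2 ^ n <= read_bound by exact: leq_addr.
have n2 : n < 2 ^ n by exact: ltn_expl.
have nV' : n <= read_bound by apply: leq_trans nV; apply: ltnW.
have V0 : 0 < read_bound by apply: leq_trans nV; rewrite expn_gt0.
have pV' : p <= read_bound by apply: leq_trans pV; rewrite leq_pmull.
have cV : t.1 <= read_bound by apply: leq_trans (ltnW cp) pV'.
have msk : mask t.2 < 2 ^ n by rewrite -tn mask_lt.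
have deg : size (supp t.2) <= n.
  by rewrite size_filter -tn -[X in _ <= X](size_iota 0); apply: count_size.
rewrite (_ : _ + _ = (u + bitlen t.1) + (3 * u + (((7 * n + 2) * u + 2 * exponent_bits t.2) + 15 * u + bitlen t.1))); last by nia.
apply: (costs_seq (R := fun m1 s1 => m1 = update m 6 t.1 /\ s1 = t.2 ++ b :: s)).
  by apply: (@costs_read unread read_bound 6 m (t.1 :: t.2 ++ b :: s)) => //; rewrite cV orbT.
move=> m1 s1 mV1 [m1E ->].
apply: (costs_seq (R := fun m2 s2 => s2 = t.2 ++ b :: s /\ m2 = update (update (update m1 9 0) 10 0) 8 1)).
  by apply: (runs_straight (lin := true) (P := Seq _ _)).
move=> m2 s2 mV2 [-> m2E].
have m21 : m2 1 = n by rewrite m2E m1E !updE /= (Hs 1 isT isT).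
apply: (@costs_leq _ _ _ _ _ (((7 * n + 2) * u + 2 * exponent_bits t.2) + 15 * u)); first by lia.
apply: (costs_seq (read_exponentsP nV (b :: s) mV2 tn m21 _ _ _)); try by rewrite m2E !updE.
move=> m3 s3 mV3 [-> Hs3 m39 m310].
have m312 : m3 12 = maxn d (\max_(t <- f) size (supp t.2)) by rewrite (Hs3 12 isT isT) m2E m1E !updE /= m12.
have m36 : m3 6 = t.1 by rewrite (Hs3 6 isT isT) m2E m1E !updE.
have m33 : m3 3 = p by rewrite (Hs3 3 isT isT) m2E m1E !updE /= (Hs 3 isT isT).
have m313 : m3 13 = size Ls by rewrite (Hs3 13 isT isT) m2E m1E !updE sLs.
have m3a a z : 64 <= a -> m3 (ad a z) = m (ad a z).
  by move=> a64; rewrite (same_ad _ Hs3) // m2E m1E !updE !ad_lit.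
have Hs3' : same [:: 5; 6; 7; 8; 9; 10; 11; 12; 13] [:: 0; 1] m0 m3.
  apply: same_trans (same_sub Hs3 _ _) => //; last by apply/allP.
  by rewrite m2E m1E; do 4!apply: same_update => //.
set dd := maxn d _ in m312.
have dE : (if size (supp t.2) - dd != 0 then size (supp t.2) else dd)
    = maxn d (\max_(t' <- rcons f t) size (supp t'.2)).
  rewrite -cats1 big_cat big_cons big_nil /= maxn0 maxnA -/dd subn_eq0 -ltnNge.
  by rewrite /maxn.
apply: (runs_seq (n1 := 1) (n2 := 14) (R := fun m4 s4 => s4 = b :: s /\ m4 = update m3 11 0)).
  by apply: (runs_straight (P := Store _ _)).
move=> m4 s4 mV4 [-> m4E].
apply: (runs_seq (n1 := 3) (n2 := 11) (R := fun m5 s5 => s5 = b :: s /\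
    forall a, m5 a = if a == 12 then maxn d (\max_(t' <- rcons f t) size (supp t'.2)) else m4 a)).
  apply: (runs_straight (P := If _ _ _)) => //.
  rewrite /= m4E !updE /= m310 m312; split => // [ne|/eqP e].
    split => //; first exact: leq_trans nV'.
    by split => // a; rewrite updE -dE ne.
  split => // a; rewrite -dE e; case: eqP => [->|//].
  by rewrite updE /= m312.
move=> m5 s5 mV5 [-> m5E].
have m5a a : a != 12 -> a != 11 -> m5 a = m3 a.
  by move=> a12 a11; rewrite m5E (negbTE a12) m4E updE (negbTE a11).
have buf5 : buffered f m5.
  exists Ls; split => //.
  - by rewrite m5a.
  - by move=> i iL; rewrite m5a ?ad_lit // m3a // nLs.
  - by move=> z; rewrite m5a ?ad_lit // m3a.
apply: (runs_seq (n1 := 8) (n2 := 3)).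
  by apply: (@add_to_bufferP f t m5) => //; rewrite m5a.
move=> m6 s6 mV6 [-> Hs6 buf6].
apply: (runs_straight (P := Read _)) => //; rewrite /=.
have bV : b <= read_bound by apply: leq_trans b1 _.
split => //; split => //; split => //.
- by apply: bounded_update => //; rewrite bV orbT.
- apply: same_update => //; apply: same_trans (same_sub Hs6 _ _) => //; last by apply/allP.
  move=> a aW aS; rewrite -(Hs3' a aW aS) m5a //; by apply: contraNneq aW => ->.
- by rewrite updE (Hs6 11 isT isT) m5E /= m4E updE.
- by rewrite updE (Hs6 12 isT isT) m5E.
- case: buf6 => Ls6 [u6 s6' n6 L6 z6]; exists Ls6; split => //.
  + by move=> i iL; rewrite updE ad_lit // n6.
  + by move=> z; rewrite updE ad_lit.
Qed.

Lemma encode_cons t f : encode_terms (t :: f) = 1 :: t.1 :: t.2 ++ encode_terms f.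
Proof. by rewrite /encode_terms /= rcons_cat. Qed.

Lemma encode_head f s : exists2 b, b <= 1 & encode_terms f ++ s = b :: behead (encode_terms f ++ s).
Proof. by case: f => [|t f]; [exists 0|exists 1; rewrite // encode_cons]. Qed.

Definition terms_cost f :=
  \sum_(t <- f) ((7 * n + 23) * u + 2 * (bitlen t.1 + exponent_bits t.2)) + 2 * u.

(** The loop starts with the next flag already in cell 5, so the stream has lost its head; [f0]
    holds the terms read so far. *)
Lemma read_termsP m0 d f0 f s m : m0 1 = n -> m0 3 = p -> all valid_term (f0 ++ f) ->
  reading m0 d f0 m -> m 5 = head 0 (encode_terms f ++ s) ->
  costs unread read_bound (While #5 read_term) m (behead (encode_terms f ++ s)) (terms_cost f)
    (fun m' s' => s' = s /\ reading m0 d (f0 ++ f) m').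
Proof.
move=> m01 m03; rewrite /terms_cost; elim: f f0 m => [|t f IH] f0 m fv Rm m5.
  have b5 : bitlen (m 5) <= u by rewrite m5 (leq_trans _ (leq_pmulr kappa _)) // (kappa_ge (isT : 1 <= 1000)).
  apply: (@costs_leq _ _ _ _ _ (u + bitlen (m 5) + 0)); first by rewrite big_nil; lia.
  by apply: costs_while_cell => //; [case: Rm|rewrite cats0|rewrite m5].
have [b b1 bE] := encode_head f s.
have {}m5 : m 5 = 1 by rewrite m5 encode_cons.
have b5 : bitlen (m 5) <= u by rewrite m5 (leq_trans _ (leq_pmulr kappa _)) // (kappa_ge (isT : 1 <= 1000)).
rewrite encode_cons /= -catA big_cons bE.
apply: (@costs_leq _ _ _ _ _ (u + bitlen (m 5) + (((7 * n + 21) * u + 2 * (bitlen t.1 + exponent_bits t.2)) +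
   (\sum_(t <- f) ((7 * n + 23) * u + 2 * (bitlen t.1 + exponent_bits t.2)) + 2 * u)))).
  by set S := (\sum_(_ <- _) _); nia.
apply: costs_while_cell => //; [by case: Rm|by rewrite m5|move=> _].
rewrite -(cat_rcons t f0 f) in fv *; have fv' : all valid_term (rcons f0 t) by move: fv; rewrite all_cat => /andP[].
apply: (costs_seq (read_termP _ m01 m03 fv' b1 Rm)) => m1 s1 mV1 [-> m15 Rm1].
by have := IH _ _ fv Rm1; rewrite bE m15; apply.
Qed.

End ReadTerms.

(** The table index involves [k], so it is formed once per distinct mask (at most [low_count n d]
    times for terms in at most [d] variables) and not once per term. The same pass clears the buffer
    for the next polynomial. *)
Definition copy : program :=
  For 14 #13
    (9 ::= arr 65 #14 ;; Store (adr 67 (tidx #9 #4)) (arr 64 #9) ;; Store (adr 64 #9) (Lit 0)).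

Definition load_poly : program :=
  (13 ::= Lit 0 ;; Read (Lit 5)) ;; While #5 read_term ;; copy.

Definition load : program :=
  (24 ::= Bin Add #2 (Lit 1) ;; 12 ::= Lit 1) ;; For 4 #2 load_poly.

Lemma costs_change X V X' V' P m s C Q : costs X V P m s C Q ->
  (forall m' s', bounded X V m' -> Q m' s' -> bounded X' V' m') -> costs X' V' P m s C Q.
Proof. by move=> [T [m' [s' [ex TC mV q]]]] H; exists T, m', s'; split => //; apply: H q. Qed.

Section Load.
Variables (n p k V : nat).
Hypotheses (p0 : 0 < p) (rV : read_bound n p <= V) (kV : k.+1 <= V).
Notation r := (read_bound n p).

Lemma copyP f i m s : bounded xpred0 V m -> bounded unread r m -> buffered p f m ->
  m 4 = i -> m 24 = k.+1 -> i <= k -> (forall z, tb k m z i = 0) ->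
  runs0 V copy m s (5 * m 13 + 2)
    (fun m' s' => [/\ s' = s, same [:: 9; 14] [:: 0; 3] m m', bounded unread r m',
       forall z, m' (ad 64 z) = 0 &
       forall z i', i' <= k -> tb k m' z i' = if i' == i then m (ad 64 z) else tb k m z i']).
Proof.
move=> mV mr [Ls [uLs sLs nLs LsE bufE]] m4 m24 ik tb0.
have V0 : 0 < V by apply: leq_trans kV.
have m13V : m 13 <= r by apply: mr.
pose R j := fun m' (s' : seq nat) => [/\ s' = s, same [:: 9; 14] [:: 0; 3] m m', bounded unread r m',
   forall z, m' (ad 64 z) = if index z Ls < j then 0 else m (ad 64 z) &
   forall z i', i' <= k -> tb k m' z i' =
     if (i' == i) && (index z Ls < j) then m (ad 64 z) else tb k m z i'].
apply: (runs_for (Inv := R) (h := m 13) (c := fun=> 3)) => //.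
- exact: leq_trans rV.
- split => //.
  + exact: same_update.
  + by apply: bounded_update; rewrite // orbT.
  + by move=> z; rewrite updE ad_lit.
  + by move=> z i' i'k; rewrite tb_reg // andbF.
- by move=> j m1 s1 [_ Hs _ _ _] _; rewrite /= (Hs 13 isT isT).
- move=> j m1 s1 jL mV1 [-> Hs mr1 Hb Ht] m1j.
  have jL' : j < size Ls by rewrite sLs.
  pose z := nth 0 Ls j.
  have zL : index z Ls = j by rewrite index_uniq.
  have m1z : m1 (ad 65 j) = z by rewrite (same_ad _ Hs) // nLs.
  have idx w : (index w Ls < j.+1) = (w == z) || (index w Ls < j).
    rewrite ltnS leq_eqVlt; congr (_ || _); apply/eqP/eqP => [wj|->//].
    have wL : w \in Ls by rewrite -index_mem wj.
    by rewrite -[LHS](nth_index 0 wL) wj.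
  have zV : z <= V by rewrite -m1z; apply: mV1.
  have bV : m (ad 64 z) <= V by apply: mV.
  apply: (runs_straight (P := Seq _ _)) => //.
  rewrite /= m1j -/(ad _ _) m1z; split => //.
  rewrite !updE /= (Hs 24 isT isT) m24 (Hs 4 isT isT) m4 -!/(ad _ _) ad_lit // Hb zL ltnn.
  split => //; rewrite !lit_ad //= -/(ad _ _); split => //; split => //; split => //.
  + by same_updates.
  + have br : m (ad 64 z) <= r by apply: mr; rewrite unread_ad.
    have zr : z <= r by rewrite -m1z; apply: mr1; rewrite unread_ad.
    have jr : j.+1 <= r by apply: leq_trans m13V.
    by repeat (apply: bounded_update; last by rewrite ?unread_ad).
  + move=> w; rewrite !updE ad_lit // !ad_eq //= ad_lit // Hb idx.
    by case: (w == z).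
  + move=> w i' i'k; rewrite tb_reg // /tb !updE !ad_eq //= ad_lit // idx_eq //= -/(tb _ _ _ _) Ht // idx.
    by case: (eqVneq w z) => [->|] //=; rewrite ?andbT; case: (i' == i).
- by rewrite sum_nat_const card_ord mulnC.
- move=> m1 s1 mV1 [-> Hs mr1 Hb Ht]; split => //.
  + move=> z; rewrite Hb -sLs index_mem; case: ifP => // /negbT zL.
    by apply/eqP; have [_ -> _] := bufE z.
  + move=> z i' i'k; rewrite Ht // -sLs index_mem; case: eqP => [->|//] /=.
    case: ifP => // /negbT zL; rewrite tb0; have [_ + _] := bufE z.
    by rewrite zL => /eqP.
Qed.

Lemma wt_mask es : size es = n -> wt n (mask es) = size (supp es).
Proof. by move=> <-; rewrite size_supp; apply: eq_bigr => j _; rewrite bit_mask. Qed.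

Lemma buffered_size d f m : all (valid_term n p) f -> {in f, forall t : term, size (supp t.2) <= d} ->
  buffered p f m -> m 13 <= low_count n d.
Proof.
move=> fv fd [Ls [uLs <- _ LsE _]].
have -> : low_count n d = size [seq z <- iota 0 (2 ^ n) | wt n z <= d].
  rewrite size_filter -sum1_count /low_count -(big_mkord xpredT (fun z => nat_of_bool (wt n z <= d))).
  by rewrite [RHS]big_mkcond /index_iota subn0; apply: eq_bigr => z _; case: (_ <= _).
apply: uniq_leq_size => // z; rewrite LsE => /mapP[t tf ->].
have /and3P[_ _ /eqP tn] := allP fv _ tf.
by rewrite mem_filter mem_iota /= add0n wt_mask // fd // -tn mask_lt.
Qed.

Notation u := (step_cost true r).
Notation U := (step_cost false V).

Lemma load_polyP d0 d f i m s : all (valid_term n p) f -> {in f, forall t : term, size (supp t.2) <= d} ->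
  bounded xpred0 V m -> bounded unread r m -> m 1 = n -> m 2 = k -> m 3 = p -> m 4 = i ->
  m 24 = k.+1 -> m 11 = 0 -> m 12 = d0 -> i <= k ->
  (forall z, m (ad 64 z) = 0) -> (forall z, tb k m z i = 0) ->
  costs xpred0 V load_poly m (encode_terms f ++ s) (terms_cost n p f + (5 * low_count n d + 4) * U)
    (fun m' s' => [/\ s' = s, same [:: 5; 6; 7; 8; 9; 10; 11; 12; 13; 14] [:: 0; 1; 3] m m',
       bounded unread r m', m' 11 = 0 /\ m' 12 = maxn d0 (\max_(t <- f) size (supp t.2)) &
       (forall z, m' (ad 64 z) = 0) /\
       forall z i', i' <= k -> if i' == i then tb k m' z i' <= p /\ tb k m' z i' = coef f z %[mod p]
                               else tb k m' z i' = tb k m z i']).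
Proof.
move=> fv fd mV mr m1 m2 m3 m4 m24 m11 m12 ik buf0 tb0.
have [b b1 bE] := encode_head f s.
have r1 : 1 <= r by rewrite /read_bound addn_gt0 expn_gt0.
have V1 : 1 <= V by apply: leq_trans kV.
rewrite (_ : terms_cost n p f + _ = 2 * U + (terms_cost n p f + (5 * low_count n d + 2) * U)); last by nia.
pose ma := update (update m 13 0) 5 b.
apply: (costs_seq (R := fun m' s' => m' = ma /\ s' = behead (encode_terms f ++ s))).
  apply: (runs_straight (P := Seq _ _)) => //=; rewrite bE /=.
  by split => //; split => //; apply: leq_trans b1 V1.
move=> m' s' mVa [m'E ->]; rewrite m'E in mVa *; have mar : bounded unread r ma.
  by repeat (apply: bounded_update; last by rewrite //= (leq_trans b1)).
have Ra : reading n p ma d0 [::] ma.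
  split => //; first by rewrite /ma !updE /= big_nil maxn0.
  exists [::]; split => // z; rewrite /ma !updE !ad_lit // buf0; split => //.
  by rewrite /coef big_nil.
apply: (costs_seq (R := fun m' s' => s' = s /\ reading n p ma d0 f m')).
  have ma1 : ma 1 = n by rewrite /ma !updE.
  have ma3 : ma 3 = p by rewrite /ma !updE.
  have ma5 : ma 5 = head 0 (encode_terms f ++ s) by rewrite bE.
  (* Reading is charged under the small bound with exempt cells. Afterwards cell 11 is 0 and the
     other exempt cells are unchanged, so the bound [V] applies to the whole memory again. *)
  apply: costs_change (read_termsP (f0 := [::]) p0 ma1 ma3 fv Ra ma5) _ => mx sx mr' [_ [_ Hs' m'11 _ _]] a _.
  case: (boolP (unread a)) => [|aU]; last by apply: leq_trans (mr' _ aU) rV.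
  have kV' : k <= V by apply: ltnW.
  case/or4P => /eqP ->; last 1 first.
  - by rewrite (Hs' 24 isT isT) /ma !updE /= m24.
  - by rewrite (Hs' 2 isT isT) /ma !updE /= m2.
  - by rewrite (Hs' 4 isT isT) /ma !updE /= m4 (leq_trans ik).
  - by rewrite m'11.
move=> mb sb mVb [-> [mbr Hsb mb11 mb12 bufb]].
have tbE z i' : tb k mb z i' = tb k m z i'.
  by rewrite /tb (same_ad _ Hsb) // /ma !updE !ad_lit.
have mb24 : mb 24 = k.+1 by rewrite (Hsb 24 isT isT) /ma !updE.
have mb4 : mb 4 = i by rewrite (Hsb 4 isT isT) /ma !updE.
have tbb0 z : tb k mb z i = 0 by rewrite tbE.
apply: (costs_weaken (copyP s mVb mbr bufb mb4 mb24 ik tbb0)).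
  by rewrite leq_mul2r leq_add2r leq_mul2l /= (buffered_size fv fd bufb) orbT.
move=> mc sc mVc [-> Hsc mcr bufc tbc]; split => //.
- apply: (@same_trans _ _ _ mb).
    apply: (@same_trans _ _ _ ma); first by same_updates.
    by apply: (same_sub Hsb); apply/allP.
  by apply: (same_sub Hsc); apply/allP.
- by rewrite (Hsc 11 isT isT) (Hsc 12 isT isT).
- split => // z i' i'k; rewrite tbc // tbE; case: eqP => // _.
  by have [Ls [_ _ _ _ H]] := bufb; have [] := H z.
Qed.

Definition load_cost d (fs : seq (seq term)) :=
  \sum_(f <- fs) terms_cost n p f + (k * (5 * low_count n d + 6) + 4) * U.

Lemma loadP d (fs : seq (seq term)) m : size fs = k ->
  {in fs, forall f, all (valid_term n p) f} ->
  {in fs, forall f : seq term, {in f, forall t : term, size (supp t.2) <= d}} ->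
  bounded unread r m -> m 1 = n -> m 2 = k -> m 3 = p -> m 4 = 0 -> m 24 = 0 -> m 11 = 0 ->
  (forall a, 64 <= a -> m a = 0) ->
  costs xpred0 V load m (flatten [seq encode_terms f | f <- fs]) (load_cost d fs)
    (fun m' s' => [/\ same [:: 4; 5; 6; 7; 8; 9; 10; 11; 12; 13; 14; 24] [:: 0; 1; 3] m m',
       m' 24 = k.+1, m' 12 = maxn 1 (\max_(f <- fs) \max_(t <- f) size (supp t.2)) &
       forall z i, i <= k -> tb k m' z i <= p /\
          if i < k then tb k m' z i = coef (nth [::] fs i) z %[mod p] else tb k m' z i = 0]).
Proof.
move=> fsk fsv fsd mr m1 m2 m3 m4 m24 m11 m0.
have V1 : 1 <= V by apply: leq_trans kV.
have mV : bounded xpred0 V m.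
  move=> a _; case: (boolP (unread a)) => [|aU]; last by apply: leq_trans (mr _ aU) rV.
  by case/or4P => /eqP ->; rewrite ?m2 ?m4 ?m11 ?m24 // ltnW.
have r1 : 1 <= r by rewrite /read_bound addn_gt0 expn_gt0.
have mad a z : 64 <= a -> m (ad a z) = 0 by move=> H; apply: m0; apply: leq_trans H (leq_addl _ _).
pose W := [:: 4; 5; 6; 7; 8; 9; 10; 11; 12; 13; 14; 24].
pose R i := fun m' s' => [/\ s' = flatten [seq encode_terms f | f <- drop i fs],
  same W [:: 0; 1; 3] m m' /\ bounded unread r m', m' 24 = k.+1 /\ m' 11 = 0,
  m' 12 = maxn 1 (\max_(f <- take i fs) \max_(t <- f) size (supp t.2)) &
  (forall z, m' (ad 64 z) = 0) /\ forall z i', i' <= k -> tb k m' z i' <= p /\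
    if i' < i then tb k m' z i' = coef (nth [::] fs i') z %[mod p] else tb k m' z i' = 0].
apply: (@costs_leq _ _ _ _ _ (2 * U + (\sum_(f <- fs) terms_cost n p f + (k * (5 * low_count n d + 6) + 2) * U))).
  by rewrite /load_cost !mulnDl; lia.
apply: (costs_seq (R := R 0)).
  apply: (runs_straight (P := Seq _ _)) => //=.
  rewrite m2 addn1; do 2!split => //; split => //.
  - by rewrite drop0.
  - split; first by same_updates.
    by repeat (apply: bounded_update; last by rewrite //=).
  - by rewrite take0 big_nil updE.
  - by split => [z|z i _]; rewrite /tb !updE !ad_lit // mad.
move=> ma sa mVa Ra; apply: (costs_for (lin := false) (Inv := R) (h := k)
   (c := fun i => terms_cost n p (nth [::] fs i) + (5 * low_count n d + 4) * U)) => //.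
- exact: ltnW.
- case: Ra => saE [Hsa mar] [ma24 ma11] ma12 [maB maT]; split => //.
  + by split; [same_updates|apply: bounded_update].
  + by split => [z|z i ik]; rewrite ?tb_reg ?updE ?ad_lit //; apply: maT.
- by move=> i mb sb [_ [Hs _] _ _ _] _; rewrite /= (Hs 2 isT isT).
- move=> i mb sb ik mVb [-> [Hsb mbr] [mb24 mb11] mb12 [mbB mbT]] mb4.
  have if_ : i < size fs by rewrite fsk.
  have fin : nth [::] fs i \in fs by rewrite mem_nth.
  rewrite (drop_nth [::]) //=.
  have mb1 : mb 1 = n by rewrite (Hsb 1 isT isT).
  have mb2 : mb 2 = k by rewrite (Hsb 2 isT isT).
  have mb3 : mb 3 = p by rewrite (Hsb 3 isT isT).
  have tb0 z : tb k mb z i = 0 by have [_] := mbT z i (ltnW ik); rewrite ltnn.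
  apply: (costs_weaken (load_polyP _ (fsv _ fin) (fsd _ fin) mVb mbr mb1 mb2 mb3 mb4 mb24 mb11 mb12 (ltnW ik) mbB tb0)) => //.
  move=> mc sc mVc [-> Hsc mcr [mc11 mc12] [mcB mcT]]; split; first by rewrite (Hsc 4 isT isT).
  split => //.
  + split; last by apply: bounded_update.
    apply: same_update => //; apply: same_trans Hsb (same_sub Hsc _ _) => //; exact/allP.
  + by rewrite !updE /= (Hsc 24 isT isT).
  + by rewrite !updE /= mc12 (take_nth [::]) // -cats1 big_cat big_cons big_nil /= maxn0 maxnA.
  + split => [z|z i' i'k]; rewrite ?tb_reg // ?updE ?ad_lit //.
    have := mcT z i' i'k; rewrite ltnS [i' <= i]leq_eqVlt; case: eqP => [->//|_ ->].
    exact: mbT.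
- rewrite (big_nth [::]) big_mkord fsk big_split big_split /= !sum_nat_const !card_ord.
  by nia.
- move=> mb sb mVb [_ [Hsb _] [mb24 _] mb12 [_ mbT]]; split => //.
  by rewrite mb12 -fsk take_size.
Qed.

End Load.

(** * The whole program *)

Definition main_body : program :=
  (Read (Lit 3) ;; load ;; parameters) ;; weights ;; evals ;; products ;; interpolate.

(** [k] is tested before [p] is read: for [k = 0] the factor [p ^ (2 k)] is 1 and cannot pay for the
    length of [p]. The answer is then [2 ^ n], a sum of empty products. *)
Definition main_program : program :=
  (Read (Lit 1) ;; Read (Lit 2)) ;; powers_of_two 15 #1 ;; 7 ::= Lit 0 ;;
  If #2 main_body (0 ::= #15).

(** Room for the sum of [2 ^ n] entries below [p ^ k * (p * 2 ^ n)], and for [degree_bound], which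
    is computed even when it far exceeds [n]. The length is still [O(n + k log p)]. *)
Definition value_bound n p k := 2 ^ (2 * n) * p ^ (2 * k + 2).

Definition main_ticks n k mm D :=
  let N := n - mm in
  (9 * n + 3 * k + 30) + ((3 * 2 ^ N + 2) + ((k * (transform_ticks N (2 ^ mm) D n + 2) + 7)
  + ((low_count N D * ((3 * k + 7) * 2 ^ mm) + 7 * 2 ^ N + 2)
  + (transform_ticks N 1 D N + transform_ticks N 1 n N + 3 * 2 ^ N + 10)))).

Section Main.
Variables (n p k d : nat) (fs : seq (seq term)).
Hypotheses (p_pr : prime p) (k0 : 0 < k) (fsk : size fs = k).
Hypothesis fsv : {in fs, forall f, all (valid_term n p) f}.
Hypothesis fsd : {in fs, forall f : seq term, {in f, forall t : term, size (supp t.2) <= d}}.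

Notation V := (value_bound n p k).
Notation U := (step_cost false V).

Definition max_degree := maxn 1 (\max_(f <- fs) \max_(t <- f) size (supp t.2)).

Lemma max_degreeP : {in fs, forall f : seq term, {in f, forall t : term, size (supp t.2) <= max_degree}}.
Proof.
move=> f ffs t tf; rewrite /max_degree leq_max; apply/orP; right.
apply: leq_trans (@leq_bigmax_seq _ fs xpredT (fun f => \max_(t <- f) size (supp t.2)) f ffs isT).
exact: (@leq_bigmax_seq _ f xpredT (fun t : term => size (supp t.2)) t tf isT).
Qed.

Lemma max_degree_le e : 0 < e ->
  {in fs, forall f : seq term, {in f, forall t : term, size (supp t.2) <= e}} -> max_degree <= e.
Proof.
move=> e0 H; rewrite geq_max e0; apply/bigmax_leqP_seq => f ffs _.
by apply/bigmax_leqP_seq => t tf _; apply: (H f).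
Qed.

Let p1 : 1 < p := prime_gt1 p_pr.
Let p0 : 0 < p := prime_gt0 p_pr.

Lemma value_bounds : [/\ read_bound n p <= V, k.+1 <= V, 2 ^ n * (p ^ k * (p * 2 ^ n)) <= V &
  forall l, l <= n -> degree_bound p k max_degree l <= V].
Proof.
have n2 : n < 2 ^ n by exact: ltn_expl.
have VE : V = (2 ^ n * 2 ^ n) * (p ^ k * p ^ k) * (p * p).
  by rewrite /value_bound expnD -[p ^ 2]mulnn !mul2n -!addnn !expnD !mulnA.
have kp : k < p ^ k by exact: ltn_expl.
have e0 : 0 < 2 ^ n by rewrite expn_gt0.
split.
- rewrite VE /read_bound; have : 1 < p ^ k by rewrite -(exp1n k) ltn_exp2r.
  move: (2 ^ n) (p ^ k) e0 => a b a0 b1.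
  have c1 : 4 * p <= b * b * (p * p).
    by apply: leq_mul; [exact: (@leq_mul 2 2)|rewrite leq_pmulr].
  rewrite -mulnA; move: (b * b * (p * p)) c1 => c c1.
  have : a * c <= a * a * c by rewrite -mulnA leq_pmull.
  by apply: leq_trans; nia.
- rewrite VE; apply: leq_trans kp _; set a := 2 ^ n; set b := p ^ k.
  rewrite (_ : a * a * (b * b) * (p * p) = b * (a * a * b * (p * p))); last by lia.
  by rewrite leq_pmulr // !muln_gt0 !expn_gt0 p0.
- rewrite VE; set a := 2 ^ n; set b := p ^ k.
  rewrite (_ : a * (b * (p * a)) = (a * a) * b * p); last by lia.
  by apply: leq_mul; [rewrite leq_mul2l leq_pmulr ?orbT // /b expn_gt0 p0|rewrite leq_pmulr].
move=> l ln; rewrite VE /degree_bound.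
have d2 : max_degree <= 2 ^ n.
  apply: max_degree_le => // f ffs t tf; have /and3P[_ _ /eqP tn] := allP (fsv ffs) _ tf.
  apply: leq_trans (ltnW n2); rewrite size_filter -tn -[X in _ <= X](size_iota 0); exact: count_size.
have H : k + k + l - 1 <= 2 ^ n * (p ^ k * p ^ k).
  have : l < 2 ^ n by apply: leq_ltn_trans ln n2.
  move: (2 ^ n) (p ^ k) kp => a b kb la.
  have b2 : 1 < b by lia.
  apply: (@leq_trans (a * (b * 2))); last by rewrite !leq_mul2l b2 !orbT.
  by case: a la => // a la; case: b kb b2 => // b kb b2; nia.
apply: leq_trans (leq_mul d2 (leq_mul (leq_subr 1 p) H)) _.
move: (2 ^ n) (p ^ k) => a b; rewrite (_ : a * (p * (a * (b * b))) = a * a * (b * b) * p); last by lia.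
by rewrite leq_mul2l leq_pmulr ?orbT.
Qed.

Lemma hsum_total N mm : N + mm = n ->
  \sum_(x < 2 ^ N) hsum p N (2 ^ mm) fs x = \sum_(z < 2 ^ n) \prod_(f <- fs) polyval p f z.
Proof.
move=> Nm; pose g z := \prod_(f <- fs) polyval p f z.
rewrite -(big_mkord xpredT g) -Nm expnD sum_blocks big_mkord.
by apply: eq_bigr => x _; rewrite big_mkord.
Qed.

Lemma main_bodyP m C :
  m 1 = n -> m 2 = k -> m 15 = 2 ^ n -> m 7 <= n ->
  (forall a, a \notin [:: 1; 2; 7; 15] -> m a = 0) ->
  (forall mm l D, params_spec n p k max_degree mm l D ->
     load_cost n p k V d fs + (main_ticks n k mm D + 1) * U <= C) ->
  costs xpred0 V main_body m (p :: flatten [seq encode_terms f | f <- fs]) C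
    (fun m' s' => m' 0 = \sum_(z < 2 ^ n) \prod_(f <- fs) polyval p f z).
Proof.
move=> m1 m2 m15 hm7 mz HC.
have [rV kV pV DV] := value_bounds.
have nr : 2 ^ n <= read_bound n p by exact: leq_addr.
have pr : p <= read_bound n p by rewrite /read_bound; lia.
have n2 : n < 2 ^ n by exact: ltn_expl.
have nV : 2 ^ n <= V by apply: leq_trans rV.
have nV' : n <= V by apply: leq_trans (ltnW n2) nV.
have mb : bounded unread (read_bound n p) m.
  move=> a aU; case: (boolP (a \in [:: 1; 2; 7; 15])) => [|/mz -> //].
  rewrite !inE => /or4P[] /eqP aE; rewrite aE in aU *.
  - by rewrite m1; apply: leq_trans (ltnW n2) nr.
  - by [].
  - by apply: leq_trans hm7 (leq_trans (ltnW n2) nr).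
  - by rewrite m15.
have mV : bounded xpred0 V m.
  move=> a _; case: (boolP (unread a)) => [|aU]; last by apply: leq_trans (mb _ aU) rV.
  by case/or4P => /eqP ->; rewrite ?m2 ?mz // ltnW.
pose ma := update m 3 p.
have maV : bounded xpred0 V ma by apply: bounded_update => //; apply: leq_trans rV.
have mab : bounded unread (read_bound n p) ma by apply: bounded_update => //.
have maz a : 64 <= a -> ma a = 0.
  move=> a64; rewrite /ma updE; case: eqP => [aE|_]; first by rewrite aE in a64.
  by rewrite mz // !inE; lia.
have ma1 : ma 1 = n by rewrite /ma updE.
have ma2 : ma 2 = k by rewrite /ma updE.
have ma3 : ma 3 = p by rewrite /ma updE.
have ma4 : ma 4 = 0 by rewrite /ma updE mz.
have ma24 : ma 24 = 0 by rewrite /ma updE mz.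
have ma11 : ma 11 = 0 by rewrite /ma updE mz.
have ma15 : ma 15 = 2 ^ n by rewrite /ma updE.
have H1 := loadP p0 rV kV fsk fsv fsd mab ma1 ma2 ma3 ma4 ma24 ma11 maz.
set W1 := [:: 4; 5; 6; 7; 8; 9; 10; 11; 12; 13; 14; 24] in H1.
pose W2 := [:: 7; 16; 17; 18; 19; 20; 22; 23; 32] ++ W1.
apply: (costs_seq_le (C1 := 1 * U + (load_cost n p k V d fs + (9 * n + 3 * k + 30) * U))
  (R := fun m' s' => [/\ same W2 [:: 0; 1; 3] ma m', m' 24 = k.+1,
     (forall z i, i <= k -> if i < k then tb k m' z i = coef (nth [::] fs i) z %[mod p] else tb k m' z i = 0) &
     exists mm l D, [/\ params_spec n p k max_degree mm l D, m' 23 = D, m' 22 = p ^ k * p ^ l &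
        [/\ m' 16 = mm, m' 19 = 2 ^ mm, m' 17 = n - mm & m' 18 = 2 ^ (n - mm)]]])).
  apply: (costs_seq (R := fun m' s' => m' = ma /\ s' = flatten [seq encode_terms f | f <- fs])).
    by apply: (runs_straight (P := Read _)) => //; split => //; apply: leq_trans rV.
  move=> m' s' mV' [m'E ->]; rewrite m'E {m'E m'} in mV' *.
  apply: (costs_seq H1) => m3 s3 mV3 [Hs3 m324 m312 Ht3].
  have m31 : m3 1 = n by rewrite (Hs3 1 isT isT).
  have m32 : m3 2 = k by rewrite (Hs3 2 isT isT).
  have m33 : m3 3 = p by rewrite (Hs3 3 isT isT).
  have m315 : m3 15 = 2 ^ n by rewrite (Hs3 15 isT isT).
  have pV' : p ^ k * (p * 2 ^ n) <= V by apply: leq_trans pV; rewrite leq_pmull ?expn_gt0.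
  apply: (costs_weaken (parametersP s3 mV3 m31 m32 m33 m312 m315 p1 (ltnW kV) pV' DV)) => //.
  move=> m4 s4 _ [_ [Hs4 Hp]]; split => //.
  - apply: (@same_trans _ _ _ m3); last by apply: (same_sub Hs4) => //; apply/allP.
    by apply: (same_sub Hs3); apply/allP.
  - by rewrite (Hs4 24 isT isT).
  - by move=> z i ik; have [_] := Ht3 z i ik; rewrite /tb (same_ad _ Hs4).
move=> m4 s4 mV4 [Hs4 m424 Ht4 [mm [l [D [Hp m423 m422 [m416 m419 m417 m418]]]]]].
exists ((main_ticks n k mm D - (9 * n + 3 * k + 30)) * U).
  apply: leq_trans (HC _ _ _ Hp); rewrite /main_ticks.
  move: (9 * n + 3 * k + 30) (3 * 2 ^ (n - mm) + 2 + _) => a b.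
  by rewrite addKn !mulnDl; lia.
rewrite /main_ticks addKn; set N := n - mm.
have mmn : mm <= n.
  have bn : block n p max_degree <= n by exact: leq_div.
  by case: Hp => _ _ _; case: ifP => _ [-> _].
have Nm : N + mm = n by rewrite subnK.
have NV : 2 ^ N <= V by apply: leq_trans nV; rewrite leq_exp2l // leq_subr.
have NV' : N <= V by apply: leq_trans nV'; rewrite leq_subr.
have DV' : D <= V.
  case: Hp => _ _ lb; case: ifP => _ [_ ->] //.
  by apply: DV; apply: leq_trans lb (leq_div _ _).
have mmV : 2 ^ mm <= V by apply: leq_trans nV; rewrite leq_exp2l.
have lV : 2 ^ n * (p ^ k * p ^ l) <= V.
  apply: leq_trans pV; rewrite !leq_mul2l; apply/orP; right; apply/orP; right.
  case: (l) Hp => [|l'] [_ lmin lb _]; first by rewrite muln_gt0 p0 expn_gt0.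
  rewrite expnS leq_mul2l; apply/orP; right.
  by apply: leq_trans (ltnW (lmin isT)) _; rewrite leq_exp2l // leq_div.
have m4w : m4 (ad 66 0) = 0 by rewrite (same_ad _ Hs4) // maz // leq_addl.
apply: (runs_seq (weightsP s4 mV4 m418 m4w NV NV')) => m5 s5 mV5 [Hs5 _ m5w].
have m5r a : a \notin [:: 14] -> ~~ in_arrays [:: 2] a -> m5 a = m4 a by exact: Hs5.
have mr a : a \notin W2 -> ~~ in_arrays [:: 0; 1; 3] a -> m4 a = ma a by exact: Hs4.
have m51 : m5 1 = n by rewrite m5r // mr.
have m52 : m5 2 = k by rewrite m5r // mr.
have m53 : m5 3 = p by rewrite m5r // mr.
have m518 : m5 18 = 2 ^ N by rewrite m5r.
have m519 : m5 19 = 2 ^ mm by rewrite m5r.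
have m523 : m5 23 = D by rewrite m5r.
have m524 : m5 24 = k.+1 by rewrite m5r.
have pV' : p <= V by apply: leq_trans rV.
apply: (runs_seq (evalsP s5 mV5 m51 m52 m53 m518 m519 m523 m524 m5w Nm p0 pV' (ltnW kV) DV' nV)).
move=> m6 s6 mV6 [Hs6 m631 Ht6].
have m61 : m6 1 = n by rewrite (Hs6 1 isT isT).
have m62 : m6 2 = k by rewrite (Hs6 2 isT isT).
have m63 : m6 3 = p by rewrite (Hs6 3 isT isT).
have m618 : m6 18 = 2 ^ N by rewrite (Hs6 18 isT isT).
have m619 : m6 19 = 2 ^ mm by rewrite (Hs6 19 isT isT).
have m623 : m6 23 = D by rewrite (Hs6 23 isT isT).
have m624 : m6 24 = k.+1 by rewrite (Hs6 24 isT isT).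
have m6w x : x < 2 ^ N -> m6 (ad 66 x) = wt N x by move=> xN; rewrite (same_ad _ Hs6) // m5w.
have PYV : 2 ^ N * 2 ^ mm <= V by rewrite -expnD Nm.
have pkV : p ^ k <= V.
  by apply: leq_trans lV; rewrite mulnCA leq_pmulr // muln_gt0 !expn_gt0 p0.
have YpV : 2 ^ mm * p ^ k <= V.
  apply: leq_trans lV; rewrite leq_mul // ?leq_exp2l //.
  by rewrite leq_pmulr // expn_gt0 p0.
have V0 : 0 < V by apply: leq_trans kV.
apply: (runs_seq (productsP m62 m63 m618 m619 m623 m624 m6w p0 (ltnW kV) mmV NV PYV pkV YpV V0 s6 mV6)).
move=> m7 s7 mV7 [Hs7 Ht7].
have m71 : m7 1 = n by rewrite (Hs7 1 isT isT).
have m72 : m7 2 = k by rewrite (Hs7 2 isT isT).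
have m717 : m7 17 = N by rewrite (Hs7 17 isT isT) (Hs6 17 isT isT) m5r.
have m718 : m7 18 = 2 ^ N by rewrite (Hs7 18 isT isT).
have m722 : m7 22 = p ^ k * p ^ l by rewrite (Hs7 22 isT isT) (Hs6 22 isT isT) m5r.
have m724 : m7 24 = k.+1 by rewrite (Hs7 24 isT isT).
have m731 : m7 31 = D by rewrite (Hs7 31 isT isT).
have m7w x : x < 2 ^ N -> m7 (ad 66 x) = wt N x by move=> xN; rewrite (same_ad _ Hs7) // m6w.
have domE x : dom N 1 D x = (x < 2 ^ N) && (wt N x <= D).
  rewrite /dom ltnS leqn0 -leqn0 -ltnS ltn_divLR ?expn_gt0 // mul1n.
  by case: ltnP => // zN; rewrite modn_small.
have evalE z i : dom N (2 ^ mm) D z -> i < k ->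
    tb k m6 z i %% p = polyval p (nth [::] fs i) z.
  move=> dz ik; rewrite Ht6 ?(ltnW ik) // ik.
  have fin : nth [::] fs i \in fs by rewrite mem_nth // fsk.
  apply: (@table_transform_eval p n) => //.
  - by move=> w /andP[wY _]; move: wY; rewrite ltn_divLR ?expn_gt0 // -expnD addnC Nm.
  - by move=> t tf; have /and3P[_ _ /eqP] := allP (fsv fin) _ tf.
  - move=> w _; have := Ht4 w i (ltnW ik); rewrite ik => <-.
    by rewrite /tb (same_ad _ Hs5).
have sumE x : dom N 1 D x -> table_sum k N (2 ^ mm) p m6 x = hsum p N (2 ^ mm) fs x.
  rewrite domE => /andP[xN xD]; apply: eq_bigr => y _.
  rewrite (big_nth [::]) big_mkord fsk; apply: eq_bigr => i _; apply: evalE => //.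
  rewrite /dom addnC mulnC divnMDl ?expn_gt0 // modnMDl modn_small // divn_small // addn0.
  by rewrite xD ltn_ord.
have HE x : tb k m7 x k = if dom N 1 D x then hsum p N (2 ^ mm) fs x else 0.
  rewrite Ht7 // eqxx /= -domE; case: ifP => [/sumE //|_].
  rewrite Ht6 // ltnn; have := Ht4 x k (leqnn k); rewrite ltnn => <-.
  by rewrite /tb (same_ad _ Hs5).
have pl : 2 ^ mm <= p ^ l.
  by case: Hp => pl _ _; case: ifP => _ [-> _] //; rewrite expn0 expn_gt0 p0.
have hM x : hsum p N (2 ^ mm) fs x < p ^ k * p ^ l.
  by rewrite -fsk; apply: hsum_lt; rewrite ?fsk ?expn_gt0 ?p0.
have HM z : tb k m7 z k < p ^ k * p ^ l.
  by rewrite HE; case: ifP => // _; rewrite muln_gt0 !expn_gt0 p0.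
apply: (runs_weaken (interpolateP s7 mV7 m71 m72 m717 m718 m722 m724 m731 m7w HM (ltnW kV) (leq_subr _ _) lV)) => //.
move=> m8 s8 _ ->; rewrite -(hsum_total Nm); apply: eq_bigr => x _.
rewrite -expnD in hM *; apply: (interpolation (d := max_degree) p_pr) => //.
- exact: max_degreeP.
- by rewrite -(exp1n (k + l)) ltn_exp2r // addn_gt0 k0.
- rewrite /N; case: Hp => _ _ _; case: ifP => _ [-> ->]; first by rewrite subn0 leqnn.
  by rewrite fsk addnAC leqnn orbT.
- exact: leq_subr.
Qed.

End Main.

(** * The time bound *)

(** Splitting off the top bit: the value 0 contributes a factor 2 and the value 1 a factor 1. *)
Lemma sum_weights N : \sum_(x < 2 ^ N) 2 ^ (N - wt N x) = 3 ^ N.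
Proof.
elim: N => [|N IH]; first by rewrite big_ord1 /wt big_ord0.
rewrite -(big_mkord xpredT (fun x => 2 ^ (N.+1 - wt N.+1 x))) expnSr sum_blocks big_mkord.
rewrite expnSr -IH big_distrl /=; apply: eq_bigr => x _.
rewrite big_nat_recl // big_nat1 muln0 addn0 muln1.
have wx y : wt N.+1 (x + 2 ^ N * y) = wt N x + bit y 0.
  rewrite /wt big_ord_recr /= bit_low // ltnn subnn; congr (_ + _).
  by apply: eq_bigr => j _; rewrite bit_low // ltn_ord.
have := wx 0; rewrite muln0 addn0 => ->; have := wx 1; rewrite muln1 => ->.
have -> : bit 0 0 = false by []. have -> : bit 1 0 = true by [].
rewrite addn0 addn1 subSS subSn ?wt_le // expnS; lia.
Qed.

(** A Chernoff-type bound: [2 ^ (D - wt)] is at least 1 on the points counted, and [2 ^ (- wt)] sums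
    to [(3 / 2) ^ N] over all points. *)
Lemma low_count_le N D : low_count N D * 2 ^ N <= 2 ^ D * 3 ^ N.
Proof.
rewrite -sum_weights /low_count big_distrl big_distrr /=; apply: leq_sum => x _.
case: (leqP (wt N x) D) => wD; rewrite ?mul0n // mul1n -{1}(subnKC (wt_le N x)) expnD leq_mul2r.
by rewrite leq_exp2l ?wD ?orbT.
Qed.

Lemma low_count_max N D : low_count N D <= 2 ^ N.
Proof. by rewrite -[X in _ <= X]card_ord -sum1_card; apply: leq_sum => x _; apply: leq_b1. Qed.

Lemma leq_expr a b e : a <= b -> a ^ e <= b ^ e.
Proof. by move=> ab; case: e => [|e]; rewrite ?expn0 // leq_exp2r. Qed.

(** With [3 * (D + mm) <= n] the cube of the left factor is at most [(2 * 27 / 8) ^ n = 6.75 ^ n],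
    while [1.9 ^ 3 = 6.859]. This explains both 1.9 and the 3 in the choice of the mode. *)
Lemma cube_bound n mm D : mm <= n -> 3 * (D + mm) <= n ->
  low_count (n - mm) D * 2 ^ mm * 10 ^ n <= 19 ^ n.
Proof.
move=> mn Dn; set X := low_count _ _ * _.
have XE : X * 2 ^ n <= 2 ^ (D + mm) * 3 ^ n.
  have e2 : 2 ^ n = 2 ^ (n - mm) * 2 ^ mm by rewrite -expnD subnK.
  have e3 : 3 ^ n = 3 ^ (n - mm) * 3 ^ mm by rewrite -expnD subnK.
  rewrite e2 e3 expnD.
  have := low_count_le (n - mm) D; rewrite /X.
  have : 2 ^ mm <= 3 ^ mm by case: (mm) => // a; rewrite leq_exp2r.
  set w := low_count _ _; move: (2 ^ mm) (3 ^ mm) (2 ^ (n - mm)) (3 ^ (n - mm)) (2 ^ D) => a a3 c c3 e H1 H2.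
  have := leq_mul H2 (leq_mul (leqnn a) H1); lia.
have X3 : (X * 2 ^ n) ^ 3 <= 2 ^ n * (3 ^ n) ^ 3.
  apply: leq_trans (_ : (2 ^ (D + mm) * 3 ^ n) ^ 3 <= _); first by rewrite leq_exp2r.
  by rewrite expnMn leq_mul // -expnM leq_exp2l // mulnC.
rewrite -(@leq_exp2r _ _ 3) // -(@leq_pmul2r ((2 ^ n) ^ 3)) ?expn_gt0 //.
rewrite expnMn mulnAC -expnMn; apply: leq_trans (leq_mul X3 (leqnn _)) _.
have e q : (q ^ n) ^ 3 = (q * (q * q)) ^ n by rewrite -expnM mulnC expnM !expnS expn0 muln1.
rewrite !e -!expnMn; apply: leq_expr; lia.
Qed.

Lemma four_pow p : 1 < p -> 4 ^ (p - 1) <= p ^ p.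
Proof.
case: p => [|[|[|[|p]]]] // _.
apply: (@leq_trans (4 ^ p.+4)); first by rewrite leq_exp2l // leq_subr.
by rewrite leq_exp2r.
Qed.

(** The hypotheses give [p ^ t <= 4 ^ b] for [t = 2 * k + l - 1]. With [4 ^ (p - 1) <= p ^ p] this
    becomes [(p - 1) * t <= b * p], so the degree bound is at most [b * d * p]. Then
    [3 * (D + b) <= 6 * b * d * p <= n], which is where the constant 6 comes from. *)
Lemma block_mode n p k d l : 1 < p -> 0 < k -> 0 < d ->
  (0 < l -> p ^ l.-1 < 2 ^ block n p d) -> p ^ (2 * k) < 2 ^ block n p d ->
  3 * (degree_bound p k d l + block n p d) <= n.
Proof.
move=> p1 k0 d0 lmin kb; have p0 := ltnW p1; rewrite /degree_bound.
set b := block n p d in lmin kb *; set t := k + k + l - 1.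
have bn : b * (6 * (d * p)) <= n by exact: leq_divM.
have tb : p ^ t <= 4 ^ b.
  rewrite (_ : 4 = 2 * 2) // expnMn; case: (posnP l) lmin => [l0 _|l0 /(_ isT) lb].
    apply: (@leq_trans (p ^ (2 * k))); first by rewrite leq_exp2l //; lia.
    by apply: leq_trans (ltnW kb) _; rewrite leq_pmulr // expn_gt0.
  rewrite (_ : t = 2 * k + l.-1); last by lia.
  by rewrite expnD leq_mul // ltnW.
have H : (p - 1) * t <= b * p.
  rewrite -(@leq_exp2l 4) //; apply: (@leq_trans ((p ^ p) ^ t)).
    by rewrite expnM; apply: leq_expr; apply: four_pow.
  by rewrite -expnM mulnC !expnM; apply: leq_expr.
have dp : 2 <= d * p by rewrite -[2]mul1n leq_mul.
have : d * ((p - 1) * t) <= d * (b * p) by rewrite leq_mul2l H orbT.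
have -> : d * (b * p) = b * (d * p) by lia.
move: (d * ((p - 1) * t)) (d * p) dp bn => x y; nia.
Qed.

(** * Cost of a run in terms of the input size and the volume *)

Definition term_bits p (fs : seq (seq term)) :=
  \sum_(f <- fs) \sum_(t <- f) (bitlen p + exponent_bits t.2).

Definition volume n mm D := 2 ^ (n - mm) + low_count (n - mm) D * 2 ^ mm.

Lemma kappa_gt0 : 0 < kappa. Proof. exact: kappa_ge. Qed.

Lemma bitlen_value_bound n p k : 0 < p -> 0 < k ->
  bitlen (value_bound n p k) <= 4 * (n.+1 * (k * bitlen p)).
Proof.
move=> p0 k0; have bl0 := bitlen_gt0 p; set b := bitlen p in bl0 *.
apply: (@leq_trans (2 * n + (2 * k + 2) * b)); last by nia.
apply: bitlen_le; first by nia.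
rewrite /value_bound [2 ^ (_ + _)]expnD ltn_pmul2l ?expn_gt0 //.
by rewrite [_ * b]mulnC expnM ltn_exp2r ?bitlenP // addn2.
Qed.

Lemma bitlen_read_bound n p : 0 < p -> bitlen (read_bound n p) <= 4 * (n.+1 * bitlen p).
Proof.
move=> p0; have bl0 := bitlen_gt0 p; have pb := bitlenP p; set b := bitlen p in bl0 pb *.
apply: (@leq_trans (n + (b + 2))); last by nia.
apply: bitlen_le; first by nia.
rewrite /read_bound !expnD; have : 0 < 2 ^ n by rewrite expn_gt0.
by move: (2 ^ n) (2 ^ b) pb => x y py x0; rewrite (_ : 2 ^ 2 = 4) //; nia.
Qed.

Lemma terms_cost_le n p f : all (valid_term n p) f ->
  terms_cost n p f <= 94 * kappa * n.+1 ^ 2 * \sum_(t <- f) (bitlen p + exponent_bits t.2)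
                      + 8 * kappa * n.+1 * bitlen p.
Proof.
move=> fv; rewrite /terms_cost; case: (posnP p) => [p0|p0].
  case: f fv => [|t f] /=; last by rewrite p0 => /andP[/and3P[]].
  rewrite !big_nil muln0 !add0n p0 /step_cost /unit_sq => _.
  rewrite (_ : read_bound n 0 = 2 ^ n); last by rewrite /read_bound muln0 addn0.
  have : bitlen (2 ^ n) <= n.+1 by apply: bitlen_le => //; rewrite ltn_exp2l.
  have -> : bitlen 0 = 1 by []. by nia.
have uE : step_cost true (read_bound n p) <= 4 * kappa * n.+1 * bitlen p.
  have := bitlen_read_bound n p0; rewrite /step_cost /unit_sq => H.
  by apply: leq_trans (leq_mul (leqnn kappa) H) _; lia.
set u := step_cost _ _ in uE *; apply: leq_add; last by apply: leq_trans (leq_mul (leqnn 2) uE) _; lia.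
rewrite big_distrr /= big_seq [X in _ <= X]big_seq; apply: leq_sum => t tf.
have /and3P[_ tp _] := allP fv _ tf.
have tb : bitlen t.1 <= bitlen p by apply: leq_bitlen; apply: ltnW.
have k0 := kappa_gt0.
have H1 : (7 * n + 23) * u <= 92 * kappa * n.+1 ^ 2 * bitlen p.
  apply: (@leq_trans (23 * n.+1 * (4 * kappa * n.+1 * bitlen p))); last by rewrite -mulnn; lia.
  by apply: leq_mul => //; lia.
have H2 : 2 * (bitlen t.1 + exponent_bits t.2) <= 2 * kappa * n.+1 ^ 2 * (bitlen p + exponent_bits t.2).
  apply: leq_mul; last by rewrite leq_add2r.
  by rewrite -mulnA leq_pmulr // muln_gt0 k0 expn_gt0.
apply: leq_trans (leq_add (leq_trans H1 (leq_mul (leqnn _) (leq_addr (exponent_bits t.2) _))) H2) _.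
move: (bitlen p + exponent_bits t.2) (n.+1 ^ 2) kappa => e a c; lia.
Qed.

Section Cost.
Variables (n p k d : nat) (fs : seq (seq term)).
Hypotheses (p_pr : prime p) (k0 : 0 < k) (fsk : size fs = k).
Hypothesis fsv : {in fs, forall f, all (valid_term n p) f}.

Let b := k * bitlen p.

Lemma ticks_le mm D : main_ticks n k mm D <= 140 * n.+1 * k * volume n mm D.
Proof.
rewrite /main_ticks /transform_ticks /volume; set N := n - mm.
have Nn : N <= n by exact: leq_subr.
have := low_count_max N n; have : 0 < 2 ^ N by rewrite expn_gt0.
rewrite !muln1; set P := 2 ^ N; set Y := 2 ^ mm; set w := low_count N D; set w' := low_count N n.
have : 0 < Y by rewrite expn_gt0.
move=> Y0 P0 w'P; set Z := P + w * Y.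
have wY : w <= w * Y by rewrite leq_pmulr.
have T1 : 6 * Y * w + 5 * P + 5 <= 10 * Z by rewrite /Z; lia.
have T2 : 6 * w + 5 * P + 5 <= 10 * Z by rewrite /Z; lia.
have T3 : 6 * w' + 5 * P + 5 <= 16 * Z by rewrite /Z; lia.
have Z1 : 0 < Z by rewrite addn_gt0 P0.
have PZ : P <= Z by exact: leq_addr.
have S1 := leq_mul (leqnn k) (leq_mul (leqnn n) T1).
have S2 : w * ((3 * k + 7) * Y) <= 10 * (k * Z).
  rewrite (_ : w * _ = (3 * k + 7) * (w * Y)); last by lia.
  by rewrite [X in _ <= X]mulnA; apply: leq_mul; [lia|exact: leq_addl].
have S3 := leq_mul Nn T2; have S4 := leq_mul Nn T3.
pose G := n.+1 * (k * Z).
have G1 : n <= G by rewrite /G; nia.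
have kZ0 : 0 < k * Z by rewrite muln_gt0 k0.
have G2 : k * Z <= G by rewrite leq_pmull.
have G3 : k <= k * Z by rewrite leq_pmulr.
have G4 : Z <= k * Z by rewrite leq_pmull.
have G5 : n * (k * Z) <= G by rewrite leq_mul2r leqnSn orbT.
have G6 : n * Z <= n * (k * Z) by rewrite leq_mul2l G4 orbT.
rewrite (_ : 140 * n.+1 * k * Z = 140 * G); last by rewrite /G; lia.
have E1 : k * (n * (10 * Z)) = 10 * (n * (k * Z)) by lia.
have E2 : n * (10 * Z) = 10 * (n * Z) by lia.
have E3 : n * (16 * Z) = 16 * (n * Z) by lia.
rewrite E1 in S1; rewrite E2 in S3; rewrite E3 in S4.
rewrite (_ : k * (n * _ + 3 + 2) = k * (n * (6 * Y * w + 5 * P + 5)) + 5 * k); last by lia.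
move: S1 S2 S3 S4.
set x1 := k * (n * _); set x2 := w * ((3 * k + 7) * Y); set x3 := N * (6 * w + _ + _); set x4 := N * _.
move: (n * (k * Z)) (n * Z) (k * Z) kZ0 G2 G3 G4 G5 G6 G1 => y1 y2 y3; lia.
Qed.

Notation V := (value_bound n p k).

(** Of [b ^ 3], one factor comes from the number of steps, proportional to [k], and two from the
    price [bitlen V ^ 2] of a step. The terms of the input escape these factors because they are
    read in linear mode. *)
Lemma total_cost mm D :
  load_cost n p k V d fs + (main_ticks n k mm D + 3 * n + 8) * step_cost false V <=
  3000 * kappa * n.+1 ^ 3 * (b ^ 3 * (volume n mm D + low_count n d) + term_bits p fs).
Proof.
have p0 := prime_gt0 p_pr; have bl0 := bitlen_gt0 p; have c0 := kappa_gt0.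
have b0 : 0 < b by rewrite muln_gt0 k0.
have BV : bitlen V <= 4 * (n.+1 * b) := bitlen_value_bound n p0 k0.
have UE : step_cost false V <= 16 * kappa * n.+1 ^ 2 * b ^ 2.
  rewrite /step_cost /unit_sq; apply: leq_trans (leq_mul (leqnn _) (leq_mul BV BV)) _.
  by rewrite -!mulnn; lia.
set U := step_cost false V in UE *.
have TE : \sum_(f <- fs) terms_cost n p f <= 94 * kappa * n.+1 ^ 2 * term_bits p fs + 8 * kappa * n.+1 * b.
  apply: (@leq_trans (\sum_(f <- fs) (94 * kappa * n.+1 ^ 2 * (\sum_(t <- f) (bitlen p + exponent_bits t.2)) + 8 * kappa * n.+1 * bitlen p))).
    by rewrite big_seq [X in _ <= X]big_seq; apply: leq_sum => f ffs; apply: terms_cost_le; apply: fsv.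
  rewrite big_split /= -big_distrr /= -/(term_bits p fs) leq_add2l big_const_seq count_predT fsk iter_addn_0.
  by rewrite /b; lia.
have ME := ticks_le mm D; set Mt := main_ticks _ _ _ _ in ME *.
set Z := volume n mm D in ME *; set S := low_count n d.
have Z0 : 0 < Z by rewrite addn_gt0 expn_gt0.
have kb : k <= b by rewrite leq_pmulr.
have NE : k * (5 * S + 6) + 4 + (Mt + 3 * n + 8) <= 170 * (n.+1 * (b * (Z + S))).
  apply: (@leq_trans (170 * (n.+1 * (k * (Z + S))))); last by rewrite !leq_mul2l leq_mul2r kb !orbT.
  have H1 : 140 * n.+1 * k * Z = 140 * (n.+1 * (k * Z)) by lia.
  have H2 : n.+1 <= n.+1 * (k * Z) by rewrite leq_pmulr // muln_gt0 k0.
  have H3 : k <= n.+1 * (k * Z) by rewrite mulnCA leq_pmulr // muln_gt0.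
  have H4 : k * S <= n.+1 * (k * S) by rewrite leq_pmull.
  rewrite [k * (Z + S)]mulnDr [n.+1 * (_ + _)]mulnDr (_ : k * (5 * S + 6) = 5 * (k * S) + 6 * k); last by lia.
  rewrite {}H1 in ME; move: ME H2 H3 H4.
  by move: (n.+1 * (k * Z)) (n.+1 * (k * S)) (k * S) => x y y'; lia.
rewrite /load_cost -addnA -mulnDl -/S.
apply: leq_trans (leq_add TE (leq_mul NE UE)) _.
have E : 170 * (n.+1 * (b * (Z + S))) * (16 * kappa * n.+1 ^ 2 * b ^ 2)
   = 2720 * (kappa * n.+1 ^ 3 * (b ^ 3 * (Z + S))) by rewrite -!mulnn !expnS !expn0; lia.
rewrite E; set x := kappa * n.+1 ^ 3 * _.
have H1 : 94 * kappa * n.+1 ^ 2 * term_bits p fs <= 94 * (kappa * n.+1 ^ 3 * term_bits p fs).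
  rewrite -!mulnA; do 3!apply: leq_mul => //.
  by rewrite leq_mul2l leq_pmull ?orbT.
have H2 : 8 * kappa * n.+1 * b <= 8 * x.
  rewrite (_ : 8 * _ * _ * _ = 8 * (kappa * n.+1 * b)); last by lia.
  have a3 : n.+1 <= n.+1 ^ 3 by rewrite -{1}[n.+1]expn1 leq_pexp2l.
  have b3 : b <= b ^ 3 by rewrite -{1}[b]expn1 leq_pexp2l.
  rewrite leq_mul2l /= /x; apply: leq_mul; first by rewrite leq_mul2l a3 orbT.
  by apply: leq_trans b3 _; rewrite leq_pmulr // addn_gt0 Z0.
have -> : 3000 * kappa * n.+1 ^ 3 * (b ^ 3 * (Z + S) + term_bits p fs)
    = 3000 * x + 3000 * (kappa * n.+1 ^ 3 * term_bits p fs).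
  by rewrite /x; move: (n.+1 ^ 3) (b ^ 3 * (Z + S)) => a e; lia.
by move: H1 H2; move: (kappa * n.+1 ^ 3 * term_bits p fs) x => y x; lia.
Qed.
End Cost.

Lemma prologueP V n k s (Q : memory -> seq nat -> Prop) C : k <= V -> 2 ^ n <= V ->
  (forall m, bounded xpred0 V m -> m 1 = n -> m 2 = k -> m 15 = 2 ^ n -> m 7 = 0 ->
     (forall a, a \notin [:: 1; 2; 7; 15] -> m a = 0) ->
     costs xpred0 V (if k == 0 then 0 ::= #15 else main_body) m s C Q) ->
  costs xpred0 V main_program (fun=> 0) [:: n, k & s] ((3 * n + 7) * step_cost false V + C) Q.
Proof.
move=> kV nV HQ; have n2 : n < 2 ^ n by exact: ltn_expl.
have nV' : n <= V by apply: leq_trans (ltnW n2) nV.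
set U := step_cost false V.
rewrite (_ : _ + C = 2 * U + ((3 * n + 3) * U + (1 * U + (U + C)))); last by lia.
pose ma := update (update (fun=> 0) 1 n) 2 k.
apply: (costs_seq (R := fun m' s' => m' = ma /\ s' = s)).
  by apply: (runs_straight (P := Seq _ _)).
move=> m0 s0 mV0 [m0E ->]; rewrite m0E in mV0 *.
have ma1 : ma 1 = n by [].
apply: (costs_seq (@powers_of_twoP V 15 1 n ma s isT isT isT isT isT mV0 ma1 nV' nV)).
move=> m1 s1 mV1 [Hs1 m115 ->].
apply: (costs_seq (R := fun m' s' => m' = update m1 7 0 /\ s' = s)).
  by apply: (runs_straight (P := Store _ _)).
move=> m2 s2 mV2 [m2E ->].
have m22 : m2 2 = k by rewrite m2E !updE /= (Hs1 2 isT isT).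
have H : costs xpred0 V (if k == 0 then 0 ::= #15 else main_body) m2 s C Q.
  apply: HQ => //; rewrite ?m2E ?updE //= ?(Hs1 1 isT isT) //.
  move=> a; rewrite updE !inE !negb_or => /and4P[a1 a2 a7 a15]; rewrite (negbTE a7).
  rewrite Hs1; first by rewrite /ma !updE (negbTE a1) (negbTE a2).
    by rewrite !inE negb_or a15.
  by rewrite /in_arrays andbF.
apply: costs_if => //; rewrite /= m22 => k0.
  by rewrite (negbTE k0) in H.
by rewrite k0 in H.
Qed.

Lemma main_program0 n (s : seq nat) :
  exists2 T, T <= (3 * n + 8) * (kappa * (n.+1 * n.+1)) & computes_in main_program [:: n, 0 & s] (2 ^ n) T.
Proof.
pose V := 2 ^ n.
have UE : step_cost false V <= kappa * (n.+1 * n.+1).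
  have bV : bitlen V <= n.+1 by apply: bitlen_le => //; rewrite ltn_exp2l.
  by rewrite /step_cost /unit_sq leq_mul // leq_mul.
have [|||T [m' [s' [ex TC _ q]]]] := @prologueP V n 0 s (fun m' s' => m' 0 = 2 ^ n) (1 * step_cost false V) => //.
  move=> m mV m1 m2 m15 m7 mz; rewrite eqxx.
  by apply: (runs_straight (P := Store _ _)) => //; rewrite /= m15.
exists T; last by exists m', s'.
apply: leq_trans TC _; rewrite -mulnDl -addnA leq_mul2l UE orbT //.
Qed.

Lemma params_exists n p k d : 1 < p -> exists mm l D, params_spec n p k d mm l D.
Proof.
move=> p1; pose b := block n p d.
have Pb : 2 ^ b <= p ^ b by apply: leq_expr.
have [l Pl lmin] := ex_minnP (ex_intro (fun l => 2 ^ b <= p ^ l) b Pb).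
pose md := if n < 3 * (degree_bound p k d l + b) then (0, n) else (b, degree_bound p k d l).
exists md.1, l, md.2; split; rewrite -?surjective_pairing //; last exact: lmin.
by move=> l0; rewrite ltnNge; apply/negP => /lmin; lia.
Qed.

(** The cost bound must hold for whichever parameters the run computes; uniqueness reduces this to a
    single choice. *)
Lemma params_unique n p k d mm l D mm' l' D' : 1 < p ->
  params_spec n p k d mm l D -> params_spec n p k d mm' l' D' -> (mm, D) = (mm', D').
Proof.
move=> p1 [P1 M1 _ ->] [P2 M2 _ ->].
have [ll|] := eqVneq l l'; first by rewrite ll.
have lt a a' : 2 ^ block n p d <= p ^ a -> (0 < a' -> p ^ a'.-1 < 2 ^ block n p d) -> a' <= a.
  move=> Pa Ma; rewrite leqNgt; apply/negP => aa'.
  have a'0 : 0 < a' := leq_ltn_trans (leq0n a) aa'.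
  have := leq_trans (Ma a'0) Pa.
  by rewrite ltn_exp2l // ltnNge -ltnS prednK // aa'.
by rewrite eqn_leq (lt _ _ P1 M2) (lt _ _ P2 M1).
Qed.

Section Main.
Variables (n p k d : nat) (fs : seq (seq term)).
Hypotheses (p_pr : prime p) (k0 : 0 < k) (fsk : size fs = k).
Hypothesis fsv : {in fs, forall f, all (valid_term n p) f}.
Hypothesis fsd : {in fs, forall f : seq term, {in f, forall t : term, size (supp t.2) <= d}}.

Lemma main_programP C :
  (forall mm l D, params_spec n p k (max_degree fs) mm l D ->
     3000 * kappa * n.+1 ^ 3 * ((k * bitlen p) ^ 3 * (volume n mm D + low_count n d) + term_bits p fs)
     <= C) ->
  exists2 T, T <= C & computes_in main_program
    [:: n, k, p & flatten [seq encode_terms f | f <- fs]]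
    (\sum_(z < 2 ^ n) \prod_(f <- fs) polyval p f z) T.
Proof.
move=> HC; pose V := value_bound n p k; pose U := step_cost false V.
have [rV kV pV DV] := value_bounds p_pr k0 fsk fsv.
have nV : 2 ^ n <= V by apply: leq_trans rV; exact: leq_addr.
have HC' mm l D : params_spec n p k (max_degree fs) mm l D ->
   load_cost n p k V d fs + (main_ticks n k mm D + 3 * n + 8) * U <= C.
  by move=> /HC; apply: leq_trans; apply: total_cost.
have [T [m' [s' [ex TC _ q]]]] : costs xpred0 V main_program (fun=> 0)
    [:: n, k, p & flatten [seq encode_terms f | f <- fs]] ((3 * n + 7) * U + (C - (3 * n + 7) * U))
    (fun m' s' => m' 0 = \sum_(z < 2 ^ n) \prod_(f <- fs) polyval p f z).
  apply: prologueP => //; first exact: ltnW.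
  move=> m mV m1 m2 m15 m7 mz; rewrite eqn0Ngt k0 /=.
  apply: (main_bodyP (d := d)) => //; first by rewrite m7.
  by move=> mm l D /HC'; rewrite -/U -/V !mulnDl mul1n; lia.
have [mm [l [D /HC' H]]] := params_exists n k (max_degree fs) (prime_gt1 p_pr).
exists T; last by exists m', s'.
apply: leq_trans TC _; rewrite subnKC //; apply: leq_trans H.
by apply: leq_trans (leq_addl _ _); rewrite leq_mul2r; apply/orP; right; lia.
Qed.

End Main.

(** * Absorbing bit lengths into powers of [p] *)

Lemma cube_le_pow2 w : w ^ 3 <= 27 * 2 ^ w.
Proof.
have wE := divn_eq w 3; have w3 := ltn_pmod w (isT : 0 < 3).
have u2 : w %/ 3 < 2 ^ (w %/ 3) by exact: ltn_expl.
(* [w <= 3 * (w %/ 3 + 1)], and the cube of [2 ^ (w %/ 3)] is at most [2 ^ w]. *)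
apply: (@leq_trans ((3 * 2 ^ (w %/ 3)) ^ 3)); first by rewrite leq_exp2r //; lia.
rewrite expnMn (_ : 3 ^ 3 = 27) // leq_mul2l /= -expnM leq_exp2l //.
exact: leq_divM.
Qed.

Section Bounds.
Variables (n p k d0 d : nat).
Hypotheses (p1 : 1 < p) (k0 : 0 < k) (d00 : 0 < d0) (dd : d0 <= d).

Notation b := (k * bitlen p).
Notation v := (p ^ k).
Notation E := (2 ^ (n - block n p d)).

(** Stands in for the length [b]: it is at least half of [b], and [2 ^ w <= p ^ k] holds exactly,
    without rounding up. *)
Let w := k * trunc_log 2 p.

Let bw : b <= 2 * w.
Proof.
have t0 : 0 < trunc_log 2 p by rewrite trunc_log_gt0 /=; lia.
by rewrite /bitlen /w; nia.
Qed.

Let wv : 2 ^ w <= v.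
Proof. by rewrite /w mulnC expnM; apply: leq_expr; apply: trunc_logP; lia. Qed.

Let b_cube : b ^ 3 <= 8 * w ^ 3.
Proof. by apply: leq_trans (leq_expr 3 bw) _; rewrite expnMn. Qed.

Lemma size_cube_le : b ^ 3 <= 216 * v.
Proof.
apply: leq_trans b_cube _; apply: leq_trans (leq_mul (leqnn 8) (cube_le_pow2 w)) _.
by rewrite mulnA (_ : 8 * 27 = 216) // leq_mul2l wv.
Qed.

(** Here [2 ^ m] may use up [v ^ 2]. If [w <= n], then [b ^ 3] is polynomial in [n]; otherwise
    [2 ^ m <= 2 ^ w <= v], and the second factor [v] pays for [b ^ 3]. *)
Lemma size_cube_block m : m <= n -> 2 ^ m <= v ^ 2 -> b ^ 3 * 2 ^ m <= 216 * n.+1 ^ 3 * v ^ 2.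
Proof.
move=> mn mv; have [wn|nw] := leqP w n.
  apply: (@leq_trans (8 * w ^ 3 * v ^ 2)); first exact: leq_mul.
  rewrite leq_mul2r; apply/orP; right; apply: leq_mul => //.
  by rewrite leq_exp2r // ltnW.
have mv' : 2 ^ m <= v by apply: leq_trans wv; rewrite leq_exp2l // (leq_trans mn) // ltnW.
apply: leq_trans (leq_mul size_cube_le mv') _.
by rewrite -mulnA mulnn leq_mul2r leq_pmulr ?orbT // expn_gt0.
Qed.

Lemma block_anti : block n p d <= block n p d0.
Proof. by rewrite /block leq_div2l ?muln_gt0 ?d00 ?(ltnW p1) // !leq_mul2l leq_mul2r dd !orbT. Qed.

Lemma block_le e : block n p e <= n. Proof. exact: leq_div. Qed.

(** [d0] is the degree found by the program and [d] the one in the bound; the smaller degree has the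
    longer block, so its [2 ^ (n - m0)] is at most [E]. *)
Lemma volume_le mm l D : params_spec n p k d0 mm l D ->
  exists2 X, X * 10 ^ n <= 19 ^ n & b ^ 3 * volume n mm D <= 432 * n.+1 ^ 3 * v ^ 2 * (E + X).
Proof.
case=> _ lmin _; set m0 := block n p d0 in lmin *.
have v0 : 0 < v by rewrite expn_gt0 (ltnW p1).
have E0 : 2 ^ (n - m0) <= E by rewrite leq_exp2l // leq_sub2l // block_anti.
case: leqP => [Dn [-> ->]|nD [-> ->]].
  exists (low_count (n - m0) (degree_bound p k d0 l) * 2 ^ m0).
    by apply: cube_bound => //; apply: block_le.
  apply: leq_mul; last by rewrite leq_add2r.
  apply: leq_trans size_cube_le _; rewrite -[v]expn1.
  apply: leq_mul; last exact: leq_pexp2l.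
  by apply: (@leq_trans (432 * 1)); rewrite // leq_mul2l /= expn_gt0.
exists 0 => //; rewrite addn0 /volume subn0 expn0 muln1.
(* Brute force was chosen, so by contraposition of [block_mode] the power [p ^ (2 * k)] is at least
   [2 ^ m0]. *)
have mv : 2 ^ m0 <= v ^ 2.
  rewrite leqNgt -expnM mulnC; apply/negP => H; move: nD; rewrite ltnNge => /negP; apply.
  exact: block_mode H.
have n2 : 2 ^ n = 2 ^ m0 * 2 ^ (n - m0) by rewrite -expnD subnKC // block_le.
apply: (@leq_trans (b ^ 3 * (2 * 2 ^ n))).
  by rewrite leq_mul2l mul2n -addnn leq_add2l low_count_max orbT.
rewrite n2 (_ : _ * (2 * _) = 2 * (b ^ 3 * 2 ^ m0) * 2 ^ (n - m0)); last by lia.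
apply: leq_mul => //; apply: leq_trans (leq_mul (leqnn 2) (size_cube_block (block_le _) mv)) _.
by rewrite !mulnA.
Qed.

(** Pays for moving the coefficients into the tables. If [3 * d] exceeds [n], the block is empty and
    [E] is all of [2 ^ n]. *)
Lemma low_count_bound :
  exists2 X, X * 10 ^ n <= 19 ^ n & low_count n d <= E + X.
Proof.
have [dn|nd] := leqP (3 * d) n.
  exists (low_count n d); last by rewrite leq_addl.
  by have := @cube_bound n 0 d (leq0n n); rewrite subn0 addn0 muln1; apply.
exists 0 => //; rewrite addn0 /block divn_small ?subn0 ?low_count_max //.
by apply: leq_trans nd _; nia.
Qed.

Lemma total_volume mm l D : params_spec n p k d0 mm l D ->
  exists2 X, X * 10 ^ n <= 2 * 19 ^ n &
    b ^ 3 * (volume n mm D + low_count n d) <= 432 * n.+1 ^ 3 * v ^ 2 * (2 * E + X).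
Proof.
move=> /volume_le[X1 X1n H1]; have [X2 X2n H2] := low_count_bound.
have v0 : 0 < v by rewrite expn_gt0 (ltnW p1).
exists (X1 + X2); first by rewrite mulnDl mul2n -addnn leq_add.
have H3 : b ^ 3 * low_count n d <= 432 * n.+1 ^ 3 * v ^ 2 * (E + X2).
  apply: leq_mul => //; apply: leq_trans size_cube_le _; rewrite -[v]expn1.
  apply: leq_mul; last exact: leq_pexp2l.
  by apply: (@leq_trans (432 * 1)); rewrite // leq_mul2l /= expn_gt0.
rewrite mulnDr (_ : 2 * E + (X1 + X2) = (E + X1) + (E + X2)); last by lia.
by rewrite mulnDr leq_add.
Qed.

End Bounds.

(** * Multivariate polynomials as lists of terms *)

Section Encoding.
Variables (p k d n : nat) (f : 'I_k -> {mpoly 'F_p[n]}).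
Hypotheses (p_pr : prime p) (fd : forall i : 'I_k, msize (f i) <= d.+1).

Definition exponents (m : 'X_{1..n}) : seq nat := [seq m j | j <- enum 'I_n].

Definition poly_terms (i : 'I_k) : seq term :=
  [seq (((f i)@_m)%R : nat, exponents m) | m <- msupp (f i)].

Definition all_terms := [seq poly_terms i | i <- enum 'I_k].

Lemma size_exponents m : size (exponents m) = n.
Proof. by rewrite size_map size_enum_ord. Qed.

Lemma nth_exponents m (j : 'I_n) : nth 0 (exponents m) j = m j.
Proof. by rewrite (nth_map j) ?size_enum_ord // nth_ord_enum. Qed.

Lemma size_supp_exponents m : size (supp (exponents m)) = \sum_(j < n) (m j != 0).
Proof.
rewrite size_supp -(big_mkord xpredT (fun j => nat_of_bool (nth 0 (exponents m) j != 0))).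
by rewrite size_exponents big_mkord; apply: eq_bigr => j _; rewrite nth_exponents.
Qed.

Lemma all_supp_exponents a m :
  all a (supp (exponents m)) = [forall j : 'I_n, (m j != 0) ==> a j].
Proof.
transitivity [forall j : 'I_n, (nth 0 (exponents m) j != 0) ==> a j].
  by move: (exponents m) (size_exponents m) => es <-; rewrite all_supp.
by apply: eq_forallb => j; rewrite nth_exponents.
Qed.

Lemma size_all_terms : size all_terms = k.
Proof. by rewrite size_map size_enum_ord. Qed.

Lemma encode_inputE :
  encode_input f = [:: n, k, p & flatten [seq encode_terms g | g <- all_terms]].
Proof.
rewrite /encode_input /all_terms -map_comp; congr [:: _, _, _ & flatten _].
apply: eq_map => i; rewrite /= /encode_poly /encode_terms /poly_terms -map_comp.
by congr rcons.
Qed.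

Lemma all_terms_valid : {in all_terms, forall g, all (valid_term n p) g}.
Proof.
move=> _ /mapP[i _ ->]; apply/allP => _ /mapP[m mf ->].
rewrite /valid_term /= size_exponents eqxx andbT; apply/andP; split.
  rewrite lt0n; move: mf; rewrite mcoeff_msupp; apply: contra => /eqP c0.
  by apply/eqP/val_inj.
by have := ltn_ord ((f i)@_m)%R; rewrite [X in _ < X -> _](Fp_cast p_pr).
Qed.

Lemma all_terms_degree :
  {in all_terms, forall g : seq term, {in g, forall t : term, size (supp t.2) <= d}}.
Proof.
move=> _ /mapP[i _ ->] _ /mapP[m mf ->]; rewrite size_supp_exponents.
rewrite -ltnS; apply: leq_trans (fd i); apply: leq_trans (msize_mdeg_lt mf).
by rewrite ltnS mdegE; apply: leq_sum => j _; case: (m j).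
Qed.

Lemma term_bitsE : term_bits p all_terms = input_bits f.
Proof.
rewrite /term_bits /input_bits big_map big_enum /=; apply: eq_bigr => i _.
rewrite /poly_terms big_map; apply: eq_bigr => m _; congr (_ + _).
by rewrite /exponent_bits big_map big_enum.
Qed.

Lemma polyval_terms z (i : 'I_k) :
  polyval p (poly_terms i) z = cube_value f i [ffun j : 'I_n => bit z j].
Proof.
rewrite /polyval -(val_Fp_nat p_pr) /cube_value; congr nat_of_ord.
rewrite natr_sum mevalE big_map; apply: eq_bigr => m _.
rewrite natrM natr_Zp; congr (_ * _)%R; rewrite all_supp_exponents.
case: (boolP [forall j : 'I_n, (m j != 0) ==> bit z j]) => [/forallP H|].
  rewrite big1 // => j _; rewrite ffunE; have := H j.
  by case: (m j) => [|e] /=; rewrite ?expr0 // => ->; rewrite expr1n.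
rewrite negb_forall => /existsP[j].
rewrite negb_imply => /andP[mj /negbTE bj].
by rewrite (bigD1 j) //= ffunE bj expr0n (negbTE mj) mul0r.
Qed.

Lemma sum_productE :
  \sum_(z < 2 ^ n) \prod_(g <- all_terms) polyval p g z = sum_product f.
Proof.
pose h (z : 'I_(2 ^ n)) : {ffun 'I_n -> bool} := [ffun j : 'I_n => bit z j].
have h_inj : injective h.
  move=> x y /ffunP xy; apply: val_inj; rewrite /= (bits_sum (ltn_ord x)) (bits_sum (ltn_ord y)).
  by apply: eq_bigr => j _; have := xy j; rewrite !ffunE => ->.
have h_bij : bijective h.
  by apply: inj_card_bij h_inj _; rewrite card_ffun card_bool !card_ord.
rewrite /sum_product (reindex h) /=; last exact: onW_bij.
apply: eq_bigr => z _; rewrite big_map big_enum /=; apply: eq_bigr => i _.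
exact: polyval_terms.
Qed.

(** For multilinear terms the mask determines the exponents, so the support injects into the points
    of weight at most [d]. *)
Lemma size_msupp_le (i : 'I_k) : (forall m, m \in msupp (f i) -> forall j, m j <= 1) ->
  size (msupp (f i)) <= low_count n d.
Proof.
move=> ml; pose g m := mask (exponents m).
have -> : low_count n d = size [seq z <- iota 0 (2 ^ n) | wt n z <= d].
  rewrite size_filter -sum1_count /low_count -(big_mkord xpredT (fun z => nat_of_bool (wt n z <= d))).
  by rewrite [RHS]big_mkcond /index_iota subn0; apply: eq_bigr => z _; case: (_ <= _).
rewrite -(size_map g); apply: uniq_leq_size.
  rewrite map_inj_in_uniq ?msupp_uniq // => m1 m2 m1f m2f gE; apply/mnmP => j.
  have := congr1 (bit ^~ j) gE; rewrite !bit_mask !nth_exponents.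
  by have := ml _ m1f j; have := ml _ m2f j; case: (m1 j) (m2 j) => [|[|?]] [|[|?]].
move=> _ /mapP[m mf ->]; rewrite mem_filter mem_iota /= add0n.
rewrite (wt_mask (size_exponents m)) -{1}(size_exponents m) mask_lt andbT.
have ffi : poly_terms i \in all_terms by apply: map_f; rewrite mem_enum.
exact: (all_terms_degree ffi (map_f (fun m => (((f i)@_m)%R : nat, exponents m)) mf)).
Qed.

(** Bounds the input size by a quantity already present in the running time, so that reading
    multilinear input needs no extra term. *)
Lemma multilinear_bits : multilinear_input f ->
  input_bits f <= n.+1 * (k * bitlen p * low_count n d).
Proof.
move=> ml; rewrite /input_bits.
apply: (@leq_trans (\sum_(i < k) (low_count n d * (n.+1 * bitlen p)))); last first.
  by rewrite sum_nat_const card_ord; lia.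
apply: leq_sum => i _; apply: (@leq_trans (size (msupp (f i)) * (n.+1 * bitlen p))); last first.
  by rewrite leq_mul2r size_msupp_le ?orbT // => m mf j; apply: ml mf j.
rewrite -sum1_size big_distrl /= big_seq [X in _ <= X]big_seq; apply: leq_sum => m mf.
have -> : \sum_(j < n) bitlen (m j) = n.
  transitivity (\sum_(j < n) 1); last by rewrite sum1_card card_ord.
  by apply: eq_bigr => j _; have := ml i m mf j; case: (m j) => [|[|?]].
by have := bitlen_gt0 p; nia.
Qed.

End Encoding.

(** * Transfer of the bounds to real numbers *)

Lemma INR_addn a b : INR (a + b) = Rplus (INR a) (INR b).
Proof. exact: plus_INR. Qed.

Lemma INR_muln a b : INR (a * b) = Rmult (INR a) (INR b).
Proof. by rewrite -mult_INR; congr INR; lia. Qed.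

Lemma INR_expn a e : INR (a ^ e) = pow (INR a) e.
Proof. by elim: e => [//|e IH]; rewrite expnS INR_muln IH. Qed.

Lemma INR_leq a b : a <= b -> Rle (INR a) (INR b).
Proof. by move=> /leP; apply: le_INR. Qed.

Section RealBounds.
Local Open Scope R_scope.

Lemma INR_pow_quotient X n : (X * 10 ^ n <= 2 * 19 ^ n)%N -> INR X <= 2 * (19 / 10) ^ n.
Proof.
move=> /INR_leq; rewrite !INR_muln !INR_expn => H.
have e10 : 0 < 10 ^ n by apply: pow_lt; lra.
have E : (19 / 10) ^ n * 10 ^ n = 19 ^ n by rewrite -Rpow_mult_distr; congr (_ ^ _); lra.
apply: (Rmult_le_reg_r (10 ^ n)) => //; rewrite Rmult_assoc E.
move: H; rewrite (_ : INR 10 = 10); last by rewrite INR_IZR_INZ.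
by rewrite (_ : INR 19 = 19); [rewrite (_ : INR 2 = 2)|rewrite INR_IZR_INZ].
Qed.

(** Rounding [n / (6 d p)] down loses at most 1 in the exponent, hence the factor 2. *)
Lemma INR_block n p d : (0 < p)%N -> (0 < d)%N ->
  INR (2 ^ (n - block n p d)) <= 2 * Rpower 2 (INR n - INR n / (6 * INR d * INR p)).
Proof.
move=> p0 d0; set q := block n p d.
have qn : (q <= n)%N by apply: leq_div.
have rp : 0 < INR p by apply: lt_0_INR; apply/ltP.
have rd : 0 < INR d by apply: lt_0_INR; apply/ltP.
have r6 : 0 < 6 * INR d * INR p by apply: Rmult_lt_0_compat => //; lra.
have nq : INR n <= (INR q + 1) * (6 * INR d * INR p).
  have H : (n <= (q + 1) * (6 * (d * p)))%N.
    by rewrite addn1; apply: ltnW; rewrite /q /block -ltn_divLR // !muln_gt0 d0.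
  have := INR_leq H; rewrite !INR_muln INR_addn.
  by rewrite (_ : INR 6 = 6); [rewrite (_ : INR 1 = 1) // => ?; lra|rewrite INR_IZR_INZ].
have le1 : INR n / (6 * INR d * INR p) <= INR q + 1.
  by apply: (Rmult_le_reg_r (6 * INR d * INR p)) => //; rewrite /Rdiv Rmult_assoc Rinv_l ?Rmult_1_r //; lra.
have -> : 2 * Rpower 2 (INR n - INR n / (6 * INR d * INR p))
    = Rpower 2 (1 + (INR n - INR n / (6 * INR d * INR p))).
  by rewrite Rpower_plus Rpower_1 //; lra.
rewrite INR_expn (_ : INR 2 = 2) // -Rpower_pow; last by lra.
apply: Rle_Rpower; first by lra.
by rewrite minus_INR; [lra|apply/leP].
Qed.

Lemma time_bound_ge p k d n E X : (0 < p)%N -> (0 < d)%N ->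
  E = (2 ^ (n - block n p d))%N -> (X * 10 ^ n <= 2 * 19 ^ n)%N ->
  INR ((p ^ k) ^ 2 * (2 * E + X)) <= 4 * time_bound p k d n.
Proof.
move=> p0 d0 EE /INR_pow_quotient HX; have := INR_block n p0 d0; rewrite -EE => HE.
have rp : 0 < INR p by apply: lt_0_INR; apply/ltP.
have vE : INR ((p ^ k) ^ 2) = INR p ^ (2 * k)%N by rewrite -expnM INR_expn mulnC.
have vp : 0 < INR p ^ (2 * k)%N by apply: pow_lt.
have e0 : 0 < (19 / 10) ^ n by apply: pow_lt; lra.
rewrite INR_muln vE INR_addn INR_muln (_ : INR 2 = 2) // /time_bound.
rewrite -Rmult_assoc (Rmult_comm 4) Rmult_assoc; apply: Rmult_le_compat_l; lra.
Qed.

Lemma time_bound_ge1 p d n : 1 <= time_bound p 0 d n.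
Proof.
rewrite /time_bound muln0 /= Rmult_1_l.
have : 1 <= (19 / 10) ^ n by apply: pow_R1_Rle; lra.
have : 0 < Rpower 2 (INR n - INR n / (6 * INR d * INR p)) by apply: exp_pos.
lra.
Qed.

Lemma time_le_poly K c T J n B : (T <= K * n.+1 ^ 7 * J)%N -> (4 * K + 7 <= c)%N ->
  INR J <= 4 * B -> time_le T (B * poly_factor c n).
Proof.
move=> /INR_leq TJ Kc JB; rewrite /time_le /poly_factor; apply: Rle_trans TJ _.
have B0 : 0 <= B by have := pos_INR J; lra.
have c7 : (4 * (K * n.+1 ^ 7) <= c * n.+1 ^ c)%N.
  by rewrite mulnA; apply: leq_mul; [lia|apply: leq_pexp2l => //; lia].
have H : 4 * INR (K * n.+1 ^ 7) <= INR (c * n.+1 ^ c).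
  by have := INR_leq c7; rewrite INR_muln (_ : INR 4 = 4) // INR_IZR_INZ.
have Kp := pos_INR (K * n.+1 ^ 7); rewrite (INR_muln (K * _)).
apply: Rle_trans (_ : INR (K * n.+1 ^ 7) * (4 * B) <= _); first exact: Rmult_le_compat_l.
rewrite -Rmult_assoc Rmult_comm; apply: Rmult_le_compat_l => //; lra.
Qed.

End RealBounds.

Theorem theorem6p1 :
  exists (P : program) (c : nat),
  forall (p k d n : nat) (f : 'I_k -> {mpoly 'F_p[n]}),
    prime p -> 0 < d -> (forall i : 'I_k, msize (f i) <= d.+1) ->
  exists T : nat,
    [/\ computes_in P (encode_input f) (sum_product f) T,
        multilinear_input f ->
          time_le T (Rmult (time_bound p k d n) (poly_factor c n))
      & time_le T (Rmult (Rplus (time_bound p k d n) (INR (input_bits f)))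
                         (poly_factor c n))].
Proof.
(* [total_cost] contributes [3000 * kappa] and [n.+1 ^ 3], [total_volume] contributes 432 and
   [n.+1 ^ 3]; multilinear input costs another factor 2 and one more [n.+1], whence 864 and the
   exponent 7. *)
pose K := 3000 * (864 * kappa).
exists main_program, (4 * K + 7) => p k d n f p_pr d0 fd.
have kap0 := kappa_gt0; have p1 := prime_gt1 p_pr; have p0 := prime_gt0 p_pr.
have a0 : 0 < n.+1 by []. set a := n.+1 in a0 *.
case: k f fd => [|k] f fd.
  have [T TC ex] := main_program0 n (p :: flatten [seq encode_terms g | g <- all_terms f]).
  have TK : T <= K * a ^ 7 * 1.
    apply: leq_trans TC _; rewrite muln1 mulnn.
    apply: (@leq_trans (8 * a * (kappa * a ^ 2))); first by rewrite leq_mul2r /a; lia.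
    rewrite (_ : 8 * a * (kappa * a ^ 2) = 8 * kappa * a ^ 3); last by rewrite !expnS expn0; lia.
    apply: leq_mul; last exact: leq_pexp2l.
    by rewrite /K; lia.
  have B1 := time_bound_ge1 p d n.
  exists T; split.
  - rewrite encode_inputE -(sum_productE f p_pr).
    have -> : all_terms f = [::] by apply: size0nil; rewrite size_all_terms.
    have -> : \sum_(z < 2 ^ n) \prod_(g <- [::]) polyval p g z = 2 ^ n.
      by under eq_bigr do rewrite big_nil; rewrite sum1_card card_ord.
    by move: ex; rewrite (_ : all_terms f = [::]) //; apply: size0nil; rewrite size_all_terms.
  - by move=> _; apply: time_le_poly TK _ _ => //=; lra.
  - by apply: time_le_poly TK _ _ => //=; have := pos_INR (input_bits f); lra.
set fs := all_terms f.
have fsv := all_terms_valid (f := f) p_pr; have fsd := all_terms_degree fd.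
have fsk : size fs = k.+1 := size_all_terms f.
have [mm [l [D Hp]]] := params_exists n k.+1 (max_degree fs) p1.
have dd : max_degree fs <= d := max_degree_le d0 fsd.
have m0 : 0 < max_degree fs by rewrite leq_max.
have [X Xn HX] := total_volume p1 (ltn0Sn k) m0 dd Hp.
set v := p ^ k.+1 in HX; set E := 2 ^ _ in HX.
pose J := v ^ 2 * (2 * E + X).
have JB : Rle (INR J) (Rmult 4 (time_bound p k.+1 d n)) := time_bound_ge k.+1 p0 d0 (erefl E) Xn.
set bl := k.+1 * bitlen p in HX; set S := low_count n d in HX.
set Y := bl ^ 3 * _ in HX.
have YJ : Y <= 432 * a ^ 3 * J by rewrite /J mulnA.
have [|T TC ex] := @main_programP n p k.+1 d fs p_pr (ltn0Sn k) fsk fsv fsd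
    (3000 * kappa * a ^ 3 * (Y + term_bits p fs)).
  by move=> mm' l' D' Hp'; have [<- <-] := params_unique p1 Hp Hp'.
have TK : T <= K * a ^ 7 * (J + input_bits f).
  apply: leq_trans TC _; rewrite term_bitsE /K.
  have H1 : Y + input_bits f <= 432 * a ^ 4 * (J + input_bits f).
    have e : 0 < a ^ 4 by rewrite expn_gt0.
    rewrite mulnDr; apply: leq_add; last by rewrite leq_pmull // muln_gt0 e.
    by apply: leq_trans YJ _; apply: leq_mul => //; apply: leq_mul => //; apply: leq_pexp2l.
  apply: leq_trans (leq_mul (leqnn _) H1) _.
  have -> : a ^ 7 = a ^ 3 * a ^ 4 by rewrite -expnD.
  by move: (a ^ 3) (a ^ 4) (J + _) => x y z; lia.
exists T; split.
- by rewrite encode_inputE -(sum_productE f p_pr).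
- move=> ml; apply: time_le_poly _ (leqnn _) JB.
  have H := multilinear_bits p_pr fd ml.
  have IY : input_bits f <= a * Y.
    apply: leq_trans H _; rewrite leq_mul2l /= -/bl -/S /Y mulnDr.
    apply: leq_trans (leq_addl _ _); apply: leq_mul => //.
    by rewrite -{1}[bl]expn1 leq_pexp2l // muln_gt0.
  apply: leq_trans TC _; rewrite term_bitsE /K.
  have H1 : Y + input_bits f <= 864 * a ^ 4 * J.
    apply: (@leq_trans (2 * (a * Y))); first by rewrite mul2n -addnn leq_add // leq_pmull.
    apply: leq_trans (leq_mul (leqnn 2) (leq_mul (leqnn a) YJ)) _.
    by rewrite (expnS a 3); move: (a ^ 3) => x; lia.
  apply: leq_trans (leq_mul (leqnn _) H1) _.
  have -> : a ^ 7 = a ^ 3 * a ^ 4 by rewrite -expnD.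
  by move: (a ^ 3) (a ^ 4) => x y; lia.
- apply: time_le_poly TK (leqnn _) _; rewrite INR_addn.
  have := pos_INR (input_bits f); lra.
Qed.
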